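(* Let $d \ge 2$ be an integer and let $p \ge 1$ be a real number, both fixed. There exists a constant $C_{d,p} > 0$, depending only on $d$ and $p$, such that for every $\epsilon \in (0,1/2)$, $$N_p(d,\epsilon) \le C_{d,p}\, \epsilon^{-\frac{2(d-1)}{d+2p}}.$$
   Context: For a linear subspace $E \subseteq L^p[0,1]$ and $\epsilon>0$, we say that $E$ admits a $(1+\epsilon)$-embedding into $\ell_p^N$ if there is a linear map $T:E\to \ell_p^N$ such that $\|x\|_p \le \|Tx\|_p \le (1+\epsilon)\|x\|_p$ for all $x\in E$. Here $\ell_p^N$ is $\mathbb{R}^N$ with the norm $\|v\|_p=(\sum_i |v_i|^p)^{1/p}$. $N_p(E,\epsilon)$ denotes the smallest $N$ such that $E$ admits a $(1+\epsilon)$-embedding into $\ell_p^N$, and $$N_p(d,\epsilon)=\sup\{N_p(E,\epsilon): E \text{ is a } d\text{-dimensional linear subspace of } L^p[0,1]\}.$$ *)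

(* Defs.v *)
From HB Require Import structures.
From mathcomp Require Import all_boot all_order all_algebra.
From mathcomp Require Import all_classical all_reals all_analysis.
From mathcomp Require Import measurable_realfun ess_sup_inf hoelder.

Set Implicit Arguments.
Unset Strict Implicit.
Unset Printing Implicit Defensive.
Import Order.TTheory GRing.Theory Num.Theory.
Import numFieldNormedType.Exports.

Local Open Scope classical_set_scope.
Local Open Scope ring_scope.

(* The library's [LspaceType mu p1] consists of the classes, modulo equality
   mu-almost everywhere, of measurable functions with finite p-norm, but it
   carries no algebraic structure. It is made here a vector space by operating
   on representatives. *)
Section Lspace_lmodule.
Context d (T : measurableType d) (R : realType).
Variables (mu : {measure set T -> \bar R}) (p : \bar R) (p1 : (1 <= p)%E).

Local Notation Lp := (LspaceType mu p1).
Local Notation mfunR := {mfun T >-> measurableTypeR R}.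
Local Notation mclass := {mfun_ mu, T >-> measurableTypeR R}.

Lemma Lnorm_ae_eq (f g : T -> R) :
  measurable_fun setT f -> measurable_fun setT g -> f = g %[ae mu] ->
  ('N[mu]_p[EFin \o f] = 'N[mu]_p[EFin \o g])%E.
Proof.
move=> mf mg fg; rewrite unlock /Lnorm; case: p p1 => [r r1| |].
- have mh (h : T -> R) : measurable_fun setT h ->
      measurable_fun setT (fun x => `|(EFin \o h) x| `^ r)%E.
    move=> mh; apply/measurable_EFinP.
    apply: (measurableT_comp (measurable_powR _)) => //.
    exact: measurableT_comp.
  congr (_ `^ _)%E; apply: ae_eq_integral => //; try exact: mh.
  by apply: filterS fg => x /(_ I) fgx _ /=; rewrite fgx.
- case: ifPn => // _ _; apply: eq_ess_sup.
  by apply: filterS fg => x /(_ I) fgx /=; rewrite fgx.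
- by [].
Qed.

Definition Lspace_fun (x : Lp) : T -> R := LebesgueSpace.sort x.

Lemma measurable_Lspace_fun (x : Lp) : measurable_fun setT (Lspace_fun x).
Proof. exact: (@measurable_funPT _ _ _ _ (repr (LebesgueSpace.sort x))). Qed.

Lemma Lspace_fun_Lfun (x : Lp) : Lspace_fun x \in Lfun mu p.
Proof.
rewrite inE; apply/andP; split; rewrite inE /=.
  exact: measurable_Lspace_fun.
exact: Lebesgue_finite.
Qed.

Lemma Lfun_measurable (f : T -> R) : f \in Lfun mu p -> measurable_fun setT f.
Proof. by rewrite inE => /andP[]; rewrite inE. Qed.

Definition Lspace_mfun (f : T -> R) (hf : f \in Lfun mu p) : mfunR :=
  HB.pack f (@isMeasurableFun.Build _ _ T (measurableTypeR R) f
              (Lfun_measurable hf)).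

Definition Lspace_class (f : T -> R) (hf : f \in Lfun mu p) : mclass :=
  \pi_mclass%qT (Lspace_mfun hf).

Lemma Lspace_class_ae (f : T -> R) (hf : f \in Lfun mu p) :
  (Lspace_class hf : T -> R) = f %[ae mu].
Proof.
by have /eqP := reprK (Lspace_class hf); rewrite eqmodE => /asboolP.
Qed.

Lemma Lspace_class_finite (f : T -> R) (hf : f \in Lfun mu p) :
  finite_norm mu p (Lspace_class hf).
Proof.
rewrite /finite_norm (@Lnorm_ae_eq _ f); last exact: Lspace_class_ae.
- by move: hf; rewrite inE => /andP[_]; rewrite inE.
- exact: (@measurable_funPT _ _ _ _ (repr (Lspace_class hf))).
- exact: Lfun_measurable.
Qed.

Definition to_Lspace (f : T -> R) (hf : f \in Lfun mu p) : Lp :=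
  HB.pack (Lspace_class hf)
    (@isFinLebesgue.Build _ T R mu p p1 _ (Lspace_class_finite hf)).

Lemma to_LspaceE (f : T -> R) (hf : f \in Lfun mu p) :
  Lspace_fun (to_Lspace hf) = f %[ae mu].
Proof. exact: Lspace_class_ae. Qed.

Lemma Lspace_eqP (x y : Lp) :
  x = y <-> Lspace_fun x = Lspace_fun y %[ae mu].
Proof.
split=> [->|xy]; first exact: ae_eq_refl.
case: x y xy => [x [[hx]]] [y [[hy]]]; rewrite /Lspace_fun /= => xy.
have exy : x = y.
  by rewrite -[x]reprK -[y]reprK; apply/eqP; rewrite eqmodE; apply/asboolP.
by case: _ / exy hy {xy} => hy; rewrite (Prop_irrelevance hx hy).
Qed.

HB.instance Definition _ := gen_eqMixin Lp.
HB.instance Definition _ := gen_choiceMixin Lp.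

Let Lfun0 : (0 : T -> R) \in Lfun mu p.
Proof. by case: (Lfun_submod_closed mu p1). Qed.

Let LfunZ a (f : T -> R) : f \in Lfun mu p -> a *: f \in Lfun mu p.
Proof.
by move=> hf; rewrite -[_ *: _]addr0; case: (Lfun_submod_closed mu p1) => ? ->.
Qed.

Let LfunN (f : T -> R) : f \in Lfun mu p -> - f \in Lfun mu p.
Proof. by move=> hf; rewrite -scaleN1r LfunZ. Qed.

Let LfunD (f g : T -> R) :
  f \in Lfun mu p -> g \in Lfun mu p -> f + g \in Lfun mu p.
Proof.
by move=> hf hg; rewrite -[f]scale1r; case: (Lfun_submod_closed mu p1) => ? ->.
Qed.

Definition Lspace_zero : Lp := to_Lspace Lfun0.
Definition Lspace_opp (x : Lp) : Lp := to_Lspace (LfunN (Lspace_fun_Lfun x)).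
Definition Lspace_add (x y : Lp) : Lp :=
  to_Lspace (LfunD (Lspace_fun_Lfun x) (Lspace_fun_Lfun y)).
Definition Lspace_scale (a : R) (x : Lp) : Lp :=
  to_Lspace (LfunZ a (Lspace_fun_Lfun x)).

Let Lspace_zeroE : \forall t \ae mu, Lspace_fun Lspace_zero t = 0.
Proof. by apply: filterS (to_LspaceE Lfun0) => t /(_ I). Qed.

Let Lspace_oppE x :
  \forall t \ae mu, Lspace_fun (Lspace_opp x) t = - Lspace_fun x t.
Proof. by apply: filterS (to_LspaceE (LfunN (Lspace_fun_Lfun x))) => t /(_ I). Qed.

Let Lspace_addE x y : \forall t \ae mu,
  Lspace_fun (Lspace_add x y) t = Lspace_fun x t + Lspace_fun y t.
Proof.
have := to_LspaceE (LfunD (Lspace_fun_Lfun x) (Lspace_fun_Lfun y)).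
by apply: filterS => t /(_ I).
Qed.

Let Lspace_scaleE a x : \forall t \ae mu,
  Lspace_fun (Lspace_scale a x) t = a * Lspace_fun x t.
Proof. by apply: filterS (to_LspaceE (LfunZ a (Lspace_fun_Lfun x))) => t /(_ I). Qed.

Let Lspace_addA : associative Lspace_add.
Proof.
move=> x y z; apply/Lspace_eqP.
apply: (filterS2 _ _
  (filterI (Lspace_addE (Lspace_add x y) z) (Lspace_addE x y))
  (filterI (Lspace_addE x (Lspace_add y z)) (Lspace_addE y z)))
  => t [h1 h2] [h3 h4] _.
by rewrite h1 h2 h3 h4 addrA.
Qed.

Let Lspace_addC : commutative Lspace_add.
Proof.
move=> x y; apply/Lspace_eqP.
apply: (filterS2 _ _
  (Lspace_addE y x)
  (Lspace_addE x y))
  => t h1 h2 _.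
by rewrite h1 h2 addrC.
Qed.

Let Lspace_add0 : left_id Lspace_zero Lspace_add.
Proof.
move=> x; apply/Lspace_eqP.
apply: (filterS2 _ _
  (Lspace_zeroE)
  (Lspace_addE Lspace_zero x))
  => t h1 h2 _.
by rewrite h2 h1 add0r.
Qed.

Let Lspace_addN : left_inverse Lspace_zero Lspace_opp Lspace_add.
Proof.
move=> x; apply/Lspace_eqP.
apply: (filterS3 _ _
  (Lspace_oppE x)
  (Lspace_zeroE)
  (Lspace_addE (Lspace_opp x) x))
  => t h1 h2 h3 _.
by rewrite h3 h2 h1 addNr.
Qed.

HB.instance Definition _ := GRing.isZmodule.Build Lp
  Lspace_addA Lspace_addC Lspace_add0 Lspace_addN.

Let Lspace_scaleA a b x :
  Lspace_scale a (Lspace_scale b x) = Lspace_scale (a * b) x.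
Proof.
apply/Lspace_eqP.
apply: (filterS3 _ _
  (Lspace_scaleE (a * b) x)
  (Lspace_scaleE b x)
  (Lspace_scaleE a (Lspace_scale b x)))
  => t h1 h2 h3 _.
by rewrite h3 h2 h1 mulrA.
Qed.

Let Lspace_scale1 : left_id 1 Lspace_scale.
Proof.
move=> x; apply/Lspace_eqP; apply: (filterS _
  (Lspace_scaleE 1 x))
  => t h _.
by rewrite h mul1r.
Qed.

Let Lspace_scaleDr : right_distributive Lspace_scale +%R.
Proof.
move=> a x y; apply/Lspace_eqP.
apply: (filterS3 _ _
  (filterI (Lspace_scaleE a x) (Lspace_scaleE a y))
  (Lspace_addE (Lspace_scale a x) (Lspace_scale a y))
  (filterI (Lspace_scaleE a (Lspace_add x y)) (Lspace_addE x y)))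
  => t [h1 h2] h3 [h4 h5] _.
by rewrite h4 h5 h3 h1 h2 mulrDr.
Qed.

Let Lspace_scaleDl x : {morph Lspace_scale^~ x : a b / a + b}.
Proof.
move=> a b; apply/Lspace_eqP.
apply: (filterS3 _ _
  (Lspace_scaleE (a + b) x)
  (Lspace_addE (Lspace_scale a x) (Lspace_scale b x))
  (filterI (Lspace_scaleE a x) (Lspace_scaleE b x)))
  => t h1 h2 [h3 h4] _.
by rewrite h1 h2 h3 h4 mulrDl.
Qed.

HB.instance Definition _ := GRing.Zmodule_isLmodule.Build R Lp
  Lspace_scaleA Lspace_scale1 Lspace_scaleDr Lspace_scaleDl.

End Lspace_lmodule.

(* [Lspace_fun] is a representative, so these hold only almost everywhere. *)
Section Lspace_ops.
Context d (T : measurableType d) (R : realType).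
Variables (mu : {measure set T -> \bar R}) (p : \bar R) (p1 : (1 <= p)%E).
Implicit Types x y : LspaceType mu p1.

Lemma Lspace_fun0 : Lspace_fun (0 : LspaceType mu p1) = (fun=> 0) %[ae mu].
Proof. exact: to_LspaceE. Qed.

Lemma Lspace_funD x y :
  Lspace_fun (x + y) = Lspace_fun x + Lspace_fun y %[ae mu].
Proof. exact: to_LspaceE. Qed.

Lemma Lspace_funZ a x : Lspace_fun (a *: x) = a *: Lspace_fun x %[ae mu].
Proof. exact: to_LspaceE. Qed.

End Lspace_ops.

Definition has_dim (K : fieldType) (V : lmodType K) (E : submodClosed V)
    (d : nat) : Prop :=
  exists b : 'I_d -> V,
    (forall c : 'I_d -> K, \sum_i c i *: b i = 0 -> forall i, c i = 0) /\
    (forall x : V, x \in E <-> exists c : 'I_d -> K, x = \sum_i c i *: b i).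

Definition linear_on (K : fieldType) (V W : lmodType K) (E : submodClosed V)
    (T : V -> W) : Prop :=
  forall a : K, {in E &, forall x y, T (a *: x + y) = a *: T x + T y}.

Section embeddings.
Context (R : realType).

(* L^p[0,1] is realized as L^p of the real line for the Lebesgue measure
   restricted to [0,1], so that values outside [0,1] are irrelevant. *)
Definition lebesgue01 : {measure set (measurableTypeR R) -> \bar R} :=
  mrestr lebesgue_measure
    (measurable_itv `[0%R, 1%R]
      : measurable (`[0%R, 1%R] : set (measurableTypeR R))).

Variables (p : R) (p1 : 1 <= p).

Lemma lee1_EFin : (1 <= p%:E)%E.
Proof. by rewrite lee_fin. Qed.

Definition Lp01 : lmodType R := LspaceType lebesgue01 lee1_EFin.

Definition Lp01_norm (x : Lp01) : R :=
  fine ('N[lebesgue01]_(p%:E)[EFin \o Lspace_fun x])%E.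

Definition lp_norm (N : nat) (v : 'rV[R]_N) : R :=
  (\sum_i `|v ord0 i| `^ p) `^ p^-1.

Definition embeds (E : submodClosed Lp01) (eps : R) (N : nat) : Prop :=
  exists T : Lp01 -> 'rV[R]_N, linear_on E T /\
    {in E, forall x,
      Lp01_norm x <= lp_norm (T x) <= (1 + eps) * Lp01_norm x}.

(* The smallest [N] is taken in [\bar R], with value [+oo] if there is none;
   see [subspace_Np_min]. *)
Definition subspace_Np (E : submodClosed Lp01) (eps : R) : \bar R :=
  ereal_inf [set N%:R%:E | N in [set N : nat | embeds E eps N]].

Definition Np (d : nat) (eps : R) : \bar R :=
  ereal_sup [set subspace_Np E eps | E in
    [set E : submodClosed Lp01 | has_dim E d]].

Lemma subspace_Np_min (E : submodClosed Lp01) (eps : R) (N : nat) :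
  embeds E eps N -> exists M : nat,
    [/\ embeds E eps M, (forall M', embeds E eps M' -> (M <= M')%N)
      & subspace_Np E eps = M%:R%:E].
Proof.
move=> eN; have ex : exists n, `[< embeds E eps n >] by exists N; apply/asboolP.
case: (ex_minnP ex) => M /asboolP eM Mmin.
have {}Mmin M' : embeds E eps M' -> (M <= M')%N.
  by move=> e; apply: Mmin; apply/asboolP.
exists M; split => //; apply/eqP; rewrite eq_le; apply/andP; split.
  by apply: ereal_inf_lbound; exists M.
by apply: le_ereal_inf_tmp => _ [M' /= e <-]; rewrite lee_fin ler_nat Mmin.
Qed.

End embeddings.

(* Main.v *)
Require Import Defs.
From HB Require Import structures.
From mathcomp Require Import all_boot all_order all_algebra perm.
From mathcomp Require Import all_classical all_reals all_analysis.
From mathcomp Require Import measurable_realfun.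
From mathcomp Require Import zify lra.
Import Order.TTheory GRing.Theory Num.Theory.
Import numFieldNormedType.Exports.

Set Implicit Arguments.
Unset Strict Implicit.
Unset Printing Implicit Defensive.

(* Write d = m + 1 and b = 1/2 + (2p+1)/(2m), so that 1/b = 2(d-1)/(d+2p). In
   the coordinates of a basis with bounded coordinate functionals, and up to an
   arbitrarily small distortion, the norm of E is (sum_u |<u,x>|^p)^(1/p) for
   finitely many atoms u in R^d. The number of atoms is then reduced by
   discrepancy. For n atoms of l1-norm at most 1 there is a partial coloring
   y in {-1,0,1}^n, with a fixed proportion of nonzero entries, such that
   sum_i y_i |<u_i,x>|^p = O(n^(1/2 - (2p+1)/(2m))) uniformly on the cube:
   dropping the atoms with y_i = -1 and multiplying those with y_i = 1 by
   2^(1/p) removes a fixed proportion of the atoms, and iterating this down to N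
   atoms leaves a total error O(N^(-b)), which is at most of order eps as soon as
   N is of order eps^(-1/b).

   The partial coloring comes from the entropy method along a chaining on each
   face of the cube. The quasi-metric Delta(x,y) bounds the squared l2-distance
   between the vectors (|<u_i,y>|^p)_i and their Taylor polynomials at x.
   Haussler's packing lemma, for half-spaces, shows that a net of scale
   n delta^(2p+1) for Delta has only O(delta^(-m)) points, so there are
   O(delta^(-m)) pieces on which these vectors are almost polynomials of bounded
   degree; a polynomial is controlled by its values at finitely many Fekete
   points, and the differences of polynomials between consecutive scales are the
   constraints imposed on the coloring. *)

(** * Packing sets of bounded VC dimension *)

Section traces.

(** The exponent is decided by the singularity of |t|^p at 0. When a point moves by delta, an atom
    whose hyperplane is at distance about a spoils the Taylor expansion by about delta^p min(1,
    delta/a). After squaring and summing, only the atoms with a = O(delta) matter: a fraction delta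
    of them if they are evenly spread, whence n delta^(2p+1). For atoms in arbitrary position this
    count fails at some points, and Haussler's lemma replaces it, bounding the size of a net of that
    scale whatever the atoms are. A coloring of n signs can meet O(n) constraints, which is the
    number of pieces at delta = n^(-1/m); there the l2-norm of a link of the chain is of order (n
    delta^(2p+1))^(1/2) = n^(1/2 - (2p+1)/(2m)). Coarser scales have few constraints, imposed far
    below the standard deviation, and finer ones have many, imposed far above it, so that both
    entropy costs and discrepancies decay geometrically away from that scale. As the bound is
    uniform in the atoms, they must have comparable weights: only the light ones are colored. *)

Definition flip n (i : 'I_n) (t : n.-tuple bool) : n.-tuple bool :=
  [tuple (if j == i then ~~ tnth t j else tnth t j) | j < n].

(* The support of [w] shatters no [k] coordinates; repetitions in [f] are
   harmless, since repeated coordinates can never be shattered. *)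
Definition unshattered k n (w : n.-tuple bool -> nat) : Prop :=
  forall f : 'I_k -> 'I_n, exists b : 'I_k -> bool,
    forall t, 0 < w t -> exists i, tnth t (f i) != b i.

(* Sum over the edges {t, t'} of the cube of the minimum of [w t] and [w t']. *)
Fixpoint edge_weight n : (n.-tuple bool -> nat) -> nat :=
  match n with
  | 0 => fun=> 0
  | n'.+1 => fun w =>
      \sum_(t : n'.-tuple bool) minn (w (cons_tuple false t)) (w (cons_tuple true t))
      + (edge_weight (fun t => w (cons_tuple false t))
         + edge_weight (fun t => w (cons_tuple true t)))
  end.

Lemma big_tuple_cons n (P : pred (n.+1.-tuple bool)) (F : n.+1.-tuple bool -> nat) :
  \sum_(t | P t) F t =
  \sum_(t | P (cons_tuple false t)) F (cons_tuple false t)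
  + \sum_(t | P (cons_tuple true t)) F (cons_tuple true t).
Proof.
pose h (p : bool * n.-tuple bool) := cons_tuple p.1 p.2.
pose h' (t : n.+1.-tuple bool) := (thead t, behead_tuple t).
rewrite (reindex h) /=; last first.
  exists h' => [[b t] _|t _]; rewrite /h /h' /=.
    by congr (_, _); apply/val_inj.
  by rewrite [RHS]tuple_eta; apply/val_inj.
rewrite -(pair_big_dep predT (fun b t => P (cons_tuple b t))
   (fun b t => F (cons_tuple b t))) /=.
by rewrite big_bool /= addnC.
Qed.

(** Compression: replacing two weights by their maximum and minimum keeps the total weight and can
    only gain edge weight. This is how the two halves of a cube are recombined in
    [edge_weight_le]. *)
Lemma edge_weight_supermodular n (v w : n.-tuple bool -> nat) :
  edge_weight v + edge_weight w <=
  edge_weight (fun t => maxn (v t) (w t)) + edge_weight (fun t => minn (v t) (w t)).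
Proof.
elim: n => [//|n IHn] in v w *; rewrite /=.
have /= := IHn (fun t => v (cons_tuple false t)) (fun t => w (cons_tuple false t)).
have /= := IHn (fun t => v (cons_tuple true t)) (fun t => w (cons_tuple true t)).
have : \sum_(t : n.-tuple bool) minn (v (cons_tuple false t)) (v (cons_tuple true t)) +
  \sum_(t : n.-tuple bool) minn (w (cons_tuple false t)) (w (cons_tuple true t)) <=
  \sum_(t : n.-tuple bool) minn (maxn (v (cons_tuple false t)) (w (cons_tuple false t)))
     (maxn (v (cons_tuple true t)) (w (cons_tuple true t))) +
  \sum_(t : n.-tuple bool) minn (minn (v (cons_tuple false t)) (w (cons_tuple false t)))
     (minn (v (cons_tuple true t)) (w (cons_tuple true t))).
  rewrite -!big_split /=; apply: leq_sum => t _.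
  move: (v _) (v _) (w _) (w _) => a b c e.
  by rewrite /minn /maxn; do !case: ifPn => ?; lia.
move=> hS hT hF; rewrite addnACA [X in _ <= X]addnACA.
by apply: leq_add => //; rewrite addnACA [X in _ <= X]addnACA; exact: leq_add.
Qed.

Lemma unshattered_max k n (w : n.+1.-tuple bool -> nat) : unshattered k w ->
  unshattered k (fun t => maxn (w (cons_tuple false t)) (w (cons_tuple true t))).
Proof.
move=> hw f; have [b hb] := hw (fun i => lift ord0 (f i)); exists b => t.
have [h h'|h _] := posnP (w (cons_tuple true t)).
  have [|i] := hb (cons_tuple false t); first lia.
  by rewrite tnthS => ?; exists i.
have [//|i] := hb (cons_tuple true t).
by rewrite tnthS => ?; exists i.
Qed.

(** A point where the minimum is positive extends to the support with both values of the first
    coordinate, so adjoining that coordinate to a shattered family would give a longer shattered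
    one. *)
Lemma unshattered_min k n (w : n.+1.-tuple bool -> nat) : unshattered k.+1 w ->
  unshattered k (fun t => minn (w (cons_tuple false t)) (w (cons_tuple true t))).
Proof.
move=> hw f.
have [b hb] := hw (fun i => if unlift ord0 i is Some j then lift ord0 (f j) else ord0).
exists (fun i => b (lift ord0 i)) => t h.
have [|i] := hb (cons_tuple (~~ ~~ b ord0) t).
  by case: (b ord0) => /=; lia.
case: unliftP => [j ->|->].
  by rewrite tnthS => ?; exists j.
by rewrite tnth0 negbK eqxx.
Qed.

Lemma unshattered0 n (w : n.-tuple bool -> nat) : unshattered 0 w -> forall t, w t = 0.
Proof.
move=> hw t; have [//|wt] := posnP (w t).
have f0 : 'I_0 -> 'I_n by case.
by have [b /(_ t wt)[[]]] := hw f0.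
Qed.

Lemma edge_weight0 n (w : n.-tuple bool -> nat) : (forall t, w t = 0) ->
  edge_weight w = 0.
Proof.
elim: n => [//|n IHn] in w * => w0; rewrite /= !IHn //.
by rewrite big1 // => t _; rewrite !w0.
Qed.

(** The edge density of the trace graph is at most the VC dimension, here weighted because several
    points may share a trace. After compression on the first coordinate, the maximum contributes [k]
    times its sum and the minimum one time less; the edges in the first direction supply exactly the
    missing sum of minima. *)
Lemma edge_weight_le k n (w : n.-tuple bool -> nat) : unshattered k.+1 w ->
  edge_weight w <= k * \sum_t w t.
Proof.
elim: n => [//|n IHn] in k w *; move=> hw; rewrite /= big_tuple_cons /=.
have /= h1 := edge_weight_supermodular (fun t => w (cons_tuple false t))
  (fun t => w (cons_tuple true t)).
have h2 := IHn k _ (unshattered_max hw).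
have e : \sum_(t : n.-tuple bool) w (cons_tuple false t)
    + \sum_(t : n.-tuple bool) w (cons_tuple true t) =
  \sum_(t : n.-tuple bool) maxn (w (cons_tuple false t)) (w (cons_tuple true t)) +
  \sum_(t : n.-tuple bool) minn (w (cons_tuple false t)) (w (cons_tuple true t)).
  by rewrite -!big_split /=; apply: eq_bigr => t _; lia.
rewrite e {e}; move: h1 h2 (unshattered_min hw).
case: k => [|k] in hw *.
  move=> h1 h2 /unshattered0 h3; rewrite (edge_weight0 h3) addn0 in h1.
  rewrite big1 ?add0n; last by move=> t _; exact: h3.
  by rewrite mul0n; exact: leq_trans h1 h2.
move=> h1 h2 /IHn h3; rewrite addnC mulnDr.
apply: leq_trans (leq_add (leq_trans h1 (leq_add h2 h3)) (leqnn _)) _.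
by rewrite -addnA leq_add2l mulSn addnC.
Qed.

(** Sauer-Shelah with a crude bound, by the same split: the maximum and the minimum together count
    the occupied traces. *)
Lemma trace_card_le k n (w : n.-tuple bool -> nat) : unshattered k.+1 w ->
  \sum_t (0 < w t) <= n.+1 ^ k.
Proof.
elim: n => [|n IHn] in k w *; move=> hw.
  rewrite exp1n (eq_bigl (xpred1 [tuple])); last by move=> t; rewrite tuple0 eqxx.
  by rewrite big_pred1_eq; case: (0 < _).
rewrite big_tuple_cons /=.
have e : \sum_(t : n.-tuple bool) (0 < w (cons_tuple false t))
    + \sum_(t : n.-tuple bool) (0 < w (cons_tuple true t)) =
  \sum_(t : n.-tuple bool) (0 < maxn (w (cons_tuple false t)) (w (cons_tuple true t))) +
  \sum_(t : n.-tuple bool) (0 < minn (w (cons_tuple false t)) (w (cons_tuple true t))).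
  by rewrite -!big_split /=; apply: eq_bigr => t _; lia.
rewrite e.
have h2 := IHn k _ (unshattered_max hw).
have := unshattered_min hw.
case: k => [|k] in h2 hw *.
  move=> /unshattered0 h3; rewrite [X in _ + X]big1; last by move=> t _; rewrite h3.
  by rewrite addn0 expn0 in h2 *.
move=> /IHn h3; apply: leq_trans (leq_add h2 h3) _.
have : n.+1 ^ k <= n.+2 ^ k by case: (k) => // k'; rewrite leq_exp2r.
rewrite !expnS -mulSnr => h; exact: leq_mul.
Qed.

Lemma edge_weight_dir n (w : n.-tuple bool -> nat) :
  edge_weight w = \sum_(i < n) \sum_(t | ~~ tnth t i) minn (w t) (w (flip i t)).
Proof.
have c0 m b (t : m.-tuple bool) : tnth (cons_tuple b t) ord0 = b by rewrite tnth0.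
have cS m b (t : m.-tuple bool) i : tnth (cons_tuple b t) (lift ord0 i) = tnth t i.
  by rewrite tnthS.
have f0 m b (t : m.-tuple bool) : flip ord0 (cons_tuple b t) = cons_tuple (~~ b) t.
  apply: eq_from_tnth => j; rewrite tnth_mktuple.
  by case: (unliftP ord0 j) => [k ->|->]; rewrite ?cS ?c0.
have fS m b (t : m.-tuple bool) i :
    flip (lift ord0 i) (cons_tuple b t) = cons_tuple b (flip i t).
  apply: eq_from_tnth => j; rewrite tnth_mktuple.
  by case: (unliftP ord0 j) => [k ->|->];
    rewrite ?cS ?c0 ?tnth_mktuple ?(inj_eq (@lift_inj _ _)).
elim: n => [|n IHn] in w *; first by rewrite big_ord0.
rewrite /= big_ord_recl; congr (_ + _).
  rewrite big_tuple_cons [X in (_ + X)%N]big_pred0; last by move=> t; rewrite c0.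
  by rewrite addn0; apply: eq_big => [t|t _]; rewrite ?c0 ?f0.
rewrite !IHn -big_split /=; apply: eq_bigr => i _.
by rewrite big_tuple_cons; congr (_ + _); apply: eq_big => t; rewrite ?cS ?fS.
Qed.

Lemma flipK n (i : 'I_n) : involutive (flip i).
Proof.
move=> t; apply: eq_from_tnth => j; rewrite !tnth_mktuple.
by case: (j == i) => //; rewrite negbK.
Qed.

Lemma tnth_flip n (i : 'I_n) t j :
  tnth (flip i t) j = if j == i then ~~ tnth t j else tnth t j.
Proof. by rewrite tnth_mktuple. Qed.

Lemma sum_tuple_flip n (i : 'I_n) (F : n.-tuple bool -> nat) :
  \sum_t F t = \sum_(t | ~~ tnth t i) (F t + F (flip i t)).
Proof.
rewrite big_split /= (bigID (fun t => ~~ tnth t i)) /=; congr (_ + _).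
rewrite (reindex_inj (inv_inj (@flipK n i))) /=.
by apply: eq_bigl => t; rewrite tnth_flip eqxx negbK.
Qed.

End traces.

Local Open Scope ring_scope.

Section packing.
Variables (R : realType) (H : finType) (om : H -> R).
Hypothesis om0 : forall h, 0 <= om h.
Hypothesis om1 : \sum_h om h = 1.
Variables (N D : nat) (a : 'I_N -> H -> bool) (delta : R).
Hypothesis delta0 : 0 < delta.
Hypothesis unsh : forall g : 'I_D.+1 -> H, exists b : 'I_D.+1 -> bool,
  forall x, exists i, a x (g i) != b i.
Hypothesis sep : forall x y, x != y ->
  delta <= \sum_(h | a x h != a y h) om h.

Variable s : nat.
Implicit Types T : {ffun 'I_s -> H}.

Definition trace T x : s.-tuple bool := [tuple a x (T i) | i < s].
Definition tcount T (t : s.-tuple bool) : nat := #|[set x | trace T x == t]|.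
Definition prob T : R := \prod_i om (T i).
Definition upd T i h : {ffun 'I_s -> H} := [ffun j => if j == i then h else T j].

Lemma prob_ge0 T : 0 <= prob T. Proof. exact: prodr_ge0. Qed.

Lemma sum_prob : \sum_T prob T = 1.
Proof.
rewrite /prob -(bigA_distr_bigA (fun _ : 'I_s => om)) /=.
by rewrite big1.
Qed.

(** Exchanging [T i] with an independent copy is an involution that preserves the product weight. *)
Lemma prob_resample i (F : {ffun 'I_s -> H} -> R) :
  \sum_T prob T * F T = \sum_T prob T * \sum_h om h * F (upd T i h).
Proof.
transitivity (\sum_(q : {ffun 'I_s -> H} * H) prob q.1 * om q.2 * F q.1).
  rewrite -(pair_bigA _ (fun T h => prob T * om h * F T)) /=.
  apply: eq_bigr => T _; rewrite -mulr_suml -mulr_sumr om1 mulr1 //.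
pose sw (q : {ffun 'I_s -> H} * H) := (upd q.1 i q.2, q.1 i).
have swK : involutive sw.
  move=> [T h]; rewrite /sw /=; congr pair; last by rewrite ffunE eqxx.
  by apply/ffunP => j; rewrite !ffunE; case: eqP => // ->.
rewrite (reindex_inj (inv_inj swK)) /=.
rewrite -(pair_bigA _ (fun T h => prob (upd T i h) * om (T i) * F (upd T i h))) /=.
apply: eq_bigr => T _; rewrite mulr_sumr; apply: eq_bigr => h _.
rewrite mulrA; congr (_ * _).
rewrite /prob (bigD1 i) //= [in RHS](bigD1 i) //= ffunE eqxx.
rewrite [X in om h * X](_ : _ = \prod_(j < s | j != i) om (T j)).
  by rewrite mulrAC [RHS]mulrAC [om h * _]mulrC.
by apply: eq_bigr => j /negPf ji; rewrite ffunE ji.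
Qed.

Lemma trace_unshattered T : unshattered D.+1 (tcount T).
Proof.
move=> f; have [b hb] := unsh (fun i => T (f i)); exists b => t.
rewrite card_gt0 => /set0Pn[x]; rewrite inE => /eqP <-.
by have [i hi] := hb x; exists i; rewrite tnth_mktuple.
Qed.

Lemma sum_tcount T : (\sum_t tcount T t = N)%N.
Proof.
rewrite -[RHS]card_ord -sum1_card (partition_big (trace T) predT) //=.
by apply: eq_bigr => t _; rewrite sum1_card /tcount cardsE.
Qed.

Lemma upd_tcount T i h t : tcount (upd T i h) t =
  #|[set x | [forall j, (j != i) ==> (a x (T j) == tnth t j)]
             & a x h == tnth t i]|.
Proof.
rewrite /tcount; apply: eq_card => x; rewrite !inE.
apply/eqP/andP => [<-|[/forallP h1 /eqP h2]].
  split; last by rewrite tnth_mktuple ffunE eqxx.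
  by apply/forallP => j; apply/implyP => /negPf ji; rewrite tnth_mktuple ffunE ji.
apply: eq_from_tnth => j; rewrite tnth_mktuple ffunE; case: eqP => [->//|/eqP ji].
exact/eqP/(implyP (h1 j)).
Qed.

(* If the other coordinates of the traces of x and y agree, resampling the
   [i]-th one separates them with probability at least [delta]; a class of c
   points thus becomes an edge of expected weight at least delta (c-1)/2. *)
Lemma resampled_direction T i :
  delta / 2 * (N%:R - (\sum_t (0 < tcount T t)%N)%:R) <=
  \sum_h om h * (\sum_(t | ~~ tnth t i)
    minn (tcount (upd T i h) t) (tcount (upd T i h) (flip i t)))%:R.
Proof.
(* The points whose trace agrees with [t] off the direction [i]: this fibre does not depend on the
   resampled function. *)
pose B (t : s.-tuple bool) := [set x | [forall j, (j != i) ==> (a x (T j) == tnth t j)]].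
have BE t : ~~ tnth t i -> #|B t| = (tcount T t + tcount T (flip i t))%N.
  move=> ti; have -> : T = upd T i (T i).
    by apply/ffunP => j; rewrite ffunE; case: eqP => // ->.
  rewrite !upd_tcount.
  rewrite -(cardsID [set x | ~~ a x (T i)] (B t)); congr (_ + _)%N.
    by apply: eq_card => x; rewrite !inE (negPf ti) eqbF_neg.
  apply: eq_card => x; rewrite !inE tnth_flip eqxx ti eqb_id negbK andbC.
  congr (_ && _); apply: eq_forallb => j; rewrite tnth_flip; case: eqP => //.
rewrite -{1}(sum_tcount T) (sum_tuple_flip i) /=.
rewrite (sum_tuple_flip i (fun t => (0 < tcount T t)%N : nat)) /=.
under [leRHS]eq_bigr do rewrite natr_sum mulr_sumr.
rewrite exchange_big /= !natr_sum -sumrB mulr_sumr; apply: ler_sum => t ti.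
rewrite -BE //.
have [B0|B0] := posnP #|B t|.
  apply: le_trans (_ : 0 <= _); last by apply: sumr_ge0 => h _; rewrite mulr_ge0.
  by rewrite pmulr_rle0 ?divr_gt0 // B0 subr_le0 ler_nat.
pose A h : {set 'I_N} := [set x in B t | ~~ a x h].
pose A' h : {set 'I_N} := [set x in B t | a x h].
have AE h : tcount (upd T i h) t = #|A h|.
  by rewrite upd_tcount; apply: eq_card => x; rewrite !inE (negPf ti) eqbF_neg.
have AE' h : tcount (upd T i h) (flip i t) = #|A' h|.
  rewrite upd_tcount; apply: eq_card => x; rewrite !inE tnth_flip eqxx ti eqb_id.
  congr (_ && _); apply: eq_forallb => j; rewrite tnth_flip; case: eqP => //.
have AA h : (#|A h| + #|A' h|)%N = #|B t|.
  rewrite -(cardsID [set x | ~~ a x h] (B t)); congr (_ + _)%N.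
    by apply: eq_card => x; rewrite !inE.
  by apply: eq_card => x; rewrite !inE negbK andbC.
apply: le_trans (_ : delta / 2 * (#|B t|%:R - 1) <= _).
  rewrite ler_pM2l ?divr_gt0 // lerD2l lerN2 (ler_nat _ 1).
  move: B0; rewrite BE // addn_gt0; lia.
(* uv/(u+v) <= min(u,v), and the left side has a computable expectation: u v counts the pairs of the
   fibre that [h] separates. *)
have key h : (#|A h| * #|A' h|)%N%:R / #|B t|%:R <=
   (minn (tcount (upd T i h) t) (tcount (upd T i h) (flip i t)))%:R :> R.
  rewrite AE AE' ler_pdivrMr ?ltr0n // -natrM ler_nat -(AA h).
  move: #|A h| #|A' h| => u v; rewrite /minn; case: ifPn => _; nia.
apply: le_trans (_ : \sum_h om h * ((#|A h| * #|A' h|)%N%:R / #|B t|%:R) <= _); last first.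
  by apply: ler_sum => h _; rewrite ler_wpM2l.
under eq_bigr do rewrite mulrA.
rewrite -mulr_suml ler_pdivlMr ?ltr0n //.
have prodE h : (#|A h| * #|A' h|)%N%:R =
   \sum_(x in B t) \sum_(y in B t) (~~ a x h && a y h)%:R :> R.
  rewrite natrM -!sum1_card !natr_sum.
  have -> (C : {set 'I_N}) : \sum_(x in C) 1%:R = \sum_x (x \in C)%:R :> R.
    by rewrite big_mkcond /=; apply: eq_bigr => x _; case: ifP.
  rewrite mulr_suml [RHS]big_mkcond; apply: eq_bigr => x _; rewrite !inE.
  case: ifP => /= hx; last by rewrite mul0r.
  have -> (C : {set 'I_N}) : \sum_(x in C) 1%:R = \sum_x (x \in C)%:R :> R.
    by rewrite big_mkcond /=; apply: eq_bigr => y _; case: ifP.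
  rewrite mulr_sumr [RHS]big_mkcond; apply: eq_bigr => y _; rewrite !inE.
  by case: ifP => /= hy; rewrite ?mulr0 // -natrM mulnb.
have sE : \sum_h om h * (#|A h| * #|A' h|)%N%:R =
   \sum_(x in B t) \sum_(y in B t) \sum_h om h * (~~ a x h && a y h)%:R.
  under eq_bigr do rewrite prodE mulr_sumr.
  rewrite exchange_big /=; apply: eq_bigr => x _.
  under eq_bigr do rewrite mulr_sumr.
  by rewrite exchange_big.
have sE2 : 2 * \sum_h om h * (#|A h| * #|A' h|)%N%:R =
   \sum_(x in B t) \sum_(y in B t) \sum_(h | a x h != a y h) om h.
  rewrite mulr_natl mulr2n {1}sE sE [X in X + _]exchange_big -big_split /=.
  apply: eq_bigr => x _; rewrite -big_split /=; apply: eq_bigr => y _.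
  rewrite -big_split [RHS]big_mkcond /=; apply: eq_bigr => h _.
  rewrite -mulrDr; case: (a x h); case: (a y h); rewrite /= ?addr0 ?add0r ?mulr1 ?mulr0 //.
suff : delta * (#|B t|%:R - 1) * #|B t|%:R <= 2 * \sum_h om h * (#|A h| * #|A' h|)%N%:R.
  lra.
rewrite sE2 mulr_natr -sumr_const; apply: ler_sum => x xB.
apply: le_trans (_ : \sum_(y in B t :\ x) delta <= _).
  rewrite sumr_const -[leRHS]mulr_natr ler_pM2l // [in leLHS](cardsD1 x) xB natrD.
  by rewrite addrC addKr.
rewrite [leRHS](big_setD1 x) //=; apply: ler_wpDl; first exact: sumr_ge0.
by apply: ler_sum => y; rewrite !inE eq_sym => /andP[xy _]; exact: sep.
Qed.

(** Double counting of the expected edge weight of the traces on a random sample of size [s]: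
    [edge_weight_le] bounds it from above, and [resampled_direction] bounds the share of each of the
    [s] directions from below. *)
Lemma packing_sample : s%:R * (delta / 2) * (N%:R - (s.+1 ^ D)%N%:R) <= (D * N)%N%:R.
Proof.
have EW : \sum_T prob T * (edge_weight (tcount T))%:R <= (D * N)%N%:R.
  rewrite -[leRHS]mul1r -[X in X * _]sum_prob mulr_suml; apply: ler_sum => T _.
  apply: ler_wpM2l; first exact: prob_ge0.
  rewrite ler_nat -[leqRHS]/(D * N)%N -[N in leqRHS](sum_tcount T).
  exact/edge_weight_le/trace_unshattered.
apply: le_trans EW.
under eq_bigr do rewrite edge_weight_dir natr_sum mulr_sumr.
rewrite exchange_big /=.
have sE : s%:R = \sum_(i < s) 1 :> R by rewrite sumr_const card_ord.
rewrite -mulrA [X in X * _ <= _]sE mulr_suml.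
apply: ler_sum => i _; rewrite mul1r (prob_resample i).
rewrite -[leLHS]mul1r -[X in X * _]sum_prob mulr_suml; apply: ler_sum => T _.
rewrite ler_wpM2l ?prob_ge0 //; apply: le_trans (resampled_direction T i).
rewrite ler_pM2l ?divr_gt0 // lerD2l lerN2 ler_nat.
exact/trace_card_le/trace_unshattered.
Qed.

End packing.

Lemma packing_bound (R : realType) (H : finType) (om : H -> R) (N D : nat)
    (a : 'I_N -> H -> bool) (delta : R) : (0 < D)%N ->
  (forall h, 0 <= om h) -> \sum_h om h = 1 -> 0 < delta <= 1 ->
  (forall g : 'I_D.+1 -> H, exists b : 'I_D.+1 -> bool,
     forall x, exists i, a x (g i) != b i) ->
  (forall x y, x != y -> delta <= \sum_(h | a x h != a y h) om h) ->
  N%:R <= 2 * (4 * D%:R + 2) ^+ D * delta^-1 ^+ D.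
Proof.
move=> Dpos om0 om1 /andP[d0 d1] unsh sep.
(* For s >= 4D/delta, and S = (s+1)^D < N, [packing_sample] gives 2D(N - S) <= DN, that is N <=
   2S. *)
have [s hs1 hs2] : exists2 s : nat, 4 * D%:R / delta <= s%:R & s%:R <= 4 * D%:R / delta + 1.
  exists (Num.truncn (4 * D%:R / delta)).+1.
    exact/ltW/truncnS_gt.
  rewrite -natr1 lerD2r truncn_le // divr_ge0 // ?mulr_ge0 //; exact: ltW.
have := packing_sample om0 om1 d0 unsh sep s.
have hD : (s.+1 ^ D)%N%:R <= (4 * D%:R + 2) ^+ D * delta^-1 ^+ D :> R.
  rewrite -exprMn natrX lerXn2r ?nnegrE //.
    by rewrite mulr_ge0 ?invr_ge0 ?addr_ge0 ?mulr_ge0 // ltW.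
  rewrite -[s.+1%:R]natr1; apply: le_trans (lerD hs2 (lexx 1)) _.
  have : 1 <= delta^-1 by rewrite invf_ge1.
  by rewrite mulrDl; lra.
set X := _ * _ in hD *; set S := (_ ^ _)%N%:R in hD *.
rewrite natrM => h.
suff NS2 : N%:R <= 2 * S.
  apply: le_trans NS2 _.
  by rewrite -mulrA ler_pM2l.
have [NS|NS] := leP N%:R S.
  by have : 0 <= S by [exact: ler0n]; lra.
have D0 : 0 < D%:R :> R by rewrite ltr0n.
have : 2 * D%:R * (N%:R - S) <= D%:R * N%:R.
  apply: le_trans h; rewrite ler_pM2r ?subr_gt0 //.
  by rewrite mulrA ler_pdivlMr // -ler_pdivrMr //; lra.
by rewrite -mulrA mulrCA ler_pM2l //; lra.
Qed.

(** * Fekete points *)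

Section fekete.
Variables (R : realType) (T : Type) (r : nat) (Y : set T) (F : T -> 'rV[R]_r) (B : R).
Hypothesis FB : forall y, Y y -> forall i, `|F y 0 i| <= B.

Let frame q (z : 'I_q -> T) := \matrix_(s < q) F (z s).

(** The values of [F] on [Y] may span a proper subspace; a maximal free family fixes the dimension
    in which the determinants of [fekete_frame] are taken, so that they do not all vanish. *)
Lemma max_frame : exists q (z : 'I_q -> T), [/\ (q <= r)%N, (forall s, Y (z s)),
  row_free (frame z) & forall y, Y y -> (F y <= frame z)%MS].
Proof.
pose Q q := `[< exists z : 'I_q -> T, (forall s, Y (z s)) /\ row_free (frame z) >].
have exQ : exists q, Q q.
  exists 0; apply/asboolP; unshelve eexists; first by case.
  by split=> [[]//|]; rewrite -row_leq_rank.
have Qr q : Q q -> (q <= r)%N.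
  by move=> /asboolP[z [_ /eqP <-]]; exact: rank_leq_col.
case: (ex_maxnP exQ Qr) => q /asboolP[z [Yz fz]] qmax.
exists q, z; split=> //; first by apply: Qr; apply/asboolP; exists z.
move=> y Yy; apply/negPn/negP => nFy.
have /qmax : Q q.+1; last by rewrite ltnn.
apply/asboolP.
pose z' (s : 'I_(1 + q)) := match fintype.split s with inl _ => y | inr j => z j end.
exists z'; split.
  by move=> s; rewrite /z'; case: fintype.split.
have -> : frame z' = col_mx (F y) (frame z).
  apply/row_matrixP => s; rewrite rowK /z'.
  rewrite -[s in RHS]splitK; case: fintype.split => j /=.
    by rewrite rowKu [j]ord1 row_id.
  by rewrite rowKd rowK.
rewrite /row_free eqn_leq rank_leq_row /=.
have -> : \rank (col_mx (F y) (frame z)) = \rank (F y + frame z)%MS.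
  by rewrite addsmxE.
apply: (@leq_ltn_trans (\rank (frame z))); first by rewrite (eqP fz).
apply: rank_ltmx.
by rewrite /ltmx addsmxSr /= addsmx_sub submx_refl andbT.
Qed.

(* [z] maximizes the determinant up to a factor 2, and the coefficients [c] are
   then given by Cramer's rule. *)
Lemma fekete_frame : exists q (z : 'I_q -> T), [/\ (q <= r)%N, (forall s, Y (z s)) &
  forall y, Y y -> exists c : 'I_q -> R, (forall s, `|c s| <= 2) /\
    F y = \sum_s c s *: F (z s)].
Proof.
have [q [z0 [qr Yz0 fz0 span]]] := max_frame.
set A := frame z0 in fz0 span.
pose k y := F y *m pinvmx A.
have kA y : Y y -> k y *m A = F y by move=> Yy; rewrite mulmxKpV // span.
pose K (w : 'I_q -> T) := \matrix_(s < q) k (w s).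
have KA w : (forall s, Y (w s)) -> K w *m A = frame w.
  by move=> Yw; apply/row_matrixP => s; rewrite row_mul !rowK kA.
have Kz0 : K z0 = 1%:M.
  by apply: (row_free_inj fz0); rewrite KA // mul1mx.
pose B' := \sum_i \sum_j B * `|pinvmx A i j|.
have kB y : Y y -> forall j, `|k y 0 j| <= B'.
  move=> Yy j; rewrite mxE; apply: le_trans (ler_norm_sum _ _ _) _.
  apply: ler_sum => i _; rewrite normrM (bigD1 j) //=.
  apply: ler_wpDr; last by rewrite ler_wpM2r ?FB.
  apply: sumr_ge0 => l _; rewrite mulr_ge0 //.
  exact: le_trans (normr_ge0 _) (FB Yy i).
pose S : set R := (fun x => exists2 w, (forall s, Y (w s)) & x = `|\det (K w)|).
have Sub x : S x -> x <= \sum_(s : 'S_q) \prod_(i < q) B'.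
  move=> [w Yw ->]; apply: le_trans (ler_norm_sum _ _ _) _.
  apply: ler_sum => s _; rewrite normrM normrX normrN1 expr1n mul1r normr_prod.
  apply: ler_prod => i _; rewrite normr_ge0 /=.
  by rewrite !mxE; have := kB (w i) (Yw i) (s i); rewrite mxE.
have S1 : S 1 by exists z0 => //; rewrite Kz0 det1 normr1.
have supS : has_sup S by split; [exists 1|exists (\sum_(s : 'S_q) \prod_(i < q) B') => x /Sub].
have sup1 : 1 <= sup S by exact: ub_le_sup supS.2 _ S1.
(* [Y] is an arbitrary set, so the supremum may not be attained; a frame beating half of it gives
   coefficients bounded by 2 instead of 1. *)
have half : sup S / 2 < sup S by lra.
have [x [w Yw xE] xS] := sup_gt (ex_intro _ 1 S1) half.
have dw : 0 < `|\det (K w)| by rewrite -xE; lra.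
have uw : K w \in unitmx by rewrite unitmxE unitfE -normr_gt0.
exists q, w; split=> // y Yy.
pose c := k y *m invmx (K w).
exists (fun s => c 0 s); split; last first.
  have -> : F y = c *m frame w by rewrite -KA // mulmxA mulmxKV // kA.
  by rewrite mulmx_sum_row; apply: eq_bigr => s _; rewrite rowK.
move=> s; pose w' i := if i == s then y else w i.
have Yw' i : Y (w' i) by rewrite /w'; case: ifP.
have -> : c 0 s = \det (K w') / \det (K w).
  rewrite /c /invmx uw -scalemxAr mxE mulrC; congr (_ / _).
  rewrite mxE (expand_det_row _ s); apply: eq_bigr => j _.
  congr (_ * _); first by rewrite [RHS]mxE /w' eqxx.
  rewrite [LHS]mxE /cofactor; congr (_ * \det _).
  apply/matrixP => i l; rewrite !mxE /w'.
  by rewrite eq_sym (negPf (neq_lift _ _)).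
rewrite normrM normfV ler_pdivrMr //.
have : `|\det (K w')| <= sup S by apply: ub_le_sup supS.2 _ _; exists w'.
rewrite -xE; lra.
Qed.

End fekete.

(** Padding the frame with [y0] and zero coefficients gives exactly [r] points, so that all the
    pieces of a chaining share one index type. *)
Lemma fekete (R : realType) (T : Type) (r : nat) (Y : set T) (y0 : T)
    (F : T -> 'rV[R]_r) (B : R) : Y y0 ->
  (forall y, Y y -> forall i, `|F y 0 i| <= B) ->
  exists z : 'I_r -> T, (forall s, Y (z s)) /\
    forall y, Y y -> exists c : 'I_r -> R, (forall s, `|c s| <= 2) /\
      F y = \sum_s c s *: F (z s).
Proof.
move=> Y0 FB; have [q [z [qr Yz h]]] := fekete_frame FB.
pose z' (s : 'I_r) := if insub (s : nat) is Some j then z j else y0.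
exists z'; split=> [s|y /h[c [c2 Fy]]]; first by rewrite /z'; case: insub.
exists (fun s => if insub (s : nat) is Some j then c j else 0); split.
  by move=> s; case: insub => [j|] //; rewrite normr0.
pose g i := if insub i is Some j then c j *: F (z j) else 0.
rewrite Fy (eq_bigr (fun s : 'I_q => g s)); last by move=> s _; rewrite /g valK.
rewrite (big_ord_widen _ g qr) big_mkcond; apply: eq_bigr => s _.
rewrite /g /z'; case: insubP => [j -> _ //|/negPf ->].
by rewrite scale0r.
Qed.

(** * The entropy method *)

Section elementary.
Variable R : realType.
Implicit Types t x l : R.

(** A random sign is sub-Gaussian; the crude constant in the exponent lets 1 + x <= exp x do most of
    the work. *)
Lemma expR_add_opp_le t : expR t + expR (- t) <= 2 * expR (2 * t ^+ 2).
Proof.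
wlog t0 : t / 0 <= t => [hw|].
  have [/hw //|/ltW t0] := leP 0 t.
  by have := hw (- t); rewrite opprK sqrrN addrC; apply; rewrite oppr_ge0.
have [t1|t1] := leP t 2^-1; last first.
  have h1 : expR t <= expR (2 * t ^+ 2).
    by rewrite ler_expR expr2; nra.
  have h2 : expR (- t) <= expR (2 * t ^+ 2).
    by rewrite ler_expR expr2; nra.
  lra.
have h1 : expR t <= 1 + t + 2 * t ^+ 2.
  have h := expR_ge1Dx (- t); rewrite expRN in h.
  have e0 := expR_gt0 t.
  have : (1 - t) * expR t <= 1.
    by rewrite -ler_pdivlMr // mul1r.
  move=> h3; rewrite -(ler_pM2l (_ : 0 < 1 - t)); last lra.
  apply: le_trans h3 _; rewrite expr2; nra.
have h2 : expR (- t) <= 1 - t + 2 * t ^+ 2.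
  have h := expR_ge1Dx t; have e0 := expR_gt0 t.
  rewrite expRN -[leLHS]mul1r ler_pdivrMr //.
  apply: le_trans (_ : (1 - t + 2 * t ^+ 2) * (1 + t) <= _).
    by rewrite expr2; nra.
  by rewrite ler_wpM2l // expr2; nra.
have := expR_ge1Dx (2 * t ^+ 2); lra.
Qed.

Lemma sum_expr_le x n : 0 <= x < 1 -> \sum_(k < n) x ^+ k <= (1 - x)^-1.
Proof.
move=> /andP[x0 x1]; rewrite -[leRHS]mul1r ler_pdivlMr ?subr_gt0 //.
have -> : (\sum_(k < n) x ^+ k) * (1 - x) = 1 - x ^+ n.
  by rewrite -[RHS]opprB subrX1 mulrC -mulNr opprB.
by rewrite gerBl exprn_ge0.
Qed.

Lemma sum_expr_dist_le x n : 0 <= x < 1 ->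
  \sum_(k < (n + n).+1) x ^+ `|k%:Z - n%:Z|%N <= 1 + 2 * (x / (1 - x)).
Proof.
move=> x01; have /andP[x0 x1] := x01.
rewrite -addnS big_split_ord /=.
rewrite (reindex_inj rev_ord_inj) /=.
rewrite (eq_bigr (fun k : 'I_n => x * x ^+ k)); last first.
  by move=> k _; rewrite -exprS; congr (_ ^+ _); have := ltn_ord k; lia.
rewrite -mulr_sumr.
rewrite (eq_bigr (fun k : 'I_n.+1 => x ^+ k)); last first.
  by move=> k _; congr (_ ^+ _); lia.
apply: le_trans (lerD (ler_wpM2l x0 (sum_expr_le n x01)) (sum_expr_le n.+1 x01)) _.
have e : (1 - x) * (1 - x)^-1 = 1 by rewrite mulfV // subr_eq0 gt_eqF.
lra.
Qed.

(** Turns an exponential moment into a bound on the mean of |x| over the tail |x| >= l. *)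
Lemma norm_le_expR_tail x l : l <= `|x| ->
  `|x| <= (expR (2 * x) + expR (- (2 * x))) * expR (- l).
Proof.
move=> lx; have h : expR (2 * `|x|) <= expR (2 * x) + expR (- (2 * x)).
  by case: (ger0P x) => x0; rewrite ?mulrN ?lerDl ?lerDr expR_ge0.
apply: le_trans (_ : expR (2 * `|x|) * expR (- l) <= _); last first.
  by rewrite ler_wpM2r // expR_ge0.
rewrite -expRD; apply: le_trans (expR_ge1Dx _); lra.
Qed.

End elementary.

Section partial_coloring.
Variable R : realType.

(* Bounds the entropy of the rounding, to multiples of 2 l, of a signed sum
   with variance at most 1. *)
Definition coloring_cost (l : R) : R :=
  2 * expR 8 * expR (- l) + ln (1 + 2 * (expR l - 1)^-1).

Variables (n : nat) (Q : finType) (v : Q -> 'I_n -> R) (sg lam : Q -> R).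
Hypothesis n0 : (0 < n)%N.
Hypothesis sg0 : forall q, 0 < sg q.
Hypothesis lam0 : forall q, 0 < lam q.
Hypothesis vsg : forall q, \sum_i v q i ^+ 2 <= sg q ^+ 2.
Hypothesis budget : \sum_q coloring_cost (lam q) <= n%:R / 8.

Implicit Types s : {ffun 'I_n -> bool}.

Let z q s : R := \sum_i (-1) ^+ s i * (v q i / sg q).
(** The nearest integer to z/(2 lam). It vanishes as soon as |z| < lam, which is why a constraint
    with a large [lam] is nearly free. *)
Let b q s : int := Num.floor (z q s / (2 * lam q) + 2^-1).

Let moment q (e : bool) : \sum_s expR (2 * ((-1) ^+ e * z q s)) <= 2 ^+ n * expR 8.
Proof.
under eq_bigr do rewrite /z !mulr_sumr expR_sum.
rewrite -(bigA_distr_bigA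
  (fun i (c : bool) => expR (2 * ((-1) ^+ e * ((-1) ^+ c * (v q i / sg q)))))).
rewrite /=; apply: le_trans (_ : \prod_(i < n) (2 * expR (8 * (v q i / sg q) ^+ 2)) <= _).
  apply: ler_prod => i _; apply/andP; split; first by apply: sumr_ge0 => c _; exact: expR_ge0.
  rewrite big_bool /= expr0 expr1.
  set t := v q i / sg q.
  have := expR_add_opp_le (2 * t).
  rewrite (_ : 2 * (2 * t) ^+ 2 = 8 * t ^+ 2); last by lra.
  case: e; rewrite ?expr1 ?expr0 ?mul1r ?mulN1r ?opprK ?mulrN //.
  by rewrite addrC.
rewrite big_split /= prodr_const card_ord ler_wpM2l ?exprn_ge0 //.
rewrite -expR_sum ler_expR -mulr_sumr -[leRHS]mulr1 ler_wpM2l //.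
under eq_bigr do rewrite exprMn.
rewrite -mulr_suml exprVn ler_pdivrMr ?exprn_gt0 // mul1r; exact: vsg.
Qed.

Let cost_pointwise q s : lam q * `|b q s|%:~R <=
  (expR (2 * z q s) + expR (- (2 * z q s))) * expR (- lam q).
Proof.
have l0 := lam0 q.
have [h|h] := leP (lam q) `|z q s|; last first.
  have -> : b q s = 0.
    apply/eqP; rewrite floor_eq.
    move: h; rewrite ltr_norml => /andP[h1 h2].
    rewrite add0r; apply/andP; split.
      rewrite -lerBlDr sub0r ler_pdivlMr ?mulr_gt0 //; lra.
    rewrite -ltrBrDr ltr_pdivrMr ?mulr_gt0 //; lra.
  by rewrite normr0 mulr0 mulr_ge0 ?addr_ge0 ?expR_ge0.
apply: le_trans (norm_le_expR_tail h).
have := floor_itv (z q s / (2 * lam q) + 2^-1); rewrite -/(b q s) => /andP[h1 h2].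
rewrite intrD in h2.
have z1 : z q s / (2 * lam q) * (2 * lam q) = z q s.
  by rewrite mulfVK // mulf_neq0 // gt_eqF.
move: h1 h2 z1; set u := z q s / _ => h1 h2 z1.
rewrite intr_norm; set B := (b q s)%:~R in h1 h2 *.
have [B0|B0] := ger0P B; have [z0|z0] := ger0P (z q s);
  rewrite ?(ger0_norm z0) ?(ltr0_norm z0) in h; nra.
Qed.

Let Bd : nat := \max_q \max_s `|b q s|%N.
Let bBd q s : (`|b q s|%N <= Bd)%N.
Proof.
apply: leq_trans (leq_bigmax (F := fun q => \max_s `|b q s|%N) q).
exact: (leq_bigmax (F := fun s => `|b q s|%N)).
Qed.

Let enc s : {ffun Q -> 'I_(Bd + Bd).+1} := [ffun q => inord (absz (b q s + Bd%:Z))].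
Let dec (k : 'I_(Bd + Bd).+1) : int := k%:Z - Bd%:Z.

Let encK q s : dec (enc s q) = b q s.
Proof.
rewrite /dec ffunE inordK; have := bBd q s; lia.
Qed.

(** An energy, which replaces an entropy inequality: the sum of exp(-energy) over colorings is
    bounded below through the mean energy, the one over codes is a product over [Q], and their
    quotient bounds the size of the most popular code from below. *)
Let code_cost (be : {ffun Q -> 'I_(Bd + Bd).+1}) : R :=
  \sum_q lam q * `|dec (be q)|%:~R.

Let T : R := \sum_q 2 * expR 8 * expR (- lam q).

Let avg_cost : \sum_s code_cost (enc s) <= 2 ^+ n * T.
Proof.
rewrite /code_cost exchange_big /= /T mulr_sumr; apply: ler_sum => q _.
apply: le_trans (_ : \sum_s (expR (2 * z q s) + expR (- (2 * z q s))) * expR (- lam q) <= _).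
  by apply: ler_sum => s _; rewrite encK; exact: cost_pointwise.
rewrite -mulr_suml !mulrA ler_wpM2r ?expR_ge0 // big_split /=.
have h0 : \sum_s expR (2 * z q s) <= 2 ^+ n * expR 8.
  apply: le_trans (moment q false); rewrite le_eqVlt; apply/orP; left; apply/eqP/eq_bigr => s _.
  by rewrite [(-1) ^+ _]expr0 mul1r.
have h1 : \sum_s expR (- (2 * z q s)) <= 2 ^+ n * expR 8.
  apply: le_trans (moment q true); rewrite le_eqVlt; apply/orP; left; apply/eqP/eq_bigr => s _.
  by rewrite [(-1) ^+ _]expr1 mulN1r mulrN.
by apply: le_trans (lerD h0 h1) _; lra.
Qed.

(** Jensen's inequality for the exponential, through its tangent at -T. *)
Let sum_cost_lower : 2 ^+ n * expR (- T) <= \sum_s expR (- code_cost (enc s)).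
Proof.
apply: le_trans (_ : \sum_s expR (- T) * (1 + T - code_cost (enc s)) <= _); last first.
  apply: ler_sum => s _.
  have -> : - code_cost (enc s) = - T + (T - code_cost (enc s)) by lra.
  rewrite expRD ler_pM2l ?expR_gt0 //.
  apply: le_trans (expR_ge1Dx _); lra.
rewrite -mulr_sumr mulrC ler_pM2l ?expR_gt0 // sumrB sumr_const card_ffun card_bool card_ord.
rewrite -[(1 + T) *+ _]mulr_natl natrX mulrDr mulr1; have := avg_cost; lra.
Qed.

Let sum_cost_upper (K : nat) : (forall be, #|[set s | enc s == be]| <= K)%N ->
  \sum_s expR (- code_cost (enc s)) <= K%:R * \prod_q (1 + 2 * (expR (lam q) - 1)^-1).
Proof.
move=> hK; rewrite (partition_big enc predT) //=.
apply: le_trans (_ : \sum_be K%:R * expR (- code_cost be) <= _).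
  apply: ler_sum => be _.
  rewrite (eq_bigr (fun=> expR (- code_cost be))); last by move=> s /eqP ->.
  rewrite sumr_const -[leLHS]mulr_natl ler_wpM2r ?expR_ge0 // ler_nat.
  by apply: leq_trans (hK be); rewrite cardsE.
rewrite -mulr_sumr ler_wpM2l //.
rewrite (eq_bigr
  (fun be : {ffun Q -> _} => \prod_q expR (- (lam q * `|dec (be q)|%:~R)))); last first.
  by move=> be _; rewrite -expR_sum sumrN.
rewrite -(bigA_distr_bigA (fun q k => expR (- (lam q * `|dec k|%:~R)))) /=.
apply: ler_prod => q _; apply/andP; split; first by apply: sumr_ge0 => c _; exact: expR_ge0.
have x01 : 0 <= expR (- lam q) < 1.
  by rewrite expR_ge0 expR_lt1 oppr_lt0 lam0.
have := sum_expr_dist_le Bd x01.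
have -> : expR (- lam q) / (1 - expR (- lam q)) = (expR (lam q) - 1)^-1.
  have e1 : expR (lam q) - 1 != 0 by rewrite gt_eqF // subr_gt0 expR_gt1.
  have e0 : expR (lam q) != 0 by rewrite gt_eqF // expR_gt0.
  rewrite expRN -[in 1 - _](mulfV e0) -[X in _ - X]mul1r -mulrBl invf_div.
  by rewrite mulrA mulVf // mul1r.
apply: le_trans; apply: ler_sum => k _.
by rewrite -expRM_natr mulNr -abszE.
Qed.

Let large_bucket : exists be, 2 ^+ n * expR (- (n%:R / 8)) <= #|[set s | enc s == be]|%:R :> R.
Proof.
have [be _ hmax] := @arg_maxnP _ (enc [ffun=> false]) predT
  (fun be => #|[set s | enc s == be]|) isT.
exists be; have := le_trans sum_cost_lower (sum_cost_upper (fun c => hmax c isT)).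
set K := #|_|.
have Z0 q : 0 < 1 + 2 * (expR (lam q) - 1)^-1.
  by rewrite ltr_pwDl // mulr_ge0 // invr_ge0 subr_ge0 ltW // expR_gt1.
have -> : \prod_q (1 + 2 * (expR (lam q) - 1)^-1) =
    expR (\sum_q ln (1 + 2 * (expR (lam q) - 1)^-1)).
  by rewrite expR_sum; apply: eq_bigr => q _; rewrite lnK // posrE Z0.
rewrite -ler_pdivrMr ?expR_gt0 // -expRN -mulrA -expRD; apply: le_trans.
rewrite ler_pM2l ?exprn_gt0 // ler_expR.
move: budget; rewrite /coloring_cost big_split /= -/T; lra.
Qed.

Let hdist (s s' : {ffun 'I_n -> bool}) : nat := #|[set i | s i != s' i]|.

Let hamming_sum s0 : \sum_s expR (-1) ^+ hdist s s0 = (1 + expR (-1)) ^+ n :> R.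
Proof.
transitivity (\sum_(s : {ffun 'I_n -> bool}) \prod_i (if s i != s0 i then expR (-1) else 1) : R).
  apply: eq_bigr => s _; rewrite -big_mkcond /= prodr_const; congr (_ ^+ _).
  by rewrite /hdist cardsE.
rewrite -(bigA_distr_bigA (fun i c => if c != s0 i then expR (-1) else 1)) /=.
rewrite (eq_bigr (fun=> 1 + expR (-1))); first by rewrite prodr_const card_ord.
by move=> i _; rewrite big_bool; case: (s0 i) => //=; rewrite addrC.
Qed.

(** A bucket within Hamming distance n/8 of one of its points would have at most exp(n/8) (1 +
    1/e)^n elements, by the exponential moment of the distance; this is less than 2^n exp(-n/8). *)
Let far_pair : exists s s0, enc s = enc s0 /\ (n <= 8 * hdist s s0)%N.
Proof.
have [be hbe] := large_bucket.
have [s0 /eqP s0be] : exists s0, enc s0 == be.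
  apply/existsP; apply: contraT => /existsPn he; move: hbe.
  rewrite (_ : #|_| = 0) ?leNgt ?mulr_gt0 ?exprn_gt0 ?expR_gt0 //.
  by apply: eq_card0 => s; rewrite inE; apply: negbTE; exact: he.
have [/existsP[s /andP[/eqP sbe far]]|] :=
  boolP [exists s, (enc s == be) && (n <= 8 * hdist s s0)%N].
  by exists s, s0; rewrite sbe.
rewrite negb_exists => /forallP near; exfalso.
have h : #|[set s | enc s == be]|%:R * expR (- (n%:R / 8)) <= (1 + expR (-1)) ^+ n :> R.
  rewrite -(hamming_sum s0) mulr_natl -sumr_const.
  rewrite [leRHS](bigID (fun s => enc s == be)) /=; apply: ler_wpDr.
    by apply: sumr_ge0 => s _; exact/exprn_ge0/expR_ge0.
  rewrite (eq_bigl (fun s => enc s == be)); last by move=> s; rewrite inE.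
  apply: ler_sum => s sbe; rewrite -expRM_natr ler_expR mulNr mul1r lerN2.
  have := near s; rewrite sbe /= -ltnNge => /ltnW.
  by rewrite -(ler_nat R) natrM ler_pdivlMr // mulrC.
have {}h := le_trans (ler_wpM2r (expR_ge0 _) hbe) h.
rewrite -mulrA -expRD in h.
have e : - (n%:R / 8) + - (n%:R / 8) = (- 4^-1 : R) * n%:R by lra.
rewrite e expRM_natr -exprMn in h.
move: h; rewrite leNgt => /negP; apply.
rewrite ltrXn2r ?gtn_eqF //.
(* It remains to see that 1 + x^4 < 2x for x = exp(-1/4), which lies between 3/4 and 4/5. *)
have -> : expR (-1) = expR (- 4^-1) ^+ 4 :> R.
  by rewrite -expRM_natr; congr expR; lra.
have h1 : 1 + - 4^-1 <= expR (- 4^-1 : R) by exact: expR_ge1Dx.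
have h2 : expR (- 4^-1 : R) <= 4 / 5.
  rewrite expRN -[4 / 5]invrK lef_pV2 ?posrE ?expR_gt0 ?invr_gt0 //.
  apply: le_trans (expR_ge1Dx _); lra.
set x := expR _ in h1 h2 *.
have h3 : x ^+ 4 <= (4 / 5) ^+ 4 by rewrite lerXn2r ?nnegrE //; lra.
lra.
Qed.

(** Half the difference of two distant colorings with the same code: it vanishes exactly where they
    agree, and equal roundings bring each normalized signed sum within 2 lam of the other. *)
Lemma partial_coloring : exists y : 'I_n -> R,
  [/\ forall i, y i \in [:: -1; 0; 1], (n <= 8 * #|[set i | y i != 0%R]|)%N &
   forall q, `|\sum_i y i * v q i| <= lam q * sg q].
Proof.
have [s [s0 [eqs far]]] := far_pair.
exists (fun i => ((-1) ^+ s i - (-1) ^+ s0 i) / 2); split.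
- move=> i; case: (s i); case: (s0 i); rewrite !inE ?expr0 ?expr1 ?subrr ?mul0r ?eqxx ?orbT //.
    by rewrite (_ : (-1 - 1) / 2 = -1) ?eqxx //; lra.
  by rewrite (_ : (1 - -1) / 2 = 1) ?eqxx ?orbT //; lra.
- apply: leq_trans far _; rewrite leq_mul2l /=.
  apply/subset_leq_card/fintype.subsetP => i; rewrite !inE.
  case: (s i); case: (s0 i) => //= _.
    by rewrite expr0 expr1; apply/eqP; lra.
  by rewrite expr0 expr1; apply/eqP; lra.
- move=> q.
  have -> : \sum_i ((-1) ^+ s i - (-1) ^+ s0 i) / 2 * v q i = (z q s - z q s0) / 2 * sg q.
    rewrite /z -sumrB !mulr_suml; apply: eq_bigr => i _.
    by rewrite -{1}[v q i](divfK (_ : sg q != 0)) ?gt_eqF //; lra.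
  rewrite normrM (gtr0_norm (sg0 q)) ler_pM2r //.
  have bb : b q s = b q s0 by rewrite -!encK eqs.
  have := floor_itv (z q s / (2 * lam q) + 2^-1); rewrite -/(b q s).
  have := floor_itv (z q s0 / (2 * lam q) + 2^-1); rewrite -/(b q s0) bb.
  rewrite !intrD /= => /andP[h1 h2] /andP[h3 h4].
  have h5 : z q s0 / (2 * lam q) - 1 <= z q s / (2 * lam q) by lra.
  have h6 : z q s / (2 * lam q) <= z q s0 / (2 * lam q) + 1 by lra.
  have l2 : 0 < 2 * lam q by rewrite mulr_gt0.
  rewrite ler_pdivrMr // in h6; rewrite ler_pdivlMr // in h5.
  rewrite mulrDl mul1r mulfVK ?gt_eqF // in h6.
  rewrite mulrBl mul1r mulfVK ?gt_eqF // in h5.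
  rewrite ler_norml; lra.
Qed.

End partial_coloring.

Local Open Scope classical_set_scope.
Local Open Scope ring_scope.

(** * Taylor expansion of real powers *)

Lemma poly_antiderivative (R : realFieldType) (P : {poly R}) (k : nat) :
  (size P <= k)%N -> exists Q : {poly R}, (size Q <= k.+1)%N /\ Q^`() = P.
Proof.
move=> sP; exists (\poly_(i < k.+1) (P`_i.-1 / i%:R)); split; first exact: size_poly.
apply/polyP => i; rewrite coef_deriv coef_poly ltnS /= -[LHS]mulr_natr.
case: ltnP => ik; last by rewrite mul0r nth_default // (leq_trans sP).
by rewrite mulfVK // pnatr_eq0.
Qed.

(** The exponent is arbitrary so that the induction can pass to the derivative: integrating the
    expansion for [q - 1] and applying the mean value theorem gains one factor |s|. *)
Lemma taylor_powR (R : realType) (k : nat) (q : R) :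
  exists (P : {poly R}) (C : R), [/\ (size P <= k)%N, 0 <= C &
    forall s : R, `|s| <= 2^-1 -> `|(1 + s) `^ q - P.[s]| <= C * `|s| ^+ k].
Proof.
elim: k => [|k IHk] in q *.
  exists 0, (expR `|q|); split; rewrite ?size_poly0 ?expR_ge0 // => s hs.
  have s0 : 0 < 1 + s by move: hs; rewrite ler_norml => /andP[]; lra.
  rewrite horner0 subr0 expr0 mulr1 ger0_norm ?powR_ge0 // /powR gt_eqF // ler_expR.
  apply: le_trans (ler_norm _) _; rewrite normrM ler_piMr // ler_norml.
  move: hs; rewrite ler_norml => /andP[h1 h2]; apply/andP; split.
    rewrite -(expRK (-1)) ler_ln ?posrE ?expR_gt0 //.
    rewrite expRN; have := expR_ge1Dx (1 : R) => h.
    apply: le_trans (_ : 2^-1 <= _); last lra.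
    by rewrite lef_pV2 ?posrE ?expR_gt0 //; lra.
  by apply: le_trans (le_ln1Dx _) _; lra.
have [P [C [sP C0 hP]]] := IHk (q - 1).
have [Q [sQ Qd]] := poly_antiderivative sP.
exists (q *: Q + (1 - q * Q.[0])%:P), (`|q| * C); split.
- rewrite (leq_trans (size_polyD _ _)) // geq_max (leq_trans (size_scale_leq _ _)) //=.
  by rewrite (leq_trans (size_polyC_leq1 _)).
- by rewrite mulr_ge0.
set W := _ + _ => s hs.
have W0 : W.[0] = 1 by rewrite /W hornerD hornerZ hornerC addrC subrK.
have Wd : W^`() = q *: P by rewrite /W derivD derivC derivZ Qd addr0.
pose g (x : R) := (1 + x) `^ q - W.[x].
pose dg (x : R) := q * ((1 + x) `^ (q - 1) - P.[x]).
have g0 : g 0 = 0 by rewrite /g addr0 powR1 W0 subrr.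
have gd (x : R) : `|x| <= 2^-1 -> is_derive x 1 g (dg x).
  move=> hx.
  have x0 : 0 < 1 + x by move: hx; rewrite ler_norml => /andP[]; lra.
  have h1 : is_derive x 1 (horner W) (q * P.[x]).
    by have := is_derive_poly W x; rewrite Wd hornerZ.
  have h2 : is_derive x 1 (fun x => (1 + x) `^ q) (q * (1 + x) `^ (q - 1)).
    have := is_derive1_comp (is_derive1_powR q x0)
      (is_deriveD (is_derive_cst (1:R) x 1) (is_derive_id x 1)).
    by rewrite add0r mulr1.
  by rewrite /dg mulrBr; exact: is_deriveB.
have gc (a b : R) : -2^-1 <= a -> b <= 2^-1 -> {within `[a, b]%classic, continuous g}.
  move=> ha hb; apply: derivable_within_continuous => x; rewrite in_itv /= => /andP[h1 h2].
  have hx : `|x| <= 2^-1 by rewrite ler_norml; lra.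
  by have [] := gd x hx.
have dgb (x : R) : `|x| <= `|s| -> `|dg x| <= `|q| * C * `|s| ^+ k.
  move=> xs; rewrite /dg normrM -mulrA ler_wpM2l //.
  apply: le_trans (hP x (le_trans xs hs)) _.
  by rewrite ler_wpM2l // lerXn2r ?nnegrE.
move: (hs); rewrite ler_norml => /andP[s1 s2].
rewrite -[_ - _]/(g s).
suff [x xs ->] : exists2 x, `|x| <= `|s| & g s = dg x * s.
  by rewrite normrM exprSr mulrA ler_wpM2r // dgb.
have [s0|s0] := ger0P s.
  have [||x] := @MVT_segment R g dg 0 s s0.
  - move=> x; rewrite in_itv /= => /andP[x1 x2]; apply: gd; rewrite ler_norml; lra.
  - by apply: gc; lra.
  rewrite in_itv /= g0 !subr0 => /andP[x1 x2] ->.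
  by exists x => //; rewrite ger0_norm.
have [||x] := @MVT_segment R g dg s 0 (ltW s0).
- move=> x; rewrite in_itv /= => /andP[x1 x2]; apply: gd; rewrite ler_norml; lra.
- by apply: gc; lra.
rewrite in_itv /= g0 !sub0r mulrN => /andP[x1 x2] /oppr_inj ->.
by exists x => //; rewrite ler0_norm //; lra.
Qed.

Local Close Scope classical_set_scope.

(** * The quasi-metric Delta *)

Section dot.
Variable R : realType.

Definition dot d (u x : 'rV[R]_d) : R := \sum_i u 0 i * x 0 i.
Definition norm1 d (u : 'rV[R]_d) : R := \sum_i `|u 0 i|.
(** By homogeneity and evenness these faces control the whole cube. On a face constants are linear
    forms, multiples of x_s, so affine functions and lower degrees need no separate treatment. *)
Definition face d (s : 'I_d) (x : 'rV[R]_d) : Prop :=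
  x 0 s = 1 /\ forall t, `|x 0 t| <= 1.

Lemma dotDr d (u x y : 'rV[R]_d) : dot u (x + y) = dot u x + dot u y.
Proof. by rewrite -big_split; apply: eq_bigr => i _; rewrite mxE mulrDr. Qed.

Lemma dotDl d (u v x : 'rV[R]_d) : dot (u + v) x = dot u x + dot v x.
Proof. by rewrite -big_split; apply: eq_bigr => i _; rewrite mxE mulrDl. Qed.

Lemma dotZr d a (u x : 'rV[R]_d) : dot u (a *: x) = a * dot u x.
Proof. by rewrite mulr_sumr; apply: eq_bigr => i _; rewrite mxE mulrCA. Qed.

Lemma dotZl d a (u x : 'rV[R]_d) : dot (a *: u) x = a * dot u x.
Proof. by rewrite mulr_sumr; apply: eq_bigr => i _; rewrite mxE mulrA. Qed.

Lemma dotNr d (u x : 'rV[R]_d) : dot u (- x) = - dot u x.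
Proof. by rewrite -scaleN1r dotZr mulN1r. Qed.

Lemma dotBr d (u x y : 'rV[R]_d) : dot u (x - y) = dot u x - dot u y.
Proof. by rewrite dotDr dotNr. Qed.

Lemma dot_sumr d (I : finType) (u : 'rV[R]_d) (F : I -> 'rV[R]_d) :
  dot u (\sum_i F i) = \sum_i dot u (F i).
Proof.
rewrite exchange_big; apply: eq_bigr => i _; rewrite summxE mulr_sumr //.
Qed.

Lemma dot_delta d (u : 'rV[R]_d) (s : 'I_d) : dot u (delta_mx 0 s) = u 0 s.
Proof.
rewrite /dot (bigD1 s) //= mxE !eqxx mulr1 big1 ?addr0 // => i /negPf si.
by rewrite mxE si andbF mulr0.
Qed.

Lemma dot_delta_l d (x : 'rV[R]_d) (s : 'I_d) : dot (delta_mx 0 s) x = x 0 s.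
Proof.
rewrite /dot (bigD1 s) //= mxE !eqxx mul1r big1 ?addr0 // => i /negPf si.
by rewrite mxE si andbF mul0r.
Qed.

Lemma dot_le d (u x : 'rV[R]_d) e : (forall t, `|x 0 t| <= e) ->
  `|dot u x| <= norm1 u * e.
Proof.
move=> h; rewrite mulr_suml; apply: le_trans (ler_norm_sum _ _ _) _.
by apply: ler_sum => i _; rewrite normrM ler_wpM2l.
Qed.

Lemma norm1_ge0 d (u : 'rV[R]_d) : 0 <= norm1 u.
Proof. exact: sumr_ge0. Qed.

(** Radon's argument: only [m] coordinates are free on the slice x_s = 1, so some nontrivial
    combination of the [m.+1] forms is constant there, and a sign pattern that contradicts the sign
    of this constant is never realized. *)
Lemma halfspaces_unshattered m (w : 'I_m.+1 -> 'rV[R]_m.+1) (s : 'I_m.+1) :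
  exists b : 'I_m.+1 -> bool, forall x : 'rV[R]_m.+1, x 0 s = 1 ->
    exists i, (0 < dot (w i) x) != b i.
Proof.
pose M := \matrix_(j < m.+1, t < m) w j 0 (lift s t).
have kM : kermx M != 0.
  rewrite kermx_eq0 /row_free neq_ltn; apply/orP; left.
  by rewrite ltnS rank_leq_col.
have [c c0 cM] : exists2 c : 'rV[R]_m.+1, c != 0 & c *m M = 0.
  exists (nz_row (kermx M)); first by rewrite nz_row_eq0.
  by apply/sub_kermxP; exact: nz_row_sub.
wlog [j0 j0c] : c c0 cM / exists j, 0 < c 0 j.
  move=> hw; have [j cj] : exists j, c 0 j != 0.
    by have /rV0Pn := c0.
  have [cp|cn|cz] := ltrgt0P (c 0 j); last by rewrite cz eqxx in cj.
    by apply: (hw c) => //; exists j.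
  apply: (hw (- c)); rewrite ?oppr_eq0 ?mulNmx ?cM ?oppr0 //.
  by exists j; rewrite mxE oppr_gt0.
pose ka := \sum_j c 0 j * w j 0 s.
have cw (x : 'rV[R]_m.+1) : x 0 s = 1 -> \sum_j c 0 j * dot (w j) x = ka.
  move=> xs; rewrite /dot; under eq_bigr do rewrite mulr_sumr.
  rewrite exchange_big (bigD1 s) //= [X in _ + X]big1 ?addr0.
    by apply: eq_bigr => j _; rewrite xs mulr1.
  move=> i; rewrite eq_sym => /unlift_some[t -> _].
  under eq_bigr do rewrite mulrA.
  rewrite -mulr_suml; have /rowP/(_ t) := cM; rewrite !mxE.
  by under eq_bigr do rewrite mxE; move=> ->; rewrite mul0r.
have [ka0|ka0] := leP ka 0.
  exists (fun j => 0 < c 0 j) => x xs; apply/existsP; apply: contraT.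
  move=> /existsPn h; have := cw _ xs; move: ka0; rewrite leNgt => /negP[].
  rewrite -(cw _ xs) (bigD1 j0) //=; apply: ltr_wpDr.
    apply: sumr_ge0 => j _; have := h j; rewrite negbK => /eqP.
    have [cp|cn|->] := ltrgt0P (c 0 j); rewrite ?mul0r // => hj.
      by rewrite mulr_ge0 // ltW.
    by apply: mulr_le0; [exact: ltW|rewrite leNgt hj].
  by have := h j0; rewrite negbK j0c => /eqP hj; rewrite mulr_gt0.
exists (fun j => c 0 j < 0) => x xs; apply/existsP; apply: contraT.
move=> /existsPn h; have := cw _ xs; move: ka0; rewrite ltNge => /negP[].
rewrite -(cw _ xs); apply: sumr_le0 => j _; have := h j; rewrite negbK => /eqP.
have [cp|cn|->] := ltrgt0P (c 0 j); rewrite ?mul0r // => hj.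
  by apply: mulr_ge0_le0; [exact: ltW|rewrite leNgt hj].
by apply: mulr_le0_ge0; exact: ltW.
Qed.

End dot.

Section kappa.
Variables (R : realType) (p : R).
Hypothesis p1 : 1 <= p.

(* The order of |a+b|^p minus its Taylor polynomial of degree at least p at [a];
   when [a] and [b] both vanish the junk value 0/0 = 0 is the right one. *)
Definition kappa (a b : R) : R := `|b| `^ p * (`|b| / (`|a| + `|b|)).

Lemma kappa_ge0 a b : 0 <= kappa a b.
Proof. by rewrite mulr_ge0 ?powR_ge0 // divr_ge0 // addr_ge0. Qed.

Lemma kappa0 a : kappa a 0 = 0.
Proof. by rewrite /kappa normr0 mul0r mulr0. Qed.

Lemma kappaN a b : kappa a (- b) = kappa a b.
Proof. by rewrite /kappa normrN. Qed.

Lemma kappa_mono a b c : `|b| <= `|c| -> kappa a b <= kappa a c.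
Proof.
move=> bc; have [->|b0] := eqVneq b 0; first by rewrite kappa0 kappa_ge0.
have bp : 0 < `|b| by rewrite normr_gt0.
have a0 := normr_ge0 a.
apply: ler_pM; rewrite ?powR_ge0 ?divr_ge0 ?addr_ge0 //.
  by apply: ge0_ler_powR; rewrite ?nnegrE //; exact: le_trans ler01 p1.
rewrite ler_pdivrMr ?ltr_wpDl // mulrAC ler_pdivlMr; last lra.
nra.
Qed.

Lemma kappa_scale a b l : 1 <= l -> kappa a (l * b) <= l `^ p * l * kappa a b.
Proof.
move=> l1; have l0 : 0 <= l by lra.
have [->|b0] := eqVneq b 0; first by rewrite mulr0 !kappa0 mulr0.
have bp : 0 < `|b| by rewrite normr_gt0.
have a0 := normr_ge0 a.
rewrite /kappa normrM (ger0_norm l0) powRM // -!mulrA.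
rewrite ler_wpM2l ?powR_ge0 // [leRHS]mulrCA ler_wpM2l ?powR_ge0 //.
by rewrite !ler_wpM2l // lef_pV2 ?posrE; nra.
Qed.

Lemma kappa_base a a' b l : 0 < l -> `|a'| + `|b| <= l * (`|a| + `|b|) ->
  kappa a b <= l * kappa a' b.
Proof.
move=> l0 h; have [->|b0] := eqVneq b 0; first by rewrite !kappa0 mulr0.
have bp : 0 < `|b| by rewrite normr_gt0.
have a0 := normr_ge0 a; have a'0 := normr_ge0 a'.
rewrite /kappa [leRHS]mulrCA ler_wpM2l ?powR_ge0 // [leRHS]mulrCA ler_wpM2l //.
rewrite -[l]invrK -invfM lef_pV2 ?posrE ?mulr_gt0 ?invr_gt0 ?ltr_wpDl //.
by rewrite mulrC ler_pdivrMr // mulrC.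
Qed.

Definition kappa_const : R := 2 `^ p * 2 * 2.

Lemma kappa_const_gt0 : 0 < kappa_const.
Proof. by rewrite /kappa_const !mulr_gt0 // powR_gt0. Qed.

(** The larger increment dominates. If it is the second one, the base can be moved from a to a + b
    at the cost of a factor 2, since |b| < |c|. *)
Lemma kappa_quasi a b c :
  kappa a (b + c) <= kappa_const * (kappa a b + kappa (a + b) c).
Proof.
have P0 : 0 <= 2 `^ p :> R by exact: powR_ge0.
have k1 := kappa_ge0 a b; have k2 := kappa_ge0 (a + b) c.
have [bc|bc] := leP `|c| `|b|.
  apply: le_trans (_ : kappa a (2 * b) <= _).
    by apply: kappa_mono; rewrite normrM (ger0_norm (_ : 0 <= 2)) //; have := ler_normD b c; lra.
  apply: le_trans (kappa_scale _ _ _) _; first lra.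
  rewrite /kappa_const; have := mulr_ge0 P0 k1; have := mulr_ge0 P0 k2; nra.
apply: le_trans (_ : kappa a (2 * c) <= _).
  by apply: kappa_mono; rewrite normrM (ger0_norm (_ : 0 <= 2)) //; have := ler_normD b c; lra.
apply: le_trans (kappa_scale _ _ _) _; first lra.
have h : kappa a c <= 2 * kappa (a + b) c.
  apply: kappa_base => //; have := ler_normD a b; have := normr_ge0 a; lra.
have := ler_wpM2l P0 h; rewrite /kappa_const; have := mulr_ge0 P0 k1; nra.
Qed.

Lemma kappa_sym a b : kappa a b <= 2 * kappa (a + b) (- b).
Proof.
rewrite kappaN; apply: kappa_base => //; have := ler_normD a b; have := normr_ge0 a; lra.
Qed.

Lemma kappa_sum a r (F : 'I_r -> R) :
  kappa a (\sum_i F i) <= r%:R `^ p * r%:R * \sum_i kappa a (F i).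
Proof.
case: r F => [|r] F; first by rewrite !big_ord0 kappa0 mulr0.
have [i0 _ hmax] := @arg_maxP _ _ _ ord0 predT (fun i => `|F i|) isT.
apply: le_trans (_ : kappa a (r.+1%:R * F i0) <= _).
  apply: kappa_mono; apply: le_trans (ler_norm_sum _ _ _) _.
  rewrite normrM ger0_norm // -[X in X%:R * _]card_ord mulr_natl -sumr_const.
  by apply: ler_sum => i _; exact: hmax.
apply: le_trans (kappa_scale _ _ _) _; first by rewrite ler1n.
rewrite ler_wpM2l ?mulr_ge0 ?powR_ge0 // (bigD1 i0) //= lerDl.
by apply: sumr_ge0 => i _; exact: kappa_ge0.
Qed.

End kappa.

(** * Packing in L1 through thresholds *)

Lemma count_thresholds (R : realType) (Z : nat) (a : R) : (0 < Z)%N -> 0 <= a <= 1 ->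
  Z%:R * a <= #|[set z : 'I_Z | z%:R / Z%:R < a]|%:R < Z%:R * a + 1.
Proof.
move=> Z0 /andP[a0 a1].
have ZR : 0 < Z%:R :> R by rewrite ltr0n.
have Zle : Z%:R * a <= Z%:R by rewrite ler_piMr // ltW.
have ex : exists k, Z%:R * a <= k%:R by exists Z.
case: (ex_minnP ex) => k hk kmin.
have kZ : (k <= Z)%N by exact: kmin.
have zk z : (z%:R / Z%:R < a) = (z < k)%N.
  rewrite ltr_pdivrMr // mulrC.
  apply/idP/idP => h; first by rewrite -(ltr_nat R); exact: lt_le_trans h hk.
  by rewrite ltNge; apply/negP => /kmin; rewrite leqNgt h.
have -> : #|[set z : 'I_Z | z%:R / Z%:R < a]| = k.
  rewrite -sum1_card -[RHS]card_ord -[RHS]sum1_card (big_ord_widen _ (fun=> 1%N) kZ).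
  by apply: eq_bigl => z; rewrite inE zk.
rewrite hk /=; case: k => [|k] in hk kmin kZ zk *.
  by rewrite ltr_wpDl // mulr_ge0 // ltW.
rewrite -natr1 ltrD2r ltNge; apply/negP => /kmin; by rewrite ltnn.
Qed.

(** Layer cake: |g x j - g y j| is the measure of the thresholds between the two values, so the
    functions are packed through the sets tau < g, on which the shattering hypothesis bears. The
    grid of thresholds z/Z is so fine that the separation drops only to delta/2. *)
Lemma packing_L1 (R : realType) (J : finType) (W : J -> R) (N D : nat)
    (g : 'I_N -> J -> R) (delta : R) :
  (0 < D)%N -> (forall j, 0 <= W j) -> \sum_j W j = 1 ->
  (forall x j, 0 <= g x j <= 1) -> 0 < delta <= 1 ->
  (forall (f : 'I_D.+1 -> J) (tau : 'I_D.+1 -> R), exists b : 'I_D.+1 -> bool,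
     forall x, exists i, (tau i < g x (f i)) != b i) ->
  (forall x y, x != y -> delta <= \sum_j W j * `|g x j - g y j|) ->
  N%:R <= 2 * (4 * D%:R + 2) ^+ D * (delta / 2)^-1 ^+ D.
Proof.
move=> D0 W0 W1 g01 /andP[d0 d1] unsh sep.
pose Z := (Num.truncn (2 / delta)).+1.
have Z0 : (0 < Z)%N by [].
have hZ : Z%:R^-1 <= delta / 2.
  rewrite -[delta / 2]invrK lef_pV2 ?posrE ?ltr0n ?invr_gt0 ?divr_gt0 //.
  by rewrite invf_div; exact/ltW/truncnS_gt.
have ZR : 0 < Z%:R :> R by rewrite ltr0n.
pose H : finType := (J * 'I_Z)%type.
pose om (h : H) : R := W h.1 / Z%:R.
pose a x (h : H) := h.2%:R / Z%:R < g x h.1.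
apply: (@packing_bound R H om N D a) => //.
- by move=> h; rewrite divr_ge0.
- rewrite -(pair_bigA _ (fun j z => om (j, z))) /= -[RHS]W1; apply: eq_bigr => j _.
  by rewrite /om /= sumr_const card_ord -[_ *+ _]mulr_natr mulfVK // gt_eqF.
- by apply/andP; split; lra.
- move=> f; have [b hb] := unsh (fun i => (f i).1) (fun i => (f i).2%:R / Z%:R).
  by exists b.
move=> x y xy; have := sep x y xy.
suff : \sum_j W j * `|g x j - g y j| - Z%:R^-1 <= \sum_(h | a x h != a y h) om h by lra.
rewrite -(pair_big_dep predT (fun j z => a x (j, z) != a y (j, z)) (fun j z => om (j, z))) /=.
have -> : Z%:R^-1 = \sum_j W j * Z%:R^-1 :> R by rewrite -mulr_suml W1 mul1r.
rewrite -sumrB; apply: ler_sum => j _.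
rewrite /om /= sumr_const -[leRHS]mulr_natr -mulrBr -mulrA ler_wpM2l //.
rewrite [leRHS]mulrC ler_pdivlMr // mulrBl mulVf ?gt_eqF // mulrC.
wlog xyj : x y {xy} / g x j <= g y j.
  move=> hw; have [h|/ltW h] := leP (g x j) (g y j); first exact: hw.
  rewrite distrC (eq_card (B := [pred z | a y (j, z) != a x (j, z)])); first exact: hw.
  by move=> z; rewrite !inE eq_sym.
have /andP[h1 h2] := count_thresholds Z0 (g01 x j).
have /andP[h3 h4] := count_thresholds Z0 (g01 y j).
set A := [set z : 'I_Z | _] in h1 h2; set B := [set z : 'I_Z | _] in h3 h4.
have AB : A \subset B.
  by apply/fintype.subsetP => z; rewrite !inE => /lt_le_trans; exact.
have -> : #|(fun z => a x (j, z) != a y (j, z))| = (#|B| - #|A|)%N.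
  rewrite -cardsDS //; apply: eq_card => z; rewrite !inE /a /= /in_mem /=.
  have [h|h] := ltP _ (g x j).
    by rewrite (lt_le_trans h xyj).
  by case: (_ < g y j).
rewrite natrB ?subset_leq_card // distrC ger0_norm ?subr_ge0 // mulrBr; lra.
Qed.

Section squeeze.
Variable R : realType.

Definition squeeze (s : R) : R := s / (1 + `|s|).

Let den (s : R) : 0 < 1 + `|s|. Proof. by have := normr_ge0 s; lra. Qed.

Lemma squeeze_bound s : -1 < squeeze s < 1.
Proof.
rewrite /squeeze ltr_pdivlMr // ltr_pdivrMr //.
have := ler_norm s; have := ler_norm (- s); rewrite normrN; lra.
Qed.

Lemma squeeze_gt (c s : R) : -1 < c < 1 -> (c < squeeze s) = (c / (1 - `|c|) < s).
Proof.
move=> /andP[c1 c2].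
have cn : 0 < 1 - `|c| by rewrite subr_gt0 ltr_norml c1.
rewrite /squeeze ltr_pdivlMr // ltr_pdivrMr //.
have [c0|c0] := ger0P c; have [s0|s0] := ger0P s;
  rewrite ?(ger0_norm c0) ?(ltr0_norm c0) ?(ger0_norm s0) ?(ltr0_norm s0) in cn *;
  apply/idP/idP => h; nra.
Qed.

Lemma squeeze_dist (s t : R) :
  `|s - t| / ((1 + `|s|) * (1 + `|t|)) <= `|squeeze s - squeeze t|.
Proof.
have ds := den s; have dt := den t.
have -> : squeeze s - squeeze t = (s - t + (s * `|t| - t * `|s|)) / ((1 + `|s|) * (1 + `|t|)).
  by rewrite /squeeze -mulNr addf_div ?gt_eqF //; congr (_ / _); lra.
rewrite normrM normfV [`|(1 + _) * _|]ger0_norm ?mulr_ge0 ?(ltW ds) ?(ltW dt) //.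
rewrite ler_wpM2r ?invr_ge0 ?mulr_ge0 ?(ltW ds) ?(ltW dt) //.
have [s0|s0] := ger0P s; have [t0|t0] := ger0P t.
- by rewrite [t * s]mulrC subrr addr0.
- rewrite [leLHS]ger0_norm ?[leRHS]ger0_norm; nra.
- rewrite [leLHS]ler0_norm ?[leRHS]ler0_norm; nra.
- by rewrite !mulrN [t * s]mulrC subrr addr0.
Qed.

(* Turns separation for Delta into separation in l1, for which half-spaces
   suffice: [squeeze] is bounded and increasing. *)
Lemma kappa_squeeze (p a b delta : R) : 1 <= p -> 0 < delta -> `|b| <= delta ->
  kappa p a b ^+ 2 <= 2 * delta `^ p ^+ 2 * `|squeeze (a / delta) - squeeze ((a + b) / delta)|.
Proof.
move=> p1 d0 bd; have [->|b0] := eqVneq b 0.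
  by rewrite kappa0 expr0n /= mulr_ge0 // mulr_ge0 // exprn_ge0 // powR_ge0.
have bp : 0 < `|b| by rewrite normr_gt0.
set s := a / delta; set t := `|b| / delta.
have t0 : 0 < t by rewrite divr_gt0.
have t1 : t <= 1 by rewrite ler_pdivrMr // mul1r.
have s0 := normr_ge0 s.
have q0 : 0 <= t / (`|s| + t).
  by apply: divr_ge0; [exact: ltW|apply: addr_ge0 => //; exact: ltW].
have k : kappa p a b <= delta `^ p * (t * (t / (`|s| + t))).
  rewrite /kappa.
  have -> : `|b| / (`|a| + `|b|) = t / (`|s| + t).
    rewrite /t /s normrM normfV (gtr0_norm d0) -mulrDl.
    by rewrite -mulf_div mulfV ?mulr1 // invr_eq0 gt_eqF.
  have -> : `|b| = delta * t by rewrite /t mulrCA mulfV ?mulr1 // gt_eqF.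
  rewrite powRM; [|exact: ltW|exact: ltW].
  rewrite -mulrA ler_wpM2l ?powR_ge0 //.
  by rewrite ler_wpM2r // ge1r_powR // t0.
apply: le_trans (_ : (delta `^ p * (t * (t / (`|s| + t)))) ^+ 2 <= _).
  rewrite lerXn2r ?nnegrE ?kappa_ge0 //; apply: mulr_ge0; first exact: powR_ge0.
  by apply: mulr_ge0 => //; exact: ltW.
rewrite exprMn [2 * _]mulrC -[leRHS]mulrA ler_wpM2l ?exprn_ge0 ?powR_ge0 //.
(* With w = |s|, what remains is t^4/(w+t)^2 <= 2t/((1+w)(1+w+t)); both sides decay like w^-2, and t
   <= 1. *)
apply: le_trans (_ : 2 * (t / ((1 + `|s|) * (1 + (`|s| + t)))) <= _); last first.
  rewrite ler_wpM2l //; apply: le_trans (squeeze_dist _ _).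
  have -> : `|s - (a + b) / delta| = t.
    rewrite /s -mulrBl opprD addrA subrr add0r mulNr normrN normrM normfV.
    by rewrite (gtr0_norm d0).
  rewrite ler_wpM2l ?(ltW t0) // lef_pV2 ?posrE ?mulr_gt0 ?den //; last lra.
  rewrite ler_wpM2l ?(ltW (den _)) // lerD2l.
  apply: le_trans (_ : `|s + b / delta| <= _); first by rewrite /s mulrDl.
  apply: le_trans (ler_normD _ _) _; rewrite lerD2l normrM normfV (gtr0_norm d0) //.
set w := `|s| in s0 *.
have w1 : 0 < w + t by lra.
have -> : (t * (t / (w + t))) ^+ 2 = t ^+ 4 / (w + t) ^+ 2.
  by rewrite mulrA -expr2 expr_div_n -exprM.
rewrite ler_pdivrMr ?exprn_gt0 //.
have -> : 2 * (t / ((1 + w) * (1 + (w + t)))) * (w + t) ^+ 2 =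
  t * (2 * (w + t) ^+ 2) / ((1 + w) * (1 + (w + t))) by lra.
rewrite ler_pdivlMr; last first.
  by rewrite mulr_gt0 //; lra.
rewrite !exprS !expr0 !mulr1.
have h1 : t * t <= t by nra.
have h2 : t * t * t <= t * t by nra.
have h3 : t * t * t <= t by nra.
have h4 : w * (t * t * t) <= w * t by nra.
have h5 : w * w * (t * t * t) <= w * w * 1 by rewrite ler_wpM2l ?mulr_ge0 //; lra.
rewrite -subr_ge0.
have -> : t * (2 * ((w + t) * (w + t))) - t * (t * (t * t)) * ((1 + w) * (1 + (w + t))) =
  t * (2 * (w * w) + 4 * (w * t) + 2 * (t * t)
   - (t * t * t) * ((1 + w) * (1 + (w + t)))) by lra.
rewrite mulr_ge0 ?(ltW t0) // subr_ge0.
apply: le_trans (_ : (t * t * t) * ((1 + w) * (2 + w)) <= _).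
  have t0' := ltW t0.
  apply: ler_wpM2l; first exact: mulr_ge0 (mulr_ge0 t0' t0') t0'.
  apply: ler_wpM2l; lra.
have -> : t * t * t * ((1 + w) * (2 + w)) =
  2 * (t * t * t) + 3 * (w * (t * t * t)) + w * w * (t * t * t) by lra.
nra.
Qed.

End squeeze.

Section Delta.
Variables (R : realType) (p : R) (n d : nat) (u : 'I_n -> 'rV[R]_d).
Hypothesis p1 : 1 <= p.

Definition Delta (x y : 'rV[R]_d) : R :=
  \sum_i kappa p (dot (u i) x) (dot (u i) (y - x)) ^+ 2.

Definition Delta_const : R := 2 * kappa_const p ^+ 2.

Lemma Delta_const_gt0 : 0 < Delta_const.
Proof. by rewrite mulr_gt0 // exprn_gt0 // kappa_const_gt0. Qed.

Lemma Delta_quasi x y z : Delta x z <= Delta_const * (Delta x y + Delta y z).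
Proof.
rewrite /Delta -big_split mulr_sumr; apply: ler_sum => i _ /=.
have -> : z - x = (y - x) + (z - y) by rewrite [RHS]addrC addrA subrK.

have := kappa_quasi p1 (dot (u i) x) (dot (u i) (y - x)) (dot (u i) (z - y)).
rewrite -(dotDr (u i) x (y - x)) subrKC -dotDr.
set a := kappa _ _ _; set b := kappa _ _ _; set c := kappa _ _ _ => h.
have a0 : 0 <= a by exact: kappa_ge0.
have K0 := kappa_const_gt0 p.
apply: le_trans (_ : (kappa_const p * (b + c)) ^+ 2 <= _).
  by rewrite lerXn2r ?nnegrE // (le_trans a0 h).
rewrite exprMn /Delta_const [2 * _]mulrC -[leRHS]mulrA ler_wpM2l ?sqr_ge0 //.
by have := sqr_ge0 (b - c); rewrite !expr2; lra.
Qed.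

Lemma Delta_sym x y : Delta x y <= 4 * Delta y x.
Proof.
rewrite /Delta mulr_sumr; apply: ler_sum => i _.
have := kappa_sym p (dot (u i) x) (dot (u i) (y - x)).
rewrite -(dotDr (u i) x (y - x)) subrKC -dotNr opprB.
set a := kappa _ _ _; set b := kappa _ _ _ => h.
have a0 : 0 <= a by exact: kappa_ge0.
apply: le_trans (_ : (2 * b) ^+ 2 <= _).
  by rewrite lerXn2r ?nnegrE // (le_trans a0 h).
by rewrite exprMn; lra.
Qed.

End Delta.

(** The constant of [packing_L1] for D = m and the separation delta/(16(m+1)) reached in
    [Delta_separated_card]. *)
Definition packing_const (R : realType) (m : nat) : R :=
  2 * (4 * m%:R + 2) ^+ m * (32 * m.+1%:R) ^+ m.

(** Two separated points either differ by more than [delta] in some coordinate, or have all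
    increments at most [delta], and then [kappa_squeeze] separates them on average over the atoms.
    Both cases are put into one L1 packing, the coordinates and the atoms receiving half of the mass
    each. *)
Lemma Delta_separated_card (R : realType) (p : R) (m n N : nat)
    (u : 'I_n -> 'rV[R]_m.+1) (s : 'I_m.+1) (delta : R) (x : 'I_N -> 'rV[R]_m.+1) :
  1 <= p -> (0 < m)%N -> (0 < n)%N -> 0 < delta <= 1 ->
  (forall i, norm1 (u i) <= 1) -> (forall k, face s (x k)) ->
  (forall k l, k != l -> n%:R * (delta * delta `^ p ^+ 2) < Delta p u (x k) (x l)) ->
  N%:R <= packing_const R m * delta^-1 ^+ m.
Proof.
move=> p1 m0 n0 /andP[d0 d1] u1 fx sep.
have nR : 0 < n%:R :> R by rewrite ltr0n.
have mR : 0 < m.+1%:R :> R by rewrite ltr0n.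
pose J : finType := ('I_m.+1 + 'I_n)%type.
pose W (j : J) : R := match j with inl _ => (2 * m.+1%:R)^-1 | inr _ => (2 * n%:R)^-1 end.
pose g (k : 'I_N) (j : J) : R := match j with
  | inl t => (x k 0 t + 1) / 2
  | inr i => (1 + squeeze (dot (u i) (x k) / delta)) / 2 end.
have dm : 0 < delta / (16 * m.+1%:R) <= 1.
  apply/andP; split; first by rewrite divr_gt0 // mulr_gt0.
  rewrite ler_pdivrMr ?mulr_gt0 // mul1r (le_trans d1) //.
  have : 1 <= m.+1%:R :> R by rewrite ler1n.
  lra.
have := @packing_L1 R J W N m g (delta / (16 * m.+1%:R)) m0 _ _ _ dm.
have -> : (delta / (16 * m.+1%:R) / 2)^-1 = 32 * m.+1%:R * delta^-1.
  by rewrite !invfM !invrK; lra.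
rewrite exprMn mulrA -/(packing_const R m); apply.
- by case=> [t|i]; rewrite /W invr_ge0 mulr_ge0.
- have hc (k : nat) : (0 < k)%N -> (2 * k%:R)^-1 *+ k = 2^-1 :> R.
    by move=> k0; rewrite -[LHS]mulr_natr invfM -mulrA mulVf ?mulr1 // gt_eqF // ltr0n.
  by rewrite big_sumType /= !sumr_const !card_ord !hc //; lra.
- move=> k [t|i] /=.
    have [_ /(_ t)] := fx k; rewrite ler_norml; lra.
  have := squeeze_bound (dot (u i) (x k) / delta); lra.
- move=> f tau.
  (* Each set tau < g is a half-space on the face, as [squeeze] is increasing; thresholds outside
     its range give the empty set or the whole face, through the forms 0 and x_s. *)
  have hw j : exists w : 'rV[R]_m.+1, forall k, (tau j < g k (f j)) = (0 < dot w (x k)).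
    case: (f j) => [t|i] /=.
      exists (delta_mx 0 t - (2 * tau j - 1) *: delta_mx 0 s) => k.
      have [xs _] := fx k.
      rewrite dotDl -scaleNr dotZl !dot_delta_l xs mulr1.
      by apply/idP/idP; lra.
    have [t1|t1] := ltP (2 * tau j - 1) 1; last first.
      exists 0 => k; have -> : dot 0 (x k) = 0.
        by rewrite /dot big1 // => l _; rewrite mxE mul0r.
      have := squeeze_bound (dot (u i) (x k) / delta) => /andP[h1 h2].
      by rewrite ltxx; apply/negbTE; rewrite -leNgt; lra.
    have [t2|t2] := leP (2 * tau j - 1) (-1).
      exists (delta_mx 0 s) => k; have [xs _] := fx k; rewrite dot_delta_l xs ltr01.
      have := squeeze_bound (dot (u i) (x k) / delta) => /andP[h1 h2].
      by rewrite ltr_pdivlMr //; lra.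
    set c := 2 * tau j - 1 in t1 t2.
    exists (u i - (delta * (c / (1 - `|c|))) *: delta_mx 0 s) => k.
    have [xs _] := fx k; rewrite dotDl -scaleNr dotZl dot_delta_l xs mulr1.
    rewrite subr_gt0 -ltr_pdivlMl // [delta^-1 * _]mulrC -squeeze_gt ?t1 ?t2 //.
    by rewrite /c ltr_pdivlMr //; apply/idP/idP; lra.
  pose w j := xget 0 [set w : 'rV[R]_m.+1 |
    forall k, (tau j < g k (f j)) = (0 < dot w (x k))]%classic.
  have {}hw j k : (tau j < g k (f j)) = (0 < dot (w j) (x k)).
    by have := xgetPex 0 (hw j); exact.
  have [b hb] := halfspaces_unshattered w s.
  exists b => k; have [i hi] := hb (x k) (fx k).1.
  by exists i; rewrite hw.
move=> k l kl; have := sep k l kl.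
have WG j : 0 <= W j * `|g k j - g l j|.
  by rewrite mulr_ge0 //; case: j => [t|i]; rewrite /W invr_ge0 mulr_ge0.
have M1 : 1 <= m.+1%:R :> R by rewrite ler1n.
have [/existsP[t ht]|] := boolP [exists t, delta < `|x k 0 t - x l 0 t|].
  move=> _; rewrite (bigD1 (inl t)) //= ler_wpDr //; first exact: sumr_ge0.
  have -> : (x k 0 t + 1) / 2 - (x l 0 t + 1) / 2 = (x k 0 t - x l 0 t) / 2 by lra.
  have h2 : delta / 2 <= `|(x k 0 t - x l 0 t) / 2|.
    by rewrite normrM normfV (ger0_norm (_ : 0 <= 2)) //; lra.
  apply: le_trans (ler_wpM2l _ h2); last by rewrite invr_ge0 mulr_ge0.
  have -> : (2 * m.+1%:R)^-1 * (delta / 2) = (delta / (16 * m.+1%:R)) * 4.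
    by rewrite !invfM; move: (m.+1%:R^-1) => y; lra.
  by rewrite ler_peMr ?ler1n //; case/andP: dm => /ltW.
rewrite negb_exists => /forallP ht hD.
have ub i : `|dot (u i) (x l - x k)| <= delta.
  apply: le_trans (_ : norm1 (u i) * delta <= _).
    by apply: dot_le => t; rewrite !mxE distrC leNgt; exact: ht.
  by rewrite ler_piMl // ltW.
have P0 : 0 < delta `^ p ^+ 2 by rewrite exprn_gt0 // powR_gt0.
have : n%:R * delta < 2 * \sum_i
   `|squeeze (dot (u i) (x k) / delta) - squeeze (dot (u i) (x l) / delta)|.
  rewrite -(ltr_pM2r P0) -mulrA; apply: lt_le_trans hD _.
  rewrite mulrAC mulr_sumr; apply: ler_sum => i _.
  have := kappa_squeeze (dot (u i) (x k)) p1 d0 (ub i).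
  by rewrite -(dotDr (u i) (x k)) subrKC.
move=> hS; rewrite big_sumType /= ler_wpDl //.
  by apply: sumr_ge0 => t _; exact: (WG (inl t)).
rewrite -mulr_sumr.
have -> : \sum_i `|(1 + squeeze (dot (u i) (x k) / delta)) / 2 -
      (1 + squeeze (dot (u i) (x l) / delta)) / 2| =
    (\sum_i `|squeeze (dot (u i) (x k) / delta) - squeeze (dot (u i) (x l) / delta)|) / 2.
  rewrite mulr_suml; apply: eq_bigr => i _.
  have -> (a b : R) : (1 + a) / 2 - (1 + b) / 2 = (a - b) / 2 by lra.
  by rewrite normrM normfV (ger0_norm (_ : 0 <= 2)).
apply: le_trans (_ : delta / 8 <= _).
  rewrite ler_pM2l // lef_pV2 ?posrE ?mulr_gt0 //; lra.
have -> : delta / 8 = (2 * n%:R)^-1 * (n%:R * delta / 4).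
  rewrite invfM -[delta in LHS](mulKf (_ : n%:R != 0)) ?gt_eqF //.
  by move: (n%:R^-1) => y; lra.
by rewrite ler_wpM2l ?invr_ge0 ?mulr_ge0 //; lra.
Qed.

Lemma sqr_sum_le (R : realFieldType) n (a : 'I_n -> R) :
  (\sum_i a i) ^+ 2 <= n%:R * \sum_i a i ^+ 2.
Proof.
have h : 0 <= \sum_i \sum_j (a i - a j) ^+ 2.
  by apply: sumr_ge0 => i _; apply: sumr_ge0 => j _; exact: sqr_ge0.
set S1 := \sum_i a i; set S2 := \sum_i a i ^+ 2.
have inner i : \sum_j (a i - a j) ^+ 2 = n%:R * a i ^+ 2 + S2 - 2 * (a i * S1).
  rewrite (eq_bigr (fun j => a i ^+ 2 + a j ^+ 2 - 2 * (a i * a j))); last first.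
    by move=> j _; lra.
  by rewrite sumrB big_split /= sumr_const card_ord mulr_natl -!mulr_sumr.
move: h; under eq_bigr do rewrite inner.
rewrite sumrB big_split /= sumr_const card_ord -mulr_natl -!mulr_sumr -mulr_suml -/S1 -/S2.
by rewrite expr2; lra.
Qed.

(** * Chaining *)

Section features.
Variables (R : realType) (k d : nat).

Definition monomial (a : 'I_#|{: {ffun 'I_k -> 'I_d}}|) : {ffun 'I_k -> 'I_d} :=
  enum_val a.

(** The k-th tensor power of y, homogeneous of degree k. On a face, factors x_s = 1 pad the lower
    degrees, so its linear images are all the polynomials of degree at most k. *)
Definition feature (y : 'rV[R]_d) : 'rV[R]_#|{: {ffun 'I_k -> 'I_d}}| :=
  \row_a \prod_t y 0 (monomial a t).

Definition featured (s : 'I_d) (g : 'rV[R]_d -> R) : Prop :=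
  exists ga : 'rV[R]_#|{: {ffun 'I_k -> 'I_d}}|, forall y, face s y -> g y = dot ga (feature y).

Lemma feature_bound s y a : face s y -> `|feature y 0 a| <= 1.
Proof.
move=> [_ hy]; rewrite mxE normr_prod.
apply: le_trans (_ : \prod_(t < k) 1 <= _); last by rewrite big1.
by apply: ler_prod => t _; rewrite normr_ge0 hy.
Qed.

Lemma featured_prod s (v : 'I_k -> 'rV[R]_d) : featured s (fun y => \prod_t dot (v t) y).
Proof.
exists (\row_a \prod_t v t 0 (monomial a t)) => y _.
rewrite /dot bigA_distr_bigA (reindex monomial) /=; last first.
  exact/onW_bij/enum_val_bij.
by apply: eq_bigr => a _; rewrite !mxE -big_split.
Qed.

Lemma featured0 s : featured s (fun=> 0).
Proof.
by exists 0 => y _; rewrite /dot big1 // => i _; rewrite mxE mul0r.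
Qed.

Lemma featuredD s g h : featured s g -> featured s h -> featured s (fun y => g y + h y).
Proof.
by move=> [ga hg] [gb hh]; exists (ga + gb) => y fy; rewrite dotDl hg // hh.
Qed.

Lemma featuredZ s a g : featured s g -> featured s (fun y => a * g y).
Proof. by move=> [ga hg]; exists (a *: ga) => y fy; rewrite dotZl hg. Qed.

Lemma featuredB s g h : featured s g -> featured s h -> featured s (fun y => g y - h y).
Proof.
move=> fg /(featuredZ (-1)) fh; have [ga hga] := featuredD fg fh.
by exists ga => y fy; rewrite -hga // mulN1r.
Qed.

Lemma featured_poly s (T : {poly R}) (w : 'rV[R]_d) : (size T <= k.+1)%N ->
  featured s (fun y => T.[dot w y]).
Proof.
move=> sT.
have hX l : (l <= k)%N -> featured s (fun y => T`_l * dot w y ^+ l).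
  move=> lk; apply: featuredZ.
  have [ga hga] := featured_prod s (fun t : 'I_k => if (t < l)%N then w else delta_mx 0 s).
  exists ga => y fy; rewrite -hga //.
  rewrite (bigID (fun t : 'I_k => (t < l)%N)) /=.
  rewrite [X in _ * X]big1 ?mulr1; last first.
    by move=> t /negPf ->; rewrite dot_delta_l; case: fy.
  rewrite (eq_bigr (fun=> dot w y)); last by move=> t ->.
  by rewrite -(big_ord_widen _ (fun=> dot w y) lk) prodr_const card_ord.
suff [ga hga] : featured s (fun y => \sum_(l < k.+1) T`_l * dot w y ^+ l).
  by exists ga => y fy; rewrite -hga // (horner_coef_wide _ sT).
have := featured0 s.
suff : forall l, (l <= k.+1)%N -> featured s (fun y => \sum_(i < l) T`_i * dot w y ^+ i).
  by move=> /(_ _ (leqnn _)).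
elim=> [_|l IHl lk].
  by have [ga hga] := featured0 s; exists ga => y fy; rewrite big_ord0 -hga.
have [ga hga] := featuredD (IHl (ltnW lk)) (hX l lk).
by exists ga => y fy; rewrite big_ord_recr -hga.
Qed.

(** The coefficients depend on y but not on g, so that a signed sum of different polynomials is
    controlled by its values at the points [z]. *)
Lemma fekete_features s (Y : set 'rV[R]_d) y0 : Y y0 -> (forall y, Y y -> face s y) ->
  exists z : 'I_#|{: {ffun 'I_k -> 'I_d}}| -> 'rV[R]_d, (forall t, Y (z t)) /\
    forall y, Y y -> exists c : 'I_#|{: {ffun 'I_k -> 'I_d}}| -> R,
      (forall t, `|c t| <= 2) /\
      forall g, featured s g -> g y = \sum_t c t * g (z t).
Proof.
move=> Yy0 fY.
have [|z [Yz h]] := @fekete R _ _ Y y0 feature 1 Yy0.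
  by move=> y /fY fy a; exact: feature_bound fy.
exists z; split=> // y Yy; have [c [c2 hc]] := h y Yy.
exists c; split=> // g [ga hg].
rewrite (hg y (fY y Yy)) hc dot_sumr; apply: eq_bigr => t _.
by rewrite dotZr (hg _ (fY _ (Yz t))).
Qed.

End features.

(** The choice between the Taylor polynomial and 0 is made with [bs], a bound for all increments of
    a piece, so that the approximant is one polynomial on the whole piece. *)
Lemma taylor_kappa (R : realType) (p : R) (k : nat) (T : {poly R}) (C : R) (a b bs : R) :
  1 <= p -> p <= k%:R -> 0 <= C ->
  (forall s : R, `|s| <= 2^-1 -> `|(1 + s) `^ p - T.[s]| <= C * `|s| ^+ k.+1) ->
  `|b| <= bs ->
  `| `|a + b| `^ p - (if 2 * bs <= `|a| then `|a| `^ p * T.[b / a] else 0)|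
    <= (2 * C + 3 `^ p * 3) * kappa p a bs.
Proof.
move=> p1 pk C0 hT bbs.
have p0 : 0 < p by lra.
have bs0 : 0 <= bs by exact: le_trans bbs.
have P3 : 0 <= 3 `^ p :> R by exact: powR_ge0.
have k0 := kappa_ge0 p a bs.
have an := normr_ge0 a.
case: ifPn => hb; last first.
  rewrite -ltNge in hb; have bsp : 0 < bs by have := normr_ge0 a; lra.
  rewrite subr0 ger0_norm ?powR_ge0 //.
  apply: le_trans (_ : (3 * bs) `^ p <= _).
    apply: ge0_ler_powR; rewrite ?nnegrE ?mulr_ge0 //; first lra.
    by have := ler_normD a b; lra.
  rewrite powRM //.
  have : bs `^ p <= 3 * kappa p a bs.
    rewrite /kappa (ger0_norm bs0) mulrCA -[leLHS]mulr1 ler_wpM2l ?powR_ge0 //.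
    by rewrite mulrA ler_pdivlMr; lra.
  by move=> /(ler_wpM2l P3); have := mulr_ge0 C0 k0; lra.
have [a0|a0] := eqVneq a 0.
  rewrite a0 normr0 in hb *; have -> : b = 0.
    by apply/eqP; rewrite -normr_le0; lra.
  rewrite addr0 normr0 powR0 ?gt_eqF // mul0r subrr normr0 -{2}a0.
  by rewrite mulr_ge0 ?addr_ge0 ?mulr_ge0 // kappa_ge0.
have ap : 0 < `|a| by rewrite normr_gt0.
set t := bs / `|a|.
have t0 : 0 <= t by rewrite divr_ge0.
have st : `|b / a| <= t by rewrite normrM normfV ler_pM2r ?invr_gt0.
have t2 : t <= 2^-1 by rewrite ler_pdivrMr //; lra.
have -> : `|a + b| = `|a| * (1 + b / a).
  rewrite -[X in _ * X]ger0_norm; last first.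
    by have := le_trans st t2; rewrite ler_norml; lra.
  by rewrite -normrM mulrDr mulr1 mulrCA mulfV // mulr1.
have s1 : 0 <= 1 + b / a by have := le_trans st t2; rewrite ler_norml; lra.
rewrite powRM // -mulrBr normrM (ger0_norm (powR_ge0 _ _)).
apply: le_trans (_ : `|a| `^ p * (C * (t `^ p * t)) <= _).
  rewrite ler_wpM2l ?powR_ge0 //; apply: le_trans (hT _ (le_trans st t2)) _.
  rewrite ler_wpM2l // exprSr ler_pM ?exprn_ge0 //.
  apply: le_trans (_ : t ^+ k <= _); first by rewrite lerXn2r ?nnegrE.
  have [->|tn0] := eqVneq t 0.
    rewrite powR0 ?gt_eqF // expr0n; case: (k) pk => // h0; lra.
  rewrite -powR_mulrn // ger_powR // lt0r tn0 t0 /=; lra.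
have -> : `|a| `^ p * (C * (t `^ p * t)) = C * (bs `^ p * t).
  have bsE : bs = `|a| * t by rewrite /t mulrCA mulfV ?mulr1 // gt_eqF.
  by rewrite bsE (powRM p an t0) mulrCA -[X in _ = _ * X]mulrA.
apply: le_trans (_ : C * (2 * kappa p a bs) <= _).
  rewrite ler_wpM2l // /kappa (ger0_norm bs0) [leRHS]mulrCA ler_wpM2l ?powR_ge0 //.
  rewrite /t [leRHS]mulrCA ler_wpM2l // ler_pdivlMr; last lra.
  by rewrite mulrC ler_pdivrMr //; lra.
by have := mulr_ge0 P3 k0; lra.
Qed.

Lemma Delta_xx (R : realType) (p : R) n d (u : 'I_n -> 'rV[R]_d) x : Delta p u x x = 0.
Proof.
rewrite /Delta big1 // => i _; rewrite subrr.
by rewrite (_ : dot _ 0 = 0) ?kappa0 ?expr0n // /dot big1 // => j _; rewrite mxE mulr0.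
Qed.

(** A maximal separated family is a net; the factor 4 of [Delta_sym] is lost because separation is
    required in both orders. *)
Lemma separated_net (R : realType) (p : R) (m n : nat) (u : 'I_n -> 'rV[R]_m.+1)
    (s : 'I_m.+1) (delta : R) :
  1 <= p -> (0 < m)%N -> (0 < n)%N -> 0 < delta <= 1 -> (forall i, norm1 (u i) <= 1) ->
  exists (N : nat) (x : 'I_N -> 'rV[R]_m.+1),
    [/\ N%:R <= packing_const R m * delta^-1 ^+ m, forall k, face s (x k) &
      forall y, face s y -> exists k,
        Delta p u (x k) y <= 4 * (n%:R * (delta * delta `^ p ^+ 2))].
Proof.
move=> p1 m0 n0 d01 u1.
set r := n%:R * _.
have d0 : 0 < delta by case/andP: d01.
have r0 : 0 <= r by rewrite !mulr_ge0 ?exprn_ge0 ?powR_ge0 // ltW.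
pose P N := `[< exists x : 'I_N -> 'rV[R]_m.+1, (forall k, face s (x k)) /\
   forall k l, k != l -> r < Delta p u (x k) (x l) >].
have PB N : P N -> N%:R <= packing_const R m * delta^-1 ^+ m.
  by move=> /asboolP[x [fx sx]]; exact: (Delta_separated_card p1 m0 n0 d01 u1 fx sx).
have ub N : P N -> (N <= (Num.truncn (packing_const R m * delta^-1 ^+ m)))%N.
  by move=> /PB h; rewrite truncn_ge_nat // (le_trans _ h).
have exP : exists N, P N.
  exists 0%N; apply/asboolP; exists (fun=> 0); split; by case.
case: (ex_maxnP exP ub) => N PN Nmax; have NB := PB _ PN.
move: PN => /asboolP[x [fx sx]].
exists N, x; split=> // y fy.
apply/not_existsP => h.
have {}h k : 4 * r < Delta p u (x k) y by rewrite ltNge; apply/negP/h.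
suff /Nmax : P N.+1 by rewrite ltnn.
apply/asboolP; exists (fun k => if unlift ord0 k is Some j then x j else y); split.
  by move=> k; case: unliftP.
move=> k l; case: unliftP => [k' ->|->]; case: unliftP => [l' ->|->].
- by rewrite (inj_eq lift_inj); exact: sx.
- by move=> _; apply: le_lt_trans (h k'); lra.
- by move=> _; have := Delta_sym p u (x l') y; have := h l'; lra.
- by rewrite eqxx.
Qed.

Section local_approximation.
Variables (R : realType) (p : R) (k : nat) (T : {poly R}) (C : R).
Hypotheses (p1 : 1 <= p) (pk : p <= k%:R) (C0 : 0 <= C) (sT : (size T <= k.+1)%N).
Hypothesis hT : forall s : R, `|s| <= 2^-1 -> `|(1 + s) `^ p - T.[s]| <= C * `|s| ^+ k.+1.

Definition approx_const d : R :=
  (2 * C + 3 `^ p * 3) ^+ 2 * ((d%:R `^ p * d%:R * (2 `^ p * 2)) ^+ 2 * d%:R * d%:R).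

Lemma approx_const_ge0 d : 0 <= approx_const d.
Proof. by rewrite /approx_const mulr_ge0 ?sqr_ge0 // -mulrA mulr_ge0 ?sqr_ge0 // mulr_ge0. Qed.

(** The expansion needs a bound on <u_i, y - x> uniform over the piece, whose squared kappas still
    sum to O(rho). Fekete points of the displacements provide it: every displacement is a bounded
    combination of [d] of them, and each of these satisfies the bound on [Delta]. *)
Lemma local_approximation n d (u : 'I_n -> 'rV[R]_d) (s : 'I_d) x rho : 0 <= rho ->
  face s x -> exists P : 'I_n -> 'rV[R]_d -> R,
    (forall i, featured k s (P i)) /\
    forall y, face s y -> Delta p u x y <= rho ->
      \sum_i (`|dot (u i) y| `^ p - P i y) ^+ 2 <= approx_const d * rho.
Proof.
move=> rho0 fx.
pose Y := [set y | face s y /\ Delta p u x y <= rho]%classic.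
have Yx : Y x by split; rewrite ?Delta_xx.
have [|z [Yz hz]] := @fekete R _ d Y x (fun y => y - x) 2 Yx.
  move=> y [[_ hy] _] i; have [_ hx] := fx.
  rewrite !mxE; have := ler_normB (y 0 i) (x 0 i); have := hy i; have := hx i; lra.
pose bs i := \sum_t 2 * `|dot (u i) (z t - x)|.
pose P i y := if 2 * bs i <= `|dot (u i) x| then
  `|dot (u i) x| `^ p * T.[dot ((dot (u i) x)^-1 *: u i - delta_mx 0 s) y] else 0.
exists P; split.
  move=> i; rewrite /P; case: (2 * bs i <= _); last exact: featured0.
  exact/featuredZ/featured_poly.
move=> y fy Dy.
have [c [c2 hc]] := hz y (conj fy Dy).
have hb i : `|dot (u i) (y - x)| <= bs i.
  rewrite hc dot_sumr; apply: le_trans (ler_norm_sum _ _ _) _.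
  by apply: ler_sum => t _; rewrite dotZr normrM ler_wpM2r.
have hP i : `| `|dot (u i) y| `^ p - P i y| <= (2 * C + 3 `^ p * 3) * kappa p (dot (u i) x) (bs i).
  have := taylor_kappa (dot (u i) x) p1 pk C0 hT (hb i).
  rewrite -dotDr subrKC /P; case: ifP => // hbi.
  (* At <u_i, x> = 0 both forms of the approximant vanish with the factor |<u_i, x>|^p, whatever the
     junk inverse. *)
  have [ax0|ax0] := eqVneq (dot (u i) x) 0.
    by rewrite ax0 normr0 powR0 ?mul0r ?gt_eqF //; exact: lt_le_trans ltr01 p1.
  have -> // : dot (u i) (y - x) / dot (u i) x = dot ((dot (u i) x)^-1 *: u i - delta_mx 0 s) y.
  case: fy => ys _.
  rewrite dotDl dotZl -[- delta_mx 0 s]scaleN1r dotZl dot_delta_l ys dotBr.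
  by rewrite mulrBl mulfV // mulr1 [_^-1 * _]mulrC.
set Cc := 2 * C + 3 `^ p * 3 in hP *.
have Cc0 : 0 <= Cc by rewrite addr_ge0 ?mulr_ge0 ?powR_ge0.
pose L : R := d%:R `^ p * d%:R * (2 `^ p * 2).
have L0 : 0 <= L by rewrite !mulr_ge0 ?powR_ge0.
have hk i : kappa p (dot (u i) x) (bs i) <=
    L * \sum_t kappa p (dot (u i) x) (dot (u i) (z t - x)).
  apply: le_trans (kappa_sum p1 _ _) _; rewrite /L -[leRHS]mulrA.
  rewrite ler_wpM2l ?mulr_ge0 ?powR_ge0 // mulr_sumr; apply: ler_sum => t _.
  rewrite /bs; apply: le_trans (kappa_scale p _ _ _) _; first lra.
  by rewrite /kappa normr_id.
apply: le_trans (_ : \sum_i Cc ^+ 2 * (L ^+ 2 *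
  (d%:R * \sum_t kappa p (dot (u i) x) (dot (u i) (z t - x)) ^+ 2)) <= _).
  apply: ler_sum => i _.
  rewrite -real_normK ?num_real //.
  apply: le_trans (_ : (Cc * (L * \sum_t kappa p (dot (u i) x) (dot (u i) (z t - x)))) ^+ 2 <= _).
    rewrite lerXn2r ?nnegrE //.
      by rewrite !mulr_ge0 // sumr_ge0 // => t _; exact: kappa_ge0.
    by apply: le_trans (hP i) _; rewrite ler_wpM2l.
  rewrite !exprMn !ler_wpM2l ?sqr_ge0 //; exact: sqr_sum_le.
rewrite -!mulr_sumr exchange_big /approx_const -/Cc -/L -!mulrA.
rewrite !ler_wpM2l ?sqr_ge0 // mulr_natl -[X in _ *+ X]card_ord -sumr_const.
by apply: ler_sum => t _; have [_ h] := Yz t.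
Qed.

End local_approximation.

Lemma functional_choice X Y (P : X -> Y -> Prop) :
  (forall x, exists y, P x y) -> exists f, forall x, P x (f x).
Proof. by move=> /boolp.choice[f hf]; exists f. Qed.

(** The ratio of consecutive scales must absorb the quasi-triangle constant for pieces to be
    nested. *)
Lemma exists_chaining_scale (R : realType) (p : R) : 1 <= p ->
  exists th : R, [/\ 0 < th <= 2^-1 & Delta_const p * (th * th `^ p ^+ 2) <= 2^-1].
Proof.
move=> p1; have A0 := Delta_const_gt0 p.
pose th := Num.min 2^-1 (2 * Delta_const p)^-1.
have th0 : 0 < th by rewrite lt_min invr_gt0 ltr0n invr_gt0 mulr_gt0.
have th2 : th <= 2^-1 by rewrite ge_min lexx.
exists th; split; first by rewrite th0.
have h : th * th `^ p ^+ 2 <= th.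
  rewrite ler_piMr ?(ltW th0) // exprn_ile1 ?powR_ge0 //.
  rewrite -[leRHS](powRr0 th) ger_powR ?th0 //=; lra.
apply: le_trans (_ : Delta_const p * (2 * Delta_const p)^-1 <= _).
  rewrite ler_pM2l //; apply: le_trans h _.
  by rewrite ge_min lexx orbT.
by rewrite invfM mulrCA mulfV ?mulr1 // gt_eqF.
Qed.

Section chaining.
Variables (R : realType) (p : R) (m : nat).
Hypotheses (p1 : 1 <= p) (m0 : (0 < m)%N).
Variables (k : nat) (T : {poly R}) (C : R).
Hypotheses (pk : p <= k%:R) (C0 : 0 <= C) (sT : (size T <= k.+1)%N).
Hypothesis hT : forall s : R, `|s| <= 2^-1 -> `|(1 + s) `^ p - T.[s]| <= C * `|s| ^+ k.+1.
Variable th : R.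
Hypothesis th01 : 0 < th <= 2^-1.
Let vt := th * th `^ p ^+ 2.
Let A := Delta_const p.
Hypothesis Avt : A * vt <= 2^-1.

Let th0 : 0 < th. Proof. by case/andP: th01. Qed.
Let vt0 : 0 < vt. Proof. by rewrite mulr_gt0 // exprn_gt0 // powR_gt0. Qed.
Let A0 : 0 < A. Proof. exact: Delta_const_gt0. Qed.

(** Pieces have radius [B] times the scale: B >= 4 makes them cover the face, and 4A + B/2 <= B
    nests each of them in its parent. *)
Let B : R := 8 * A + 4.
Let B0 : 0 < B. Proof. by rewrite addr_gt0 // mulr_gt0. Qed.
Let C1 : R := approx_const p C m.+1.
Let C10 : 0 <= C1. Proof. exact: approx_const_ge0. Qed.
(** The last term pays for the approximation on the parent piece, whose radius is 1/vt times
    larger. *)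
Let C2 : R := 2 + 2 * (C1 * B) + 2 * (C1 * B / vt).
Let r := #|{: {ffun 'I_k -> 'I_m.+1}}|.

Variables (n : nat) (u : 'I_n -> 'rV[R]_m.+1) (s : 'I_m.+1).
Hypotheses (n0 : (0 < n)%N) (u1 : forall i, norm1 (u i) <= 1).

Let rad j : R := n%:R * vt ^+ j.
Let rad0 j : 0 <= rad j. Proof. by rewrite mulr_ge0 // exprn_ge0 // ltW. Qed.

(** Each polynomial is that of the parent piece plus a link, so the sum telescopes along a branch.
    The vectors [v] are the values of the links at the Fekete points of their pieces, and the square
    root is the error left at the finest level. *)
Lemma chaining : forall jm : nat,
  exists (Q : finType) (lvl : Q -> 'I_jm.+1) (v : Q -> 'I_n -> R),
  [/\ forall q, \sum_i v q i ^+ 2 <= C2 * (n%:R * vt ^+ lvl q),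
      forall j, #|[set q | lvl q == j]|%:R <= packing_const R m * r%:R * th^-1 ^+ (j * m) &
      forall (b : nat -> R) (y : 'I_n -> R), (forall i, `|y i| <= 1) ->
        (forall q, `|\sum_i y i * v q i| <= b (lvl q)) ->
        forall x, face s x -> `|\sum_i y i * `|dot (u i) x| `^ p| <=
          (2 * r%:R) * \sum_(j < jm.+1) b j +
            Num.sqrt (n%:R * (C1 * (B * (n%:R * vt ^+ jm))))].
Proof.
have /functional_choice[net hnet] : forall j, exists q : {N : nat & 'I_N -> 'rV[R]_m.+1},
  [/\ (projT1 q)%:R <= packing_const R m * th^-1 ^+ (j * m),
      forall a, face s (projT2 q a) &
      forall y, face s y -> exists a, Delta p u (projT2 q a) y <= 4 * rad j].
  move=> j.
  have dj : 0 < th ^+ j <= 1.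
    by rewrite exprn_gt0 //= exprn_ile1 ?(ltW th0) //; case/andP: th01; lra.
  have [N [x [h1 h2 h3]]] := separated_net s p1 m0 n0 dj u1.
  exists (existT (fun N => 'I_N -> 'rV[R]_m.+1) N x); split=> //=.
    by rewrite exprM exprVn.
  move=> y /h3[a ha]; exists a; apply: le_trans ha _.
  have -> // : th ^+ j * (th ^+ j) `^ p ^+ 2 = vt ^+ j.
  rewrite /vt exprMn; congr (_ * _).
  rewrite -exprM mulnC exprM; congr (_ ^+ 2).
  by rewrite -(powR_mulrn j (ltW th0)) -powRrM mulrC powRrM powR_mulrn ?powR_ge0.
pose N j := projT1 (net j).
pose Idx := {j : nat & 'I_(N j)}.
pose X (a : Idx) : 'rV[R]_m.+1 := projT2 (net (tag a)) (tagged a).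
have fX a : face s (X a) by have [_ h _] := hnet (tag a); exact: h.
pose Y (a : Idx) : set 'rV[R]_m.+1 := fun y => face s y /\ Delta p u (X a) y <= B * rad (tag a).
have YX a : Y a (X a) by split=> //; rewrite Delta_xx mulr_ge0 // ltW.
have /functional_choice[P hP] : forall a, exists Pa : 'I_n -> 'rV[R]_m.+1 -> R,
    (forall i, featured k s (Pa i)) /\
    forall y, Y a y -> \sum_i (`|dot (u i) y| `^ p - Pa i y) ^+ 2 <= C1 * (B * rad (tag a)).
  move=> a.
  have [|P [h1 h2]] := local_approximation p1 pk C0 sT hT u _ (fX a) (rho := B * rad (tag a)).
    by rewrite mulr_ge0 // ltW.
  by exists P; split=> // y [fy Dy]; exact: h2.
have sqrB2 (a b : R) : (a - b) ^+ 2 <= 2 * a ^+ 2 + 2 * b ^+ 2.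
  by have := sqr_ge0 (a + b); rewrite sqrrB sqrrD; lra.
have CB0 : 0 <= C1 * B by rewrite mulr_ge0 // ltW.
have /functional_choice[V hV] : forall a, exists Va : 'I_n -> 'rV[R]_m.+1 -> R,
    [/\ forall i, featured k s (Va i),
        forall y, Y a y -> \sum_i Va i y ^+ 2 <= C2 * rad (tag a) &
        match tag a with
        | 0%N => forall i y, P a i y = Va i y
        | j.+1 => exists a', [/\ tag a' = j, forall y, Y a y -> Y a' y &
                     forall i y, P a i y = Va i y + P a' i y]
        end].
  move=> [[|j] l].
    exists (P (existT _ 0 l)); split=> //; first by case: (hP (existT _ 0 l)).
    move=> y Yy; have [_ /(_ y Yy) h] := hP (existT _ 0 l).
    apply: le_trans (_ : \sum_i (2 * (`|dot (u i) y| `^ p) ^+ 2 +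
        2 * (`|dot (u i) y| `^ p - P (existT _ 0 l) i y) ^+ 2) <= _).
      apply: ler_sum => i _; apply: le_trans (sqrB2 _ _).
      by rewrite opprB addrC subrK.
    rewrite big_split /= -!mulr_sumr.
    have f1 : \sum_i (`|dot (u i) y| `^ p) ^+ 2 <= n%:R.
      rewrite -[X in _ <= X%:R]card_ord -sum1_card natr_sum; apply: ler_sum => i _.
      rewrite exprn_ile1 ?powR_ge0 //.
      have <- : 1 `^ p = 1 :> R by rewrite powR1.
      apply: ge0_ler_powR; rewrite ?nnegrE //; first exact: le_trans ler01 p1.
      apply: le_trans (dot_le _ Yy.1.2) _; rewrite mulr1; exact: u1.
    rewrite /rad /= expr0 !mulr1 in h *; rewrite /C2.
    have n1 : 0 <= n%:R :> R by [].
    have := mulr_ge0 (mulr_ge0 CB0 n1) (_ : 0 <= vt^-1); rewrite invr_ge0 ltW // => /(_ isT) h4.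
    by rewrite !mulrDl; lra.
  have [_ _ /(_ _ (fX (existT _ j.+1 l)))[l' hl']] := hnet j.
  pose a' : Idx := existT _ j l'; pose a : Idx := existT _ j.+1 l.
  (* The center of the child is within 4 rad j of the center of its parent, hence the nesting. *)
  have YY y : Y a y -> Y a' y.
    move=> [fy Dy]; split=> //; apply: le_trans (Delta_quasi u p1 _ (X a) _) _.
    apply: le_trans (_ : A * (4 * rad j + B * rad j.+1) <= _).
      by rewrite ler_pM2l // lerD.
    rewrite /= /rad exprS; set w := vt ^+ j.
    have w0 : 0 <= n%:R * w by rewrite mulr_ge0 // exprn_ge0 // ltW.
    have h : A * vt * (B * (n%:R * w)) <= 2^-1 * (B * (n%:R * w)).
      by rewrite ler_wpM2r // mulr_ge0 // ltW.
    have -> : A * (4 * (n%:R * w) + B * (n%:R * (vt * w))) =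
      4 * A * (n%:R * w) + A * vt * (B * (n%:R * w)) by lra.
    apply: le_trans (lerD (lexx _) h) _; rewrite /B; lra.
  exists (fun i y => P a i y - P a' i y); split.
  - move=> i; apply: featuredB; [exact: (hP a).1|exact: (hP a').1].
  - move=> y Yy; have h1 := (hP a).2 y Yy; have h2 := (hP a').2 y (YY y Yy).
    apply: le_trans (_ : \sum_i (2 * (`|dot (u i) y| `^ p - P a' i y) ^+ 2 +
        2 * (`|dot (u i) y| `^ p - P a i y) ^+ 2) <= _).
      apply: ler_sum => i _.
      have -> : P a i y - P a' i y =
        (`|dot (u i) y| `^ p - P a' i y) - (`|dot (u i) y| `^ p - P a i y) by lra.
      exact: sqrB2.
    rewrite big_split /= -!mulr_sumr.
    apply: le_trans (_ : 2 * (C1 * (B * rad j)) + 2 * (C1 * (B * rad j.+1)) <= _).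
      by rewrite lerD // ler_wpM2l.
    have -> : rad j = vt^-1 * rad j.+1.
      by rewrite /rad exprS mulrCA mulKf // gt_eqF.
    have := rad0 j.+1; rewrite /= /C2; lra.
  - by exists a'; split=> // i y; rewrite subrK.
have /functional_choice[z hz] : forall a, exists za : 'I_r -> 'rV[R]_m.+1,
    (forall t, Y a (za t)) /\
    forall y, Y a y -> exists c : 'I_r -> R, (forall t, `|c t| <= 2) /\
      forall g, featured k s g -> g y = \sum_t c t * g (za t).
  by move=> a; exact: (@fekete_features R k m.+1 s (Y a) (X a) (YX a) (fun y h => h.1)).
move=> jm.
pose Q : finType := {j : 'I_jm.+1 & ('I_(N j) * 'I_r)%type}.
pose idx (q : Q) : Idx := existT _ (nat_of_ord (tag q)) (tagged q).1.
exists Q, (fun q => tag q), (fun q i => V (idx q) i (z (idx q) (tagged q).2)).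
split.
- move=> q; have [_ h _] := hV (idx q); apply: h; exact: (hz (idx q)).1.
- move=> j; have [h _ _] := hnet j.
  have -> : #|[set q : Q | tag q == j]| = (N j * r)%N.
    rewrite -sum1_card (eq_bigl (fun q : Q => (tag q == j) && true)); last first.
      by move=> q; rewrite inE andbT.
    rewrite -(sig_big_dep (fun i => i == j) (fun _ _ => true) (fun _ _ => 1%N)) /=.
    by rewrite big_pred1_eq sum1_card card_prod !card_ord.
  by rewrite natrM mulrAC ler_wpM2r.
move=> b y y1 hq x fx.
have claim j : (j <= jm)%N -> forall a, tag a = j -> forall w, Y a w ->
    `|\sum_i y i * P a i w| <= (2 * r%:R) * \sum_(l < j.+1) b l.
  (* A link at any point of its piece is a combination of its [r] tested values with coefficients at
     most 2, whence the factor 2r. *)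
  have step a : (tag a <= jm)%N -> forall w, Y a w ->
      `|\sum_i y i * V a i w| <= 2 * r%:R * b (tag a).
    move=> ajm w Yw; have [c [c2 hc]] := (hz a).2 w Yw.
    have [fV _ _] := hV a.
    rewrite (eq_bigr (fun i => \sum_t c t * (y i * V a i (z a t)))); last first.
      move=> i _; rewrite (hc _ (fV i)) mulr_sumr; apply: eq_bigr => t _.
      by rewrite mulrCA.
    rewrite exchange_big /=; apply: le_trans (ler_norm_sum _ _ _) _.
    rewrite mulrAC -[r in leRHS]card_ord mulr_natr -sumr_const; apply: ler_sum => t _.
    rewrite -mulr_sumr normrM.
    have ltj : (tag a < jm.+1)%N by [].
    have := hq (existT _ (Ordinal ltj) (tagged a, t)).
    have -> : idx (existT _ (Ordinal ltj) (tagged a, t)) = a by case: (a) ltj.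
    by move=> h; apply: ler_pM.
  elim: j => [|j IHj] jjm a aj w Yw.
    have [_ _] := hV a; rewrite aj => hPV.
    have := step a _ w Yw; rewrite aj => /(_ isT) h.
    by rewrite big_ord1; under eq_bigr do rewrite hPV.
  have [_ _] := hV a; rewrite aj => -[a' [a'j YY hPV]].
  under eq_bigr do rewrite hPV mulrDr.
  rewrite big_split /= big_ord_recr /= mulrDr addrC; apply: le_trans (ler_normD _ _) _.
  rewrite lerD //; first by apply: (IHj _ a') => //; [exact: ltnW|exact: YY].
  by have := step a _ w Yw; rewrite aj => /(_ jjm).
have [_ _ /(_ x fx)[l hl]] := hnet jm.
pose a : Idx := existT _ jm l.
have Yx : Y a x.
  split=> //; apply: le_trans hl _; rewrite ler_wpM2r // /B lerDr mulr_ge0 //; exact: ltW.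
have -> : \sum_i y i * `|dot (u i) x| `^ p =
    \sum_i y i * P a i x + \sum_i y i * (`|dot (u i) x| `^ p - P a i x).
  by rewrite -big_split /=; apply: eq_bigr => i _; rewrite -mulrDr addrC subrK.
apply: le_trans (ler_normD _ _) _; rewrite lerD //; first exact: claim.
rewrite -sqrtr_sqr; apply: ler_wsqrtr.
apply: le_trans (sqr_sum_le _) _; rewrite ler_wpM2l //.
apply: le_trans _ ((hP a).2 x Yx); apply: ler_sum => i _.
rewrite exprMn ler_piMl ?sqr_ge0 // -real_normK ?num_real //.
by rewrite exprn_ile1.
Qed.

End chaining.

(** * Costs and discrepancies summed over the scales *)

Lemma sum_geometric_dist (R : realType) (x : R) (J N : nat) : 0 <= x < 1 ->
  \sum_(j < N) x ^+ `|j%:Z - J%:Z|%N <= 1 + 2 * (x / (1 - x)).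
Proof.
move=> x01; have /andP[x0 x1] := x01.
apply: le_trans (sum_expr_dist_le (N + J) x01).
rewrite -(big_mkord xpredT (fun j => x ^+ `|j%:Z - (N + J)%N%:Z|%N)).
rewrite (@big_cat_nat _ _ _ N) //=; last lia.
rewrite (@big_cat_nat _ _ _ (N + N)%N N) /=; [|lia|lia].
apply: ler_wpDl; first by apply: sumr_ge0 => i _; exact: exprn_ge0.
apply: ler_wpDr; first by apply: sumr_ge0 => i _; exact: exprn_ge0.
rewrite -[X in \sum_(X <= _ < _) _]add0n big_addn addnK big_mkord.
apply: ler_sum => j _; rewrite le_eqVlt; apply/orP; left; apply/eqP; congr (_ ^+ _); lia.
Qed.

Lemma natr_le_geometric (R : realType) (t : nat) : t%:R <= 2 * (3 / 2 : R) ^+ t.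
Proof.
elim: t => [|t IHt]; first by rewrite expr0; lra.
have h : 1 <= (3 / 2 : R) ^+ t by apply: exprn_ege1; lra.
rewrite -natr1 exprS; lra.
Qed.

Section cost.
Variable R : realType.

(** Polynomial decay suffices; it will be used at order m + 1, one more than the growth exponent of
    the number of pieces. *)
Lemma coloring_cost_large (l : R) k : 0 < l ->
  coloring_cost l <= (2 * expR 8 + 2) * (k.+1)`!%:R * l^-1 ^+ k.+1.
Proof.
move=> l0; have h := expR_ge1Dxn k (ltW l0).
set q := l ^+ k.+1 / (k.+1)`!%:R in h *.
have q0 : 0 < q by rewrite divr_gt0 ?exprn_gt0 // ltr0n fact_gt0.
have h1 : (expR l - 1)^-1 <= q^-1 by rewrite lef_pV2 ?posrE; lra.
have h2 : expR (- l) <= q^-1.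
  by rewrite expRN lef_pV2 ?posrE ?expR_gt0 //; lra.
have h3 : ln (1 + 2 * (expR l - 1)^-1) <= 2 * (expR l - 1)^-1.
  apply: le_ln1Dx; apply: lt_le_trans (ltrN10 R) _.
  by rewrite mulr_ge0 // invr_ge0 subr_ge0 ltW // expR_gt1.
have -> : (2 * expR 8 + 2) * (k.+1)`!%:R * l^-1 ^+ k.+1 = 2 * expR 8 * q^-1 + 2 * q^-1.
  by rewrite /q invf_div exprVn; lra.
by rewrite /coloring_cost lerD //; [rewrite ler_wpM2l ?mulr_ge0 ?expR_ge0|lra].
Qed.

Lemma coloring_cost_small (l : R) : 0 < l <= 1 ->
  coloring_cost l <= 2 * expR 8 + 2 + ln l^-1.
Proof.
move=> /andP[l0 l1]; rewrite /coloring_cost -addrA; apply: lerD.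
  rewrite ler_piMr ?mulr_ge0 ?expR_ge0 // expR_le1; lra.
have h := expR_ge1Dx l.
have h1 : (expR l - 1)^-1 <= l^-1 by rewrite lef_pV2 ?posrE; lra.
have h2 : 1 <= l^-1 by rewrite invf_ge1.
apply: le_trans (_ : ln (3 * l^-1) <= _).
  have pos : 0 < 1 + 2 * (expR l - 1)^-1.
    by rewrite ltr_pwDl // mulr_ge0 // invr_ge0; lra.
  by rewrite ler_ln ?posrE ?mulr_gt0 ?invr_gt0 //; move: h1 h2; lra.
rewrite lnM ?posrE ?invr_gt0 // lerD2r.
have -> : 3 = 1 + 2 :> R by lra.
by apply: le_ln1Dx; lra.
Qed.

(** [t] counts the levels away from the balanced one. On the fine side the decay of the cost beats
    the growth of the number of pieces; on the coarse side the cost is only linear in [t], against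
    geometrically fewer pieces. Passing from the ratio 1/2 to 3/4 absorbs the factor [t]. *)
Lemma coloring_cost_bounds (th : R) (m a : nat) : 0 < th <= 2^-1 -> (0 < m)%N ->
  exists2 K : R, 0 < K & forall t : nat,
    coloring_cost (th^-1 ^+ t) * th^-1 ^+ (t * m) <= K * (3 / 4) ^+ t /\
    coloring_cost (th ^+ (t * a)) * th ^+ (t * m) <= K * (3 / 4) ^+ t.
Proof.
move=> /andP[th0 th2] m0.
have X1 : 1 <= th^-1 by rewrite invf_ge1 //; lra.
pose K0 : R := (2 * expR 8 + 2) * (m.+1)`!%:R.
pose K1 : R := 2 * expR 8 + 2 + 2 * (a%:R * th^-1).
have e8 : 0 <= expR 8 :> R by exact: expR_ge0.
have K00 : 0 < K0 by rewrite mulr_gt0 ?ltr0n ?fact_gt0 //; lra.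
have aX : 0 <= a%:R * th^-1 by rewrite mulr_ge0 // invr_ge0 ltW.
have K10 : 0 < K1 by rewrite /K1; lra.
exists (K0 + K1); first exact: addr_gt0.
move=> t.
have g0 : 0 <= (3 / 4 : R) ^+ t by apply: exprn_ge0; lra.
have tht : th ^+ t <= (2^-1) ^+ t by rewrite lerXn2r ?nnegrE ?(ltW th0) //; lra.
have half34 : (2^-1 : R) ^+ t <= (3 / 4) ^+ t by rewrite lerXn2r ?nnegrE //; lra.
split.
  apply: le_trans (_ : K0 * th ^+ t <= _).
    have Xt0 : 0 < th^-1 ^+ t by rewrite exprn_gt0 // invr_gt0.
    apply: le_trans (ler_wpM2r _ (coloring_cost_large m Xt0)) _.
      by rewrite exprn_ge0 // invr_ge0 ltW.
    rewrite -/K0 -mulrA ler_wpM2l ?(ltW K00) //.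
    rewrite exprS exprM -mulrA -exprMn mulVf ?gt_eqF // expr1n mulr1.
    by rewrite -exprVn invrK.
  apply: le_trans (_ : K0 * (3 / 4) ^+ t <= _).
    by rewrite ler_wpM2l ?(ltW K00) //; apply: le_trans tht half34.
  by rewrite ler_wpM2r // lerDl ltW.
have l01 : 0 < th ^+ (t * a) <= 1.
  by rewrite exprn_gt0 //= exprn_ile1 ?(ltW th0) //; lra.
apply: le_trans (ler_wpM2r _ (coloring_cost_small l01)) _.
  by rewrite exprn_ge0 // ltW.
apply: le_trans (_ : K1 * (3 / 4) ^+ t <= _); last first.
  by rewrite ler_wpM2r // lerDr ltW.
have lnX : ln (th ^+ (t * a))^-1 <= t%:R * (a%:R * th^-1).
  rewrite -exprVn lnXn ?invr_gt0 // -[leLHS]mulr_natl natrM -mulrA.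
  rewrite ler_wpM2l // ler_wpM2l //.
  have : 1 + (th^-1 - 1) = th^-1 by lra.
  move=> {1}<-; apply: le_trans (le_ln1Dx _) _; lra.
have thm : th ^+ (t * m) <= (2^-1) ^+ t.
  apply: le_trans tht; rewrite -[m]prednK // mulnS exprD ler_piMr ?exprn_ge0 ?(ltW th0) //.
  by rewrite exprn_ile1 ?(ltW th0) //; lra.
have h2 : 0 <= (2^-1 : R) ^+ t by apply: exprn_ge0; lra.
apply: le_trans (_ : (2 * expR 8 + 2 + t%:R * (a%:R * th^-1)) * (2^-1) ^+ t <= _).
  apply: ler_pM => //; last by rewrite lerD2l.
    by rewrite addr_ge0 ?addr_ge0 ?mulr_ge0 // ln_ge0 // -exprVn exprn_ege1.
  by rewrite exprn_ge0 // ltW.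
rewrite [leLHS]mulrDl /K1 [leRHS]mulrDl lerD //.
  by rewrite ler_wpM2l // addr_ge0 ?mulr_ge0.
have -> : t%:R * (a%:R * th^-1) * 2^-1 ^+ t = (a%:R * th^-1) * (t%:R * 2^-1 ^+ t) by lra.
rewrite [2 * _]mulrC -[leRHS]mulrA ler_wpM2l //.
apply: le_trans (ler_wpM2r h2 (natr_le_geometric R t)) _.
rewrite -mulrA ler_wpM2l // -exprMn le_eqVlt; apply/orP; left; apply/eqP; congr (_ ^+ _); lra.
Qed.

End cost.

Lemma packing_const_ge0 (R : realType) m : 0 <= packing_const R m.
Proof. by rewrite !mulr_ge0 ?exprn_ge0 // addr_ge0 // mulr_ge0. Qed.

Lemma coloring_cost_ge0 (R : realType) (l : R) : 0 < l -> 0 <= coloring_cost l.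
Proof.
move=> l0; rewrite addr_ge0 ?mulr_ge0 ?expR_ge0 // ln_ge0 // lerDl mulr_ge0 //.
by rewrite invr_ge0 subr_ge0 ltW // expR_gt1.
Qed.

(** The constants are chosen before the atoms, the face and the depth. *)
Lemma chaining_constants (R : realType) (p : R) (m : nat) : 1 <= p -> (0 < m)%N ->
  exists (th C2 D3 C4 C5 : R), [/\ 0 < th <= 2^-1, 0 < C2, 0 <= D3, 0 <= C4 & 0 <= C5] /\
  forall n (u : 'I_n -> 'rV[R]_m.+1) (s : 'I_m.+1) (jm : nat), (0 < n)%N ->
  (forall i, norm1 (u i) <= 1) ->
  exists (Q : finType) (lvl : Q -> 'I_jm.+1) (v : Q -> 'I_n -> R),
  [/\ forall q, \sum_i v q i ^+ 2 <= C2 * (n%:R * (th * th `^ p ^+ 2) ^+ lvl q),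
      forall j, #|[set q | lvl q == j]|%:R <= D3 * th^-1 ^+ (j * m) &
      forall (b : nat -> R) (y : 'I_n -> R), (forall i, `|y i| <= 1) ->
        (forall q, `|\sum_i y i * v q i| <= b (lvl q)) ->
        forall x, face s x -> `|\sum_i y i * `|dot (u i) x| `^ p| <=
          C4 * \sum_(j < jm.+1) b j +
            Num.sqrt (n%:R * (C5 * (n%:R * (th * th `^ p ^+ 2) ^+ jm)))].
Proof.
move=> p1 m0.
have [th [th01 Ath]] := exists_chaining_scale p1.
have [T [C [sT C0 hT]]] := taylor_powR (Num.truncn p).+2 p.
have pk : p <= (Num.truncn p).+1%:R by exact/ltW/truncnS_gt.
pose A := Delta_const p; pose B : R := 8 * A + 4.
pose C1 := approx_const p C m.+1.
pose vt := th * th `^ p ^+ 2.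
have A0 : 0 < A by exact: Delta_const_gt0.
have B0 : 0 <= B by rewrite addr_ge0 // mulr_ge0 // ltW.
have C10 : 0 <= C1 by exact: approx_const_ge0.
have vt0 : 0 < vt by case/andP: th01 => th0 _; rewrite mulr_gt0 // exprn_gt0 // powR_gt0.
exists th, (2 + 2 * (C1 * B) + 2 * (C1 * B / vt)),
  (packing_const R m * #|{: {ffun 'I_(Num.truncn p).+1 -> 'I_m.+1}}|%:R),
  (2 * #|{: {ffun 'I_(Num.truncn p).+1 -> 'I_m.+1}}|%:R), (C1 * B).
have CB : 0 <= C1 * B by exact: mulr_ge0.
split; first split => //.
- have : 0 <= C1 * B / vt by rewrite divr_ge0 // ltW.
  lra.
- by rewrite mulr_ge0 // packing_const_ge0.
move=> n u s jm n0 u1.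
have [Q [lvl [v [h1 h2 h3]]]] := chaining p1 m0 pk C0 sT hT th01 Ath s n0 u1 jm.
exists Q, lvl, v; split=> // b y y1 hy x fx.
by have := h3 b y y1 hy x fx; rewrite [C1 * (_ * _)]mulrA.
Qed.

Lemma absz_subDr (j t : nat) : `|j%:Z - (j + t)%N%:Z|%N = t.
Proof. lia. Qed.

Lemma absz_subDl (j t : nat) : `|(j + t)%N%:Z - j%:Z|%N = t.
Proof. lia. Qed.

(** The product of [lam] and of the standard deviation peaks at [J]: on the coarse side th^(2(k+1))
    <= vt/2, because k >= p; on the fine side th^-2 vt <= 1/2, because p >= 1. Finally 1/2 <=
    (3/4)^2. *)
Lemma level_discrepancy (R : realType) (p th : R) (k J j : nat) : 1 <= p -> p <= k%:R ->
  0 < th <= 2^-1 -> let vt := th * th `^ p ^+ 2 in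
  forall c : R, 0 <= c ->
  (if (j <= J)%N then th ^+ ((J - j) * k.+1) else th^-1 ^+ (j - J)) *
    Num.sqrt (c * vt ^+ j) <= (3 / 4) ^+ `|j%:Z - J%:Z|%N * Num.sqrt (c * vt ^+ J).
Proof.
move=> p1 pk /andP[th0 th2] vt c c0.
have vt0 : 0 < vt by rewrite mulr_gt0 // exprn_gt0 // powR_gt0.
have th1 : th <= 1 by lra.
have thp : th `^ p <= th.
  by rewrite -[leRHS](powRr1 (ltW th0)) ger_powR // th0.
have thk : th ^+ k <= th `^ p.
  by rewrite -(powR_mulrn _ (ltW th0)) ger_powR // th0.
have thp0 : 0 <= th `^ p by exact: powR_ge0.
have thk0 : 0 <= th ^+ k by rewrite exprn_ge0 // ltW.
have e1 : (th ^+ k.+1) ^+ 2 <= 2^-1 * vt.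
  rewrite (exprS th k) exprMn /vt.
  have h1 : (th ^+ k) ^+ 2 <= th `^ p ^+ 2 by rewrite lerXn2r ?nnegrE.
  apply: le_trans (_ : th ^+ 2 * th `^ p ^+ 2 <= _).
    by rewrite ler_wpM2l // sqr_ge0.
  by rewrite expr2 -mulrA ler_wpM2r // mulr_ge0 ?sqr_ge0 // ltW.
have e2 : (th^-1) ^+ 2 * vt <= 2^-1.
  have h1 : th `^ p ^+ 2 <= th ^+ 2 by rewrite lerXn2r ?nnegrE // ltW.
  apply: le_trans (_ : th^-1 ^+ 2 * (th * th ^+ 2) <= _).
    by rewrite ler_wpM2l ?sqr_ge0 // ler_wpM2l // ltW.
  by rewrite mulrCA -exprMn mulVf ?gt_eqF // expr1n mulr1.
have s34 : 2^-1 <= (3 / 4 : R) ^+ 2 by rewrite expr2; lra.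
set lam := (X in X * _ <= _).
have lam0 : 0 <= lam.
  by rewrite /lam; case: ifP => _; rewrite exprn_ge0 ?invr_ge0 ?(ltW th0).
rewrite -[lam]ger0_norm // -sqrtr_sqr -sqrtrM ?sqr_ge0 //.
have g0 t : 0 <= (3 / 4 : R) ^+ t by apply: exprn_ge0; lra.
rewrite -[(3 / 4) ^+ _]ger0_norm // -sqrtr_sqr -sqrtrM ?sqr_ge0 //.
apply: ler_wsqrtr; rewrite !(mulrCA _ c) ler_wpM2l //.
rewrite -exprM mulnC exprM /lam; case: ifP => jJ.
  have [t Jt] : exists t, J = (j + t)%N by exists (J - j)%N; rewrite subnKC.
  rewrite Jt addKn.
  rewrite absz_subDr.
  have -> : (th ^+ (t * k.+1)) ^+ 2 = ((th ^+ k.+1) ^+ 2) ^+ t.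
    by rewrite mulnC exprM exprAC.
  have h : ((th ^+ k.+1) ^+ 2) ^+ t <= ((3 / 4) ^+ 2) ^+ t * vt ^+ t.
    rewrite -exprMn; apply: lerXn2r; rewrite ?nnegrE;
      [exact: sqr_ge0|exact: mulr_ge0 (sqr_ge0 _) (ltW vt0)|].
    by apply: le_trans e1 _; rewrite ler_wpM2r // ltW.
  by rewrite exprD [vt ^+ j * _]mulrC mulrA ler_wpM2r // exprn_ge0 // ltW.
have [t jt] : exists t, j = (J + t)%N.
  by exists (j - J)%N; rewrite subnKC // ltnW // ltnNge jJ.
rewrite jt addKn.
rewrite absz_subDl.
have -> : (th^-1 ^+ t) ^+ 2 = (th^-1 ^+ 2) ^+ t.
  exact: exprAC.
have h : (th^-1 ^+ 2) ^+ t * vt ^+ t <= ((3 / 4) ^+ 2) ^+ t.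
  rewrite -exprMn; apply: lerXn2r; rewrite ?nnegrE;
    [exact: mulr_ge0 (sqr_ge0 _) (ltW vt0)|exact: sqr_ge0|].
  exact: le_trans e2 s34.
by rewrite exprD [vt ^+ J * _]mulrC mulrA ler_wpM2r // exprn_ge0 // ltW.
Qed.

Lemma sum_three_quarters (R : realType) (J N : nat) :
  \sum_(j < N) (3 / 4 : R) ^+ `|j%:Z - J%:Z|%N <= 7.
Proof.
have h : 0 <= (3 / 4 : R) < 1 by apply/andP; split; lra.
apply: le_trans (sum_geometric_dist J N h) _.
have -> : 1 - 3 / 4 = 4^-1 :> R by lra.
by rewrite invrK; lra.
Qed.

(* The levels are balanced around the last [J] at which the number of cells is
   still a small fraction of [n]. *)
Lemma balanced_level (R : realType) (M0 th : R) (m n : nat) :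
  1 <= M0 -> 0 < th <= 2^-1 -> (0 < m)%N -> M0 <= n%:R ->
  exists J, M0 * th^-1 ^+ (J * m) <= n%:R < M0 * th^-1 ^+ (J.+1 * m).
Proof.
move=> M1 /andP[th0 th2] m0 Mn.
have X2 : 2 <= th^-1 by rewrite -[2]invrK lef_pV2 ?posrE ?invr_gt0.
pose P J := M0 * th^-1 ^+ (J * m) <= n%:R.
have exP : exists J, P J by exists 0%N; rewrite /P mul0n expr0 mulr1.
have ub J : P J -> (J <= n)%N.
  move=> PJ; rewrite -(ler_nat R); apply: le_trans PJ.
  apply: le_trans (_ : 2 ^+ J <= _).
    by rewrite -natrX ler_nat ltnW // ltn_expl.
  apply: le_trans (_ : th^-1 ^+ J <= _); first by rewrite lerXn2r ?nnegrE //; lra.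
  rewrite -[leLHS]mul1r ler_pM ?exprn_ge0 //; [lra|].
  by apply: ler_weXn2l; [lra|rewrite leq_pmulr].
case: (ex_maxnP exP ub) => J PJ Jmax; exists J; apply/andP; split; first exact: PJ.
rewrite ltNge.
by apply/negP => /Jmax; rewrite ltnn.
Qed.

Section sum_over_levels.
Variables (R : realType) (m jm : nat) (Q : 'I_m.+1 -> finType) (lvl : forall s, Q s -> 'I_jm.+1).

Lemma sum_by_level (F : nat -> R) :
  \sum_(q : {s : 'I_m.+1 & Q s}) F (lvl (tagged q)) =
  \sum_s \sum_(j < jm.+1) #|[set q : Q s | lvl q == j]|%:R * F j.
Proof.
rewrite -(sig_big_dep xpredT (fun _ _ => true) (fun s (q : Q s) => F (lvl q))) /=.
apply: eq_bigr => s _.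
rewrite (partition_big (@lvl s) predT) //=; apply: eq_bigr => j _.
rewrite (eq_bigr (fun=> F j)); last by move=> q /eqP ->.
by rewrite sumr_const -[LHS]mulr_natl cardsE.
Qed.

End sum_over_levels.

Lemma dot_powR_scale (R : realType) d (p M : R) n (y : 'I_n -> R) (u : 'I_n -> 'rV[R]_d) x :
  0 <= M -> \sum_i y i * `|dot (u i) (M *: x)| `^ p = M `^ p * \sum_i y i * `|dot (u i) x| `^ p.
Proof.
move=> M0; rewrite mulr_sumr; apply: eq_bigr => i _.
by rewrite dotZr normrM (ger0_norm M0) powRM // mulrCA.
Qed.

(** Dividing by a coordinate of largest modulus moves any nonzero point to a face; its sign is lost
    in the absolute values. *)
Lemma from_faces (R : realType) m (p D : R) n (y : 'I_n -> R) (u : 'I_n -> 'rV[R]_m.+1) :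
  0 <= p -> p != 0 -> 0 <= D ->
  (forall s x, face s x -> `|\sum_i y i * `|dot (u i) x| `^ p| <= D) ->
  forall (x : 'rV[R]_m.+1) M, 0 <= M -> (forall t, `|x 0 t| <= M) ->
  `|\sum_i y i * `|dot (u i) x| `^ p| <= D * M `^ p.
Proof.
move=> p0 pn0 D0 hD x M M0 xM.
have [s _ smax] := @arg_maxP _ _ _ ord0 predT (fun t => `|x 0 t|) isT.
set mu := x 0 s in smax.
have [mu0|mu0] := eqVneq mu 0.
  have -> : x = 0 *: x.
    apply/rowP => t; rewrite mxE mul0r; apply/eqP; rewrite -normr_le0.
    by have := smax t isT; rewrite mu0 normr0.
  rewrite dot_powR_scale // powR0 // mul0r normr0 mulr_ge0 ?powR_ge0 //.
have mup : 0 < `|mu| by rewrite normr_gt0.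
have -> : \sum_i y i * `|dot (u i) x| `^ p =
    `|mu| `^ p * \sum_i y i * `|dot (u i) (mu^-1 *: x)| `^ p.
  rewrite mulr_sumr; apply: eq_bigr => i _; rewrite mulrCA; congr (_ * _).
  rewrite -powRM // -normrM -dotZr scalerA mulfV // scale1r //.
rewrite normrM (ger0_norm (powR_ge0 _ _)) mulrC.
apply: ler_pM; rewrite ?powR_ge0 //.
  apply: (hD s); split; first by rewrite mxE mulVf.
  by move=> t; rewrite mxE normrM normfV ler_pdivrMl // mulr1; exact: smax.
by apply: ge0_ler_powR; rewrite ?nnegrE //; exact: xM.
Qed.

(** The maximality of [J] gives th^(J m) = O(1/n), and (th * th^(2p))^J is the power (2p+1)/m of
    th^(J m). *)
Lemma level_error_bound (R : realType) (p th M0 : R) (m n J : nat) :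
  1 <= p -> 0 < th -> 0 < M0 -> (0 < m)%N -> (0 < n)%N ->
  n%:R < M0 * th^-1 ^+ (J.+1 * m) ->
  Num.sqrt (n%:R * (th * th `^ p ^+ 2) ^+ J) <=
   Num.sqrt ((M0 * th^-1 ^+ m) `^ ((2 * p + 1) / m%:R)) *
   n%:R `^ ((1 - (2 * p + 1) / m%:R) / 2).
Proof.
move=> p1 th0 M00 m0 n0 nM.
have nR : 0 < n%:R :> R by rewrite ltr0n.
have mR : 0 < m%:R :> R by rewrite ltr0n.
set W := M0 * th^-1 ^+ m; set e := (2 * p + 1) / m%:R.
have e0 : 0 <= e by rewrite divr_ge0 //; lra.
have W0 : 0 < W by rewrite mulr_gt0 // exprn_gt0 // invr_gt0.
have t0 : 0 < th ^+ (J * m) by rewrite exprn_gt0.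
have tle : th ^+ (J * m) <= W / n%:R.
  move: nM; rewrite mulSn exprD mulrA => nM.
  by rewrite ler_pdivlMr // mulrC -ler_pdivlMr // -exprVn ltW.
have -> : (th * th `^ p ^+ 2) ^+ J = (th ^+ (J * m)) `^ e.
  rewrite -(powR_mulrn _ (ltW th0)) -powRrM natrM /e -mulrA [m%:R * _]mulrC mulfVK ?gt_eqF //.
  rewrite [J%:R * _]mulrC powRrM powR_mulrn ?powR_ge0 //; congr (_ ^+ J).
  rewrite powRD; last by rewrite (gt_eqF th0) implybT.
  by rewrite powRr1 ?(ltW th0) // mulrC [2 * p]mulrC powRrM -[2]/(2%:R) powR_mulrn ?powR_ge0.
apply: le_trans (_ : Num.sqrt (W `^ e * n%:R `^ (1 - e)) <= _).
  apply: ler_wsqrtr.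
  apply: le_trans (_ : n%:R * (W / n%:R) `^ e <= _).
    rewrite ler_pM2l //; apply: ge0_ler_powR; rewrite ?nnegrE ?(ltW t0) //.
    by rewrite divr_ge0 // ltW.
  rewrite powRM ?invr_ge0 ?(ltW W0) // mulrCA ler_wpM2l ?powR_ge0 //.
  rewrite powRB; last by rewrite (gt_eqF nR) implybT.
  by rewrite powRr1 // -powR_inv1 // -powRrM mulN1r powRN.
rewrite sqrtrM ?powR_ge0 // ler_wpM2l ?sqrtr_ge0 //.
by rewrite -powR12_sqrt ?powR_ge0 // -powRrM.
Qed.

Theorem partial_coloring_powers (R : realType) (p : R) (m : nat) : 1 <= p -> (0 < m)%N ->
  exists (C : R) (N0 : nat), [/\ 0 < C, (0 < N0)%N &
  forall n (u : 'I_n -> 'rV[R]_m.+1), (N0 <= n)%N -> (forall i, norm1 (u i) <= 1) ->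
  exists y : 'I_n -> R, [/\ forall i, y i \in [:: -1; 0; 1],
    (n <= 8 * #|[set i | y i != 0%R]|)%N &
    forall (x : 'rV[R]_m.+1) M, 0 <= M -> (forall t, `|x 0 t| <= M) ->
      `|\sum_i y i * `|dot (u i) x| `^ p| <=
         C * n%:R `^ ((1 - (2 * p + 1) / m%:R) / 2) * M `^ p]].
Proof.
move=> p1 m0.
have [th [C2 [D3 [C4 [C5 [[th01 C20 D30 C40 C50] chain]]]]]] := chaining_constants p1 m0.
have /andP[th0 th2] := th01.
pose k := (Num.truncn p).+1.
have pk : p <= k%:R by exact/ltW/truncnS_gt.
have [K K0 hK] := coloring_cost_bounds k.+1 th01 m0.
(* The total cost is at most 7 (m+1) D3 K th^(-J m), which must stay below n/8; 64 exceeds 8 * 7. *)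
pose M0 : R := 64 * (m.+1%:R * (D3 * K)) + 1.
have M1 : 1 <= M0 by rewrite lerDr !mulr_ge0 // ltW.
have M00 : 0 < M0 by exact: lt_le_trans ltr01 M1.
pose vt := th * th `^ p ^+ 2.
have vt0 : 0 < vt by rewrite mulr_gt0 // exprn_gt0 // powR_gt0.
have vt2 : vt <= 2^-1.
  apply: le_trans th2; rewrite /vt ler_piMr ?(ltW th0) // exprn_ile1 ?powR_ge0 //.
  rewrite -[leRHS](powRr0 th) ger_powR ?th0 //=; lra.
pose W := Num.sqrt ((M0 * th^-1 ^+ m) `^ ((2 * p + 1) / m%:R)).
pose C := (C4 * (7 * Num.sqrt C2) + Num.sqrt C5) * W + 1.
have W0 : 0 <= W by exact: sqrtr_ge0.
have C0 : 0 < C.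
  by rewrite ltr_wpDl // mulr_ge0 // addr_ge0 ?sqrtr_ge0 // mulr_ge0 // mulr_ge0 // sqrtr_ge0.
exists C, (Num.truncn M0).+1; split=> // n u nN u1.
have n0 : (0 < n)%N by exact: leq_ltn_trans nN.
have nR : 0 < n%:R :> R by rewrite ltr0n.
have Mn : M0 <= n%:R.
  by apply: le_trans (_ : (Num.truncn M0).+1%:R <= _); [exact/ltW/truncnS_gt|rewrite ler_nat].
have [J /andP[J1 J2]] := balanced_level M1 th01 m0 Mn.
(* n further levels make the final error no larger than the one at [J], as n vt^n <= 1. *)
pose jm := (J + n)%N.
have /functional_choice[data hdata] : forall s : 'I_m.+1,
  exists d : {Q : finType & ((Q -> 'I_jm.+1) * (Q -> 'I_n -> R))%type},
  [/\ forall q, \sum_i (projT2 d).2 q i ^+ 2 <= C2 * (n%:R * vt ^+ (projT2 d).1 q),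
      forall j, #|[set q | (projT2 d).1 q == j]|%:R <= D3 * th^-1 ^+ (j * m) &
      forall (b : nat -> R) (y : 'I_n -> R), (forall i, `|y i| <= 1) ->
        (forall q, `|\sum_i y i * (projT2 d).2 q i| <= b ((projT2 d).1 q)) ->
        forall x, face s x -> `|\sum_i y i * `|dot (u i) x| `^ p| <=
          C4 * \sum_(j < jm.+1) b j + Num.sqrt (n%:R * (C5 * (n%:R * vt ^+ jm)))].
  move=> s; have [Q [lvl [v [h1 h2 h3]]]] := chain n u s jm n0 u1.
  by exists (existT (fun Q : finType => ((Q -> 'I_jm.+1) * (Q -> 'I_n -> R))%type) Q (lvl, v)).
pose Qs s : finType := projT1 (data s).
pose lvl s : Qs s -> 'I_jm.+1 := (projT2 (data s)).1.
pose v s : Qs s -> 'I_n -> R := (projT2 (data s)).2.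
(* The constraints of all the faces are imposed on a single coloring. *)
pose Q : finType := {s : 'I_m.+1 & Qs s}.
(* Strict constraints on the few coarse links, loose ones on the many fine links, and one standard
   deviation at [J]. *)
pose lam (j : nat) : R := if (j <= J)%N then th ^+ ((J - j) * k.+1) else th^-1 ^+ (j - J).
have lam0 j : 0 < lam j by rewrite /lam; case: ifP => _; rewrite exprn_gt0 ?invr_gt0.
pose sg (j : nat) : R := Num.sqrt (C2 * (n%:R * vt ^+ j)).
have sgp j : 0 < C2 * (n%:R * vt ^+ j) by rewrite !mulr_gt0 // exprn_gt0.
have sg0 j : 0 < sg j by rewrite sqrtr_gt0.
have budget : \sum_(q : Q) coloring_cost (lam (lvl (tag q) (tagged q))) <= n%:R / 8.
  rewrite (sum_by_level lvl (fun j => coloring_cost (lam j))).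
  apply: le_trans (_ : \sum_(s < m.+1) D3 * K * th^-1 ^+ (J * m) * 7 <= _); last first.
    rewrite sumr_const card_ord -[leLHS]mulr_natl.
    have : 0 <= th^-1 ^+ (J * m) by rewrite exprn_ge0 // invr_ge0 ltW.
    move: J1; rewrite /M0 mulrDl mul1r; set X := th^-1 ^+ _.
    have : 0 <= m.+1%:R * (D3 * K) by rewrite !mulr_ge0 // ltW.
    set Z := m.+1%:R * (D3 * K) => Z0 J1 X0.
    have -> : m.+1%:R * (D3 * K * X * 7) = 7 * (Z * X) by rewrite /Z; lra.
    have := mulr_ge0 Z0 X0; move: J1; rewrite -mulrA; lra.
  apply: ler_sum => s _.
  apply: le_trans (_ : \sum_(j < jm.+1) D3 * K * th^-1 ^+ (J * m) *
    (3 / 4) ^+ `|j%:Z - J%:Z|%N <= _); last first.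
    rewrite -mulr_sumr ler_wpM2l ?sum_three_quarters // !mulr_ge0 ?exprn_ge0 ?invr_ge0 // ltW //.
  apply: ler_sum => j _.
  have [_ hcard _] := hdata s.
  apply: le_trans (ler_wpM2r (coloring_cost_ge0 (lam0 j)) (hcard j)) _.
  rewrite -!mulrA ler_wpM2l //.
  rewrite /lam; case: ifPn => [jJ|]; last rewrite -ltnNge => jJ.
    have [t Jt] : exists t, J = (j + t)%N by exists (J - j)%N; rewrite subnKC.
    have [_ ht] := hK t.
    rewrite Jt addKn absz_subDr.
    have Xj : th^-1 ^+ (j * m) = th^-1 ^+ ((j + t) * m) * th ^+ (t * m).
      rewrite mulnDl exprD -mulrA -exprMn mulVf ?gt_eqF //.
      by rewrite expr1n mulr1.
    rewrite Xj -mulrA [leRHS]mulrCA ler_wpM2l ?exprn_ge0 ?invr_ge0 ?(ltW th0) //.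
    by rewrite mulrC.
  have [t jt] : exists t, (j : nat) = (J + t)%N by exists (j - J)%N; rewrite subnKC // ltnW.
  have [ht _] := hK t.
  rewrite jt addKn absz_subDl mulnDl exprD -mulrA [leRHS]mulrCA.
  by rewrite ler_wpM2l ?exprn_ge0 ?invr_ge0 ?(ltW th0) // mulrC.
have vsg (q : Q) : \sum_i v (tag q) (tagged q) i ^+ 2 <= sg (lvl (tag q) (tagged q)) ^+ 2.
  have [h _ _] := hdata (tag q).
  rewrite sqr_sqrtr; last exact: ltW.
  exact: h.
have [y [y1 y2 y3]] := @partial_coloring R n Q (fun q => v (tag q) (tagged q))
  (fun q => sg (lvl (tag q) (tagged q))) (fun q => lam (lvl (tag q) (tagged q)))
  n0 (fun q => sg0 _) (fun q => lam0 _) vsg budget.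
exists y; split=> //.
have yb i : `|y i| <= 1.
  by have := y1 i; rewrite !inE => /or3P[] /eqP ->; rewrite ?normrN ?normr1 ?normr0.
apply: from_faces; [lra|by rewrite gt_eqF //; lra| |].
  by rewrite mulr_ge0 ?(ltW C0) ?powR_ge0.
move=> s x fx.
have [_ _ h] := hdata s.
apply: le_trans (h (fun j => lam j * sg j) y yb _ x fx) _.
  by move=> q; exact: (y3 (existT _ s q)).
have S0 : 0 <= n%:R * vt ^+ J by rewrite mulr_ge0 // exprn_ge0 // ltW.
have b1 : \sum_(j < jm.+1) lam j * sg j <= 7 * Num.sqrt C2 * Num.sqrt (n%:R * vt ^+ J).
  apply: le_trans (_ : \sum_(j < jm.+1)
  (3 / 4) ^+ `|j%:Z - J%:Z|%N * Num.sqrt (C2 * n%:R * vt ^+ J) <= _).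
    apply: ler_sum => j _; rewrite /sg mulrA.
    by apply: level_discrepancy => //; rewrite mulr_ge0 // ltW.
  rewrite -mulr_suml -[C2 * _ * _]mulrA sqrtrM ?(ltW C20) // -[leRHS]mulrA.
  by rewrite ler_wpM2r ?sum_three_quarters // mulr_ge0 // sqrtr_ge0.
have b2 : Num.sqrt (n%:R * (C5 * (n%:R * vt ^+ jm))) <= Num.sqrt C5 * Num.sqrt (n%:R * vt ^+ J).
  rewrite -sqrtrM //; apply: ler_wsqrtr; rewrite mulrCA ler_wpM2l //.
  have re (a b c : R) : a * (a * (b * c)) = a * b * (a * c) by lra.
  rewrite /jm exprD re -[leRHS]mulr1; apply: ler_wpM2l => //.
  apply: le_trans (_ : (2 ^+ n) * (2^-1) ^+ n <= _); last by rewrite -exprMn mulfV // expr1n.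
  apply: ler_pM => //; first by rewrite exprn_ge0 // ltW.
    by rewrite -natrX ler_nat ltnW // ltn_expl.
  by rewrite lerXn2r ?nnegrE ?(ltW vt0).
apply: le_trans (lerD (ler_wpM2l C40 b1) b2) _.
rewrite mulrA -mulrDl.
have h3 := level_error_bound p1 th0 M00 m0 n0 J2.
rewrite -/vt -/W in h3.
have c0 : 0 <= C4 * (7 * Num.sqrt C2) + Num.sqrt C5.
  by rewrite addr_ge0 ?sqrtr_ge0 // mulr_ge0 // mulr_ge0 // sqrtr_ge0.
apply: le_trans (ler_wpM2l c0 h3) _.
by rewrite mulrA ler_wpM2r ?powR_ge0 // lerDl.
Qed.

(** * Reducing the number of atoms *)

Section atoms.
Variables (R : realType) (p : R) (d : nat).
Hypothesis p1 : 1 <= p.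
Implicit Types (us : seq 'rV[R]_d) (x v : 'rV[R]_d).

Definition psum us x : R := \sum_(v <- us) `|dot v x| `^ p.
Definition weight v : R := \sum_s `|v 0 s| `^ p.
Definition mass us : R := \sum_(v <- us) weight v.

Let p0 : 0 < p. Proof. exact: lt_le_trans ltr01 p1. Qed.

Lemma weight_ge0 v : 0 <= weight v.
Proof. by apply: sumr_ge0 => s _; exact: powR_ge0. Qed.

(** A uniform error bound for [psum] on the cube therefore also limits the growth of the mass. *)
Lemma mass_psum us : mass us = \sum_s psum us (delta_mx 0 s).
Proof.
rewrite /psum exchange_big; apply: eq_bigr => v _; apply: eq_bigr => s _.
by rewrite dot_delta.
Qed.

Lemma psum_cat us vs x : psum (us ++ vs) x = psum us x + psum vs x.
Proof. by rewrite /psum big_cat. Qed.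

Lemma norm1_weight v : norm1 v `^ p <= d%:R `^ p * weight v.
Proof.
have [d0|d0] := posnP d.
  have -> : norm1 v = 0.
    by rewrite /norm1 big1 // => s _; have := ltn_ord s; rewrite [X in (_ < X)%N]d0.
  by rewrite powR0 ?gt_eqF // mulr_ge0 ?powR_ge0 ?weight_ge0.
have [s _ smax] := @arg_maxP _ _ _ (Ordinal d0) predT (fun t => `|v 0 t|) isT.
apply: le_trans (_ : (d%:R * `|v 0 s|) `^ p <= _).
  apply: ge0_ler_powR; rewrite ?nnegrE ?mulr_ge0 ?norm1_ge0 ?(ltW p0) //.
  rewrite mulr_natl -[X in _ *+ X]card_ord -sumr_const.
  by apply: ler_sum => t _; exact: smax.
rewrite powRM // ler_wpM2l ?powR_ge0 // /weight (bigD1 s) //= lerDl.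
by apply: sumr_ge0 => t _; exact: powR_ge0.
Qed.

End atoms.

Section halving.
Variables (R : realType) (p : R) (m : nat).
Hypotheses (p1 : 1 <= p) (m0 : (0 < m)%N).
Let d := m.+1.
Let e : R := (1 - (2 * p + 1) / m%:R) / 2.

Let p0 : 0 < p. Proof. exact: lt_le_trans ltr01 p1. Qed.

(** Markov's inequality: at most half of the atoms weigh more than twice the average bound. *)
Lemma light_atoms (us : seq 'rV[R]_d) (A : R) : 0 < A -> mass p us <= A -> (0 < size us)%N ->
  (size us <= 2 * count (fun v => weight p v <= 2 * A / (size us)%:R)%R us)%N.
Proof.
move=> A0 mA M0; have MR : 0 < (size us)%:R :> R by rewrite ltr0n.
set l := 2 * A / _; have l0 : 0 < l by rewrite divr_gt0 // mulr_gt0.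
have h : (count (predC (fun v => weight p v <= l)) us)%:R * l <= A.
  apply: le_trans mA; rewrite /mass [leRHS](bigID (fun v => weight p v <= l)) /=.
  apply: ler_wpDl; first by apply: sumr_ge0 => v _; exact: weight_ge0.
  rewrite -sum1_count natr_sum mulr_suml; apply: ler_sum => v hv.
  by rewrite mul1r ltW // ltNge.
rewrite -(count_predC (fun v => weight p v <= l) us).
set c1 := count _ us in h *; set c2 := count _ us in h *.
rewrite mul2n -addnn leq_add2l.
have cc : (c2 + c1)%N = size us by exact: count_predC.
suff : (2 * c1 <= size us)%N by lia.
rewrite -(ler_nat R) natrM -(ler_pM2r l0) -mulrA.
have -> : (size us)%:R * l = 2 * A by rewrite /l mulrCA mulfV ?mulr1 // gt_eqF.
by rewrite ler_pM2l.
Qed.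

(** The exponent [e] can have either sign, depending on m and p. *)
Lemma powR_comparable (M n : nat) : (0 < n)%N -> (n <= M)%N -> (M <= 2 * n)%N ->
  n%:R `^ e <= 2 `^ `|e| * M%:R `^ e.
Proof.
move=> n0 nM Mn; have nR : 0 < n%:R :> R by rewrite ltr0n.
have nMR : n%:R <= M%:R :> R by rewrite ler_nat.
have MnR : M%:R <= 2 * n%:R :> R by rewrite -natrM ler_nat.
have two1 : 1 <= 2 `^ `|e| :> R by rewrite -[leLHS](powRr0 2) ler_powR //; lra.
have [e0|e0] := leP 0 e.
  apply: le_trans (_ : M%:R `^ e <= _); last by rewrite ler_peMl // powR_ge0.
  by apply: ge0_ler_powR; rewrite ?nnegrE.
rewrite (ltr0_norm e0) powRN ler_pdivlMl ?powR_gt0 // -powRM //.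
have h : 0 < M%:R :> R by lra.
rewrite -[e]opprK !(powRN _ (- e)) lef_pV2 ?posrE ?powR_gt0 ?mulr_gt0 //.
by apply: ge0_ler_powR; rewrite ?nnegrE ?mulr_ge0 //; lra.
Qed.

(** Light atoms have weight O(A / size us), which lowers the exponent from e to e - 1; heavy atoms
    are kept unchanged. *)
Lemma halving_step : exists (C : R) (N1 : nat), [/\ 0 < C, (0 < N1)%N &
  forall (us : seq 'rV[R]_d) (A : R), 0 < A -> mass p us <= A -> (N1 <= size us)%N ->
  exists us' : seq 'rV[R]_d, (32 * size us' <= 31 * size us)%N /\
    forall x : 'rV[R]_d, (forall t, `|x 0 t| <= 1) ->
      `|psum p us' x - psum p us x| <= A * C * (size us)%:R `^ (e - 1)].
Proof.
have [C [N0 [C0 N00 color]]] := partial_coloring_powers p1 m0.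
exists (d%:R `^ p * 2 * C * 2 `^ `|e|), (2 * N0)%N; split.
- by rewrite !mulr_gt0 // ?powR_gt0 // ltr0n.
- by rewrite muln_gt0.
move=> us A A0 mA NM; set M := size us.
have M0 : (0 < M)%N by apply: leq_trans NM; rewrite muln_gt0.
have MR : 0 < M%:R :> R by rewrite ltr0n.
have hl := light_atoms A0 mA M0.
pose l : R := 2 * A / M%:R; have l0 : 0 < l by rewrite divr_gt0 // mulr_gt0.
pose li := [seq v <- us | weight p v <= l]; pose he := [seq v <- us | ~~ (weight p v <= l)].
pose n := size li.
have nc : n = count (fun v => weight p v <= l) us by rewrite /n size_filter.
have Mn : (M <= 2 * n)%N by rewrite nc; exact: hl.
have nM : (n <= M)%N by rewrite nc count_size.
have usE x : psum p us x = psum p li x + psum p he x.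
  by rewrite /psum /li /he !big_filter [LHS](bigID (fun v => weight p v <= l)).
have sE : M = (n + size he)%N.
  by rewrite /M /n !size_filter -(count_predC (fun v => weight p v <= l) us).
pose v (i : 'I_n) := tnth (in_tuple li) i.
have vl i : weight p (v i) <= l.
  by have := mem_tnth i (in_tuple li); rewrite mem_filter => /andP[].
pose D : R := d%:R `^ p * l.
have D0 : 0 < D by rewrite mulr_gt0 // powR_gt0 // ltr0n.
pose tau : R := D `^ p^-1.
have tau0 : 0 < tau by rewrite powR_gt0.
have taup : tau `^ p = D by rewrite /tau -powRrM mulVf ?gt_eqF // powRr1 // ltW.
have u1 i : norm1 (tau^-1 *: v i) <= 1.
  have -> : norm1 (tau^-1 *: v i) = tau^-1 * norm1 (v i).
    rewrite /norm1 mulr_sumr; apply: eq_bigr => t _.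
    by rewrite mxE normrM gtr0_norm // invr_gt0.
  rewrite ler_pdivrMl // mulr1.
  have h : norm1 (v i) `^ p <= D.
    by apply: le_trans (norm1_weight p1 _) _; rewrite ler_wpM2l ?powR_ge0.
  rewrite -[leLHS]powRr1 ?norm1_ge0 // -(mulfV (lt0r_neq0 p0)) powRrM.
  by apply: ge0_ler_powR; rewrite ?nnegrE ?powR_ge0 ?invr_ge0 ?(ltW p0) ?(ltW D0).
have [|y [y1 y2 y3]] := color n (fun i => tau^-1 *: v i) _ u1.
  by rewrite -(leq_pmul2l (isT : (0 < 2)%N)); apply: leq_trans Mn.
(* After a change of sign, at least n/16 entries are -1. Dropping these, with n at least half of the
   atoms, leaves at most 31/32 of them. *)
wlog ym : y y1 y2 y3 / (n <= 16 * #|[set i | y i == (-1)%R]|)%N => [hw|].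
  have [|h] := leqP n (16 * #|[set i | y i == (-1)%R]|)%N; first exact: hw.
  apply: (hw (fun i => - y i)).
  - move=> i; have := y1 i; rewrite !inE => /or3P[] /eqP ->; rewrite ?opprK ?oppr0 eqxx ?orbT //.
  - by under eq_finset do rewrite oppr_eq0.
  - move=> x K K0 xK; rewrite (_ : \sum_i _ = - \sum_i y i * `|dot (tau^-1 *: v i) x| `^ p).
      by rewrite normrN; exact: y3.
    by rewrite -sumrN; apply: eq_bigr => i _; rewrite mulNr.
  have : (#|[set i | y i != 0%R]| <= #|[set i | y i == (-1)%R]| + #|[set i | - y i == (-1)%R]|)%N.
    rewrite -cardsUI (leq_trans _ (leq_addr _ _)) //; apply/subset_leq_card/fintype.subsetP => i.
    have := y1 i; rewrite !inE eqr_opp => /or3P[] /eqP ->; rewrite ?eqxx ?orbT //.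
  have aux (a b c k : nat) : (k <= 8 * a -> 16 * b < k -> a <= b + c -> k <= 16 * c)%N by lia.
  exact: aux y2 h.
have ypos i : 0 <= 1 + y i.
  by have := y1 i; rewrite !inE => /or3P[] /eqP ->; lra.
exists ([seq (1 + y i) `^ p^-1 *: v i | i <- enum 'I_n & y i != -1] ++ he); split.
  rewrite size_cat size_map size_filter.
  have cn : (count (fun i => y i != (-1)%R) (enum 'I_n) + #|[set i | y i == (-1)%R]|)%N = n.
    have -> : #|[set i | y i == (-1)%R]| = count (predC (fun i => y i != (-1)%R)) (enum 'I_n).
      rewrite -sum1_card -sum1_count big_enum_cond /=.
      by apply: eq_bigl => i; rewrite !inE negbK.
    by rewrite count_predC size_enum_ord.
  move: ym cn Mn; rewrite -/M sE; lia.
move=> x x1.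
have pE : psum p [seq (1 + y i) `^ p^-1 *: v i | i <- enum 'I_n & y i != -1] x =
    \sum_i (1 + y i) * `|dot (v i) x| `^ p.
  rewrite /psum big_map big_filter big_enum_cond /=.
  rewrite [RHS](bigID (fun i => y i != -1)) /= [X in _ + X]big1 ?addr0; last first.
    by move=> i; rewrite negbK => /eqP ->; rewrite subrr mul0r.
  apply: eq_bigr => i _; rewrite dotZl normrM (ger0_norm (powR_ge0 _ _)).
  by rewrite powRM ?powR_ge0 // -powRrM mulVf ?lt0r_neq0 // powRr1.
have lE : psum p li x = \sum_i `|dot (v i) x| `^ p.
  by rewrite /psum -[li in LHS]/(val (in_tuple li)) big_tnth.
have -> : psum p ([seq (1 + y i) `^ p^-1 *: v i | i <- enum 'I_n & y i != -1] ++ he) x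
    - psum p us x = \sum_i y i * `|dot (v i) x| `^ p.
  rewrite psum_cat usE opprD addrACA subrr addr0 pE lE -sumrB.
  by apply: eq_bigr => i _; rewrite mulrDl mul1r addrC addKr.
have -> : \sum_i y i * `|dot (v i) x| `^ p = D * \sum_i y i * `|dot (tau^-1 *: v i) x| `^ p.
  rewrite mulr_sumr; apply: eq_bigr => i _; rewrite mulrCA; congr (_ * _).
  rewrite dotZl normrM powRM // -taup mulrA -powRM //; last exact: ltW.
  by rewrite (gtr0_norm (_ : 0 < tau^-1)) ?invr_gt0 // mulfV ?lt0r_neq0 // powR1 mul1r.
rewrite normrM (gtr0_norm D0).
have := y3 x 1 ler01 x1; rewrite powR1 mulr1 -/e => hy.
apply: le_trans (ler_wpM2l (ltW D0) hy) _.
have n0 : (0 < n)%N by move: Mn M0; lia.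
have hn := powR_comparable n0 nM Mn.
apply: le_trans (_ : D * (C * (2 `^ `|e| * M%:R `^ e)) <= _).
  by rewrite ler_wpM2l ?(ltW D0) // ler_wpM2l // ltW.
have -> : M%:R `^ (e - 1) = M%:R `^ e / M%:R.
  by rewrite powRB ?(gt_eqF MR) ?implybT // powRr1.
rewrite /D /l le_eqVlt; apply/orP; left; apply/eqP; lra.
Qed.

End halving.

Lemma powRN_nat_le (R : realType) (b : R) (M N : nat) : 0 <= b -> (0 < N)%N -> (N <= M)%N ->
  M%:R `^ (- b) <= N%:R `^ (- b).
Proof.
move=> b0 N0 NM; have NR : 0 < N%:R :> R by rewrite ltr0n.
have NMR : N%:R <= M%:R :> R by rewrite ler_nat.
have MR : 0 < M%:R :> R by exact: lt_le_trans NMR.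
rewrite !powRN lef_pV2 ?posrE ?powR_gt0 //.
by apply: ge0_ler_powR; rewrite ?nnegrE.
Qed.

Lemma ltn_32_31 a b : (0 < b -> 32 * a <= 31 * b -> a < b)%N.
Proof. lia. Qed.

Theorem sparsification (R : realType) (p : R) (m : nat) : 1 <= p -> (0 < m)%N ->
  let b := 1 / 2 + (2 * p + 1) / (2 * m%:R) in
  exists (C : R) (N1 : nat), [/\ 0 < C, (0 < N1)%N &
  forall (us : seq 'rV[R]_m.+1) (A : R) (N : nat), 0 < A -> mass p us <= A -> (N1 <= N)%N ->
  exists us' : seq 'rV[R]_m.+1, (size us' <= N)%N /\
    forall x : 'rV[R]_m.+1, (forall t, `|x 0 t| <= 1) ->
      `|psum p us' x - psum p us x| <= A * C * N%:R `^ (- b)].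
Proof.
move=> p1 m0 b.
have mR : 0 < m%:R :> R by rewrite ltr0n.
have b0 : 0 < b.
  by rewrite /b addr_gt0 // ?divr_gt0 // ?mulr_gt0 //; lra.
have [C' [N0 [C'0 N00 step]]] := halving_step p1 m0.
have eb : (1 - (2 * p + 1) / m%:R) / 2 - 1 = - b.
  by rewrite /b invfM; lra.
rewrite {}eb in step.
(* M^(-b) grows at least by this factor at each step. *)
pose g : R := (32 / 31) `^ b.
have g1 : 1 < g.
  have <- : 1 `^ b = 1 :> R by rewrite powR1.
  by apply: gt0_ltr_powR; rewrite ?nnegrE //; lra.
pose c0 : R := 2 * C' / (g - 1).
have c00 : 0 < c0 by rewrite divr_gt0 ?subr_gt0 // mulr_gt0.
pose L : R := m.+1%:R * c0 * g.
have g0 : 0 < g by lra.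
have L0 : 0 < L by rewrite /L (mulr_gt0 _ g0) // (mulr_gt0 _ c00) // ltr0n.
(* So large that the errors accumulated down to [N] atoms increase the mass by at most A. *)
pose N1 := (2 * N0 + (Num.truncn (L `^ b^-1)).+1)%N.
exists (c0 * g), N1; split; first by rewrite mulr_gt0 //; lra.
  by rewrite /N1 addnS.
move=> us A N A0 mA NN1.
have N0N : (0 < N)%N by apply: leq_trans NN1; rewrite /N1 addnS.
have NN0 : (N0 <= N)%N by apply: leq_trans NN1; rewrite /N1 mul2n -addnn -addnA leq_addr.
have NR : 0 < N%:R :> R by rewrite ltr0n.
have LN : L * N%:R `^ (- b) <= 1.
  rewrite powRN ler_pdivrMr ?powR_gt0 // mul1r.
  have h : L `^ b^-1 <= N%:R.
    apply: le_trans (_ : (Num.truncn (L `^ b^-1)).+1%:R <= _); first exact/ltW/truncnS_gt.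
    by rewrite ler_nat; apply: leq_trans NN1; rewrite /N1 leq_addl.
  have LE : L = (L `^ b^-1) `^ b by rewrite -powRrM mulVf ?lt0r_neq0 // powRr1 // ltW.
  rewrite [leLHS]LE.
  by apply: (ge0_ler_powR (ltW b0)) h; rewrite ?nnegrE ?powR_ge0.
(* The error still allowed from M atoms on. By the choice of [c0], one step costs A c0 (g - 1)
   M^(-b), which is at most E(M) - E(M') when M' <= (31/32) M. The same potential keeps the mass
   below 2A along the iteration. *)
pose E (M : nat) : R := A * c0 * (g * N%:R `^ (- b) - M%:R `^ (- b)).
have Ac0 : 0 < A * c0 by rewrite mulr_gt0.
have claim : forall k vs, (size vs <= k)%N -> (N < size vs)%N ->
    mass p vs <= 2 * A - m.+1%:R * E (size vs) ->
    exists us' : seq 'rV[R]_m.+1, (size us' <= N)%N /\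
      forall x : 'rV[R]_m.+1, (forall t, `|x 0 t| <= 1) ->
      `|psum p us' x - psum p vs x| <= E (size vs).
  elim=> [vs|k IHk vs sk Ns mvs]; first by rewrite leqn0 => /eqP ->.
  set M := size vs in sk Ns mvs *.
  have M0 : (0 < M)%N by exact: leq_ltn_trans Ns.
  have Mb : 0 < M%:R `^ (- b) by rewrite powR_gt0 // ltr0n.
  have MN : M%:R `^ (- b) <= N%:R `^ (- b).
    by apply: powRN_nat_le; [exact: ltW| |exact: ltnW].
  have E0 : 0 <= E M.
    rewrite /E mulr_ge0 ?(ltW Ac0) // subr_ge0; apply: le_trans MN _.
    by rewrite ler_peMl ?powR_ge0 // ltW.
  have mvs2 : mass p vs <= 2 * A.
    by apply: le_trans mvs _; rewrite gerBl mulr_ge0.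
  have [|vs1 [s1 e1]] := step vs (2 * A) _ mvs2 (leq_trans NN0 (ltnW Ns)).
    by rewrite mulr_gt0.
  pose eta : R := 2 * A * C' * M%:R `^ (- b).
  have etaE : eta = A * c0 * (g - 1) * M%:R `^ (- b).
    by rewrite /eta /c0 -[A * _ * (g - 1)]mulrA divfK ?gt_eqF ?subr_gt0 // !mulrA (mulrC A).
  have [sN|Ns1] := leqP (size vs1) N.
    exists vs1; split=> // x x1; apply: le_trans (e1 x x1) _.
    rewrite -/M -/eta etaE /E -mulrA ler_wpM2l ?(ltW Ac0) //.
    rewrite mulrBl mul1r lerD2r ler_wpM2l //; lra.
  have s1M : (size vs1 < M)%N by exact: ltn_32_31 M0 s1.
  have gM : g * M%:R `^ (- b) <= (size vs1)%:R `^ (- b).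
    have s1R : 0 < (size vs1)%:R :> R by rewrite ltr0n (leq_ltn_trans _ Ns1).
    have MR : 0 < M%:R :> R by rewrite ltr0n.
    rewrite !powRN ler_pdivrMr ?powR_gt0 // mulrC ler_pdivlMr ?powR_gt0 // /g.
    have c3231 : 0 <= 32 / 31 :> R by rewrite divr_ge0.
    rewrite -powRM //.
    apply: ge0_ler_powR; [exact: ltW|by rewrite nnegrE; apply: mulr_ge0|by rewrite nnegrE|].
    have : (32 * size vs1)%N%:R <= (31 * M)%N%:R :> R by rewrite ler_nat.
    rewrite !natrM; lra.
  have Est : E (size vs1) + eta <= E M.
    rewrite etaE /E -[A * c0 * (g - 1) * _]mulrA -mulrDr ler_wpM2l ?(ltW Ac0) //; lra.
  have [||us' [h1 h2]] := IHk vs1 _ Ns1.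
  - by rewrite -ltnS (leq_trans s1M).
  - apply: le_trans (_ : mass p vs + m.+1%:R * eta <= _).
      rewrite -lerBlDl !mass_psum -sumrB.
      apply: le_trans (_ : \sum_(s < m.+1) eta <= _); last first.
        by rewrite sumr_const card_ord mulr_natl.
      apply: ler_sum => s _; apply: le_trans (ler_norm _) _; apply: e1 => t.
      by rewrite mxE; case: (_ && _); rewrite ?normr1 ?normr0.
    have := ler_wpM2l (ler0n R m.+1) Est; rewrite mulrDr; lra.
  exists us'; split=> // x x1.
  have -> : psum p us' x - psum p vs x =
    (psum p us' x - psum p vs1 x) + (psum p vs1 x - psum p vs x) by lra.
  apply: le_trans (ler_normD _ _) _; apply: le_trans Est.
  by rewrite lerD ?h2 ?e1.
have [sN|Ns] := leqP (size us) N.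
  exists us; split=> // x _; rewrite subrr normr0.
  by apply: mulr_ge0; [exact: ltW (mulr_gt0 A0 (mulr_gt0 c00 g0))|exact: powR_ge0].
have Ele : E (size us) <= A * (c0 * g) * N%:R `^ (- b).
  rewrite /E mulrBr [A * (c0 * g)]mulrA -[leRHS]mulrA gerBl.
  by apply: mulr_ge0; [exact: ltW|exact: powR_ge0].
have dE : m.+1%:R * E (size us) <= A.
  apply: le_trans (ler_wpM2l (ler0n R m.+1) Ele) _.
  have -> : m.+1%:R * (A * (c0 * g) * N%:R `^ (- b)) = A * (L * N%:R `^ (- b)).
    by rewrite /L; lra.
  by rewrite ler_piMr // ltW.
have [|us' [h1 h2]] := claim (size us) us (leqnn _) Ns; first lra.
by exists us'; split=> // x x1; apply: le_trans (h2 x x1) Ele.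
Qed.

Local Open Scope classical_set_scope.
Local Open Scope ring_scope.

(** * From subspaces of L^p to atoms *)

Section AbstractNorm.
Variables (R : realType) (V : lmodType R) (nu : V -> R).
Hypothesis nuD : forall x y, nu (x + y) <= nu x + nu y.
Hypothesis nuZ : forall a x, nu (a *: x) = `|a| * nu x.

Lemma norm_zero : nu 0 = 0.
Proof. by rewrite -(scale0r (0 : V)) nuZ normr0 mul0r. Qed.

Lemma norm_opp x : nu (- x) = nu x.
Proof. by rewrite -scaleN1r nuZ normrN1 mul1r. Qed.

Lemma norm_nonneg x : 0 <= nu x.
Proof.
have := nuD x (- x); rewrite subrr norm_zero norm_opp -mulr2n.
by rewrite pmulrn_lge0.
Qed.

Lemma norm_sum_le (I : Type) (r : seq I) (F : I -> V) :
  nu (\sum_(i <- r) F i) <= \sum_(i <- r) nu (F i).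
Proof.
elim/big_ind2: _ => [|x a y b xa yb|//]; first by rewrite norm_zero.
by apply: le_trans (nuD _ _) _; exact: lerD.
Qed.

Lemma norm_combination_le n (c : 'rV[R]_n) (b : 'I_n -> V) (B : R) :
  (forall i, nu (b i) <= B) ->
  nu (\sum_i c 0 i *: b i) <= (\sum_i `|c 0 i|) * B.
Proof.
move=> hB; apply: le_trans (norm_sum_le _ _) _.
by rewrite mulr_suml; apply: ler_sum => i _; rewrite nuZ ler_wpM2l.
Qed.

Lemma norm_dist x y : `|nu x - nu y| <= nu (x - y).
Proof.
rewrite ler_norml; apply/andP; split.
  rewrite lerNl opprB lerBlDr -(norm_opp (x - y)) opprB.
  by have := nuD (y - x) x; rewrite subrK.
by rewrite lerBlDr; have := nuD (x - y) y; rewrite subrK.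
Qed.
End AbstractNorm.

Lemma rV_entry_le_norm (R : realType) n (c : 'rV[R]_n) i : `|c 0 i| <= `|c|.
Proof.
have -> : `|c| = \big[Num.max/0]_ij `|c ij.1 ij.2| := mx_normrE c.
exact: (le_bigmax _ (fun ij => `|c ij.1 ij.2|) (0, i)).
Qed.

(** Compactness of the unit sphere of the sup norm, where [nu] is continuous and positive. *)
Lemma norm_equivalence (R : realType) n (nu : 'rV[R]_n.+1 -> R) :
  (forall x y, nu (x + y) <= nu x + nu y) ->
  (forall a x, nu (a *: x) = `|a| * nu x) ->
  (forall x, nu x = 0 -> x = 0) ->
  exists2 K : R, 0 < K & forall c, `|c| <= K * nu c.
Proof.
move=> nuD nuZ nu_def.
pose B := \sum_i nu (delta_mx 0 i).
have B0 : 0 <= B by apply: sumr_ge0 => i _; exact: norm_nonneg.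
have nuB c : nu c <= `|c| * B.
  rewrite {1}[c]row_sum_delta; apply: le_trans (norm_sum_le nuD nuZ _ _) _.
  rewrite mulr_sumr; apply: ler_sum => i _.
  by rewrite nuZ ler_wpM2r ?norm_nonneg// rV_entry_le_norm.
pose A := [set c : 'rV[R]_n.+1 | `|c| = 1].
have A0 : A !=set0.
  pose u : 'rV[R]_n.+1 := const_mx 1.
  exists (`|u|^-1 *: u); rewrite /A /= normrZ ger0_norm//.
  by rewrite mulVf// normr_eq0; apply/eqP => /rowP /(_ 0); rewrite !mxE => /eqP; rewrite oner_eq0.
have cA : compact A.
  apply: bounded_closed_compact.
    by exists 1; split => // M M1 c /= ->; exact: ltW.
  apply: (@closed_comp _ _ (fun c : 'rV[R]_n.+1 => `|c|) [set 1]) => [c _|].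
    exact: norm_continuous.
  exact: closed_eq.
have cnu : continuous nu.
  move=> c; apply/(@cvgrPdist_lt _ R _ (nbhs c) (nbhs_filter c)) => e e0.
  have r0 : 0 < e / (B + 1) by rewrite divr_gt0 // ltr_pwDr.
  have /(@cvgrPdist_lt _ _ _ (nbhs c) (nbhs_filter c) (fun x => x))/(_ _ r0) :
    x @[x --> c] --> c by exact: cvg_id.
  apply: filterS => x xc; apply: (le_lt_trans (norm_dist nuD nuZ _ _)).
  apply: (le_lt_trans (nuB _)).
  apply: (@le_lt_trans _ _ (`|c - x| * (B + 1))).
    by rewrite ler_wpM2l// lerDl.
  by rewrite -ltr_pdivlMr ?ltr_pwDr.
have [c cinA cmin] := EVT_min_rV A0 cA (continuous_subspaceT cnu).
have c1 : `|c| = 1 by move/set_mem: cinA.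
have nuc : 0 < nu c.
  rewrite lt_neqAle eq_sym norm_nonneg// andbT; apply/eqP => /nu_def c0.
  by move/eqP: c1; rewrite c0 normr0 eq_sym oner_eq0.
exists (nu c)^-1; first by rewrite invr_gt0.
move=> x; have [->|x0] := eqVneq x 0; first by rewrite normr0 mulr_ge0 ?invr_ge0 ?norm_nonneg// ltW.
have nx : 0 < `|x| by rewrite normr_gt0.
rewrite ler_pdivlMl //.
have := cmin (`|x|^-1 *: x); rewrite nuZ ger0_norm ?invr_ge0// ler_pdivlMl// mulrC; apply.
by rewrite inE /A /= normrZ ger0_norm ?invr_ge0// mulVf// gt_eqF.
Qed.

(** Fekete points of the unit ball, in the coordinates of any basis, form an approximate Auerbach
    basis. The equivalence of norms supplies the boundedness required by [fekete]. *)
Lemma auerbach_basis (R : realType) (V : lmodType R) (nu : V -> R)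
    (E : submodClosed V) n :
  (forall x y, nu (x + y) <= nu x + nu y) ->
  (forall a x, nu (a *: x) = `|a| * nu x) ->
  (forall x, nu x = 0 -> x = 0) -> has_dim E n.+1 ->
  exists (b : 'I_n.+1 -> V) (coord : V -> 'rV[R]_n.+1),
    [/\ forall s, nu (b s) <= 1,
        linear_on E coord &
        {in E, forall x, x = \sum_s coord x 0 s *: b s /\
                         forall s, `|coord x 0 s| <= 2 * nu x}].
Proof.
move=> nuD nuZ nu_def [b0 [free0 span0]].
pose comb (c : 'rV[R]_n.+1) := \sum_i c 0 i *: b0 i.
have combD c1 c2 : comb (c1 + c2) = comb c1 + comb c2.
  by rewrite /comb -big_split /=; apply: eq_bigr => i _; rewrite mxE scalerDl.
have combZ a c : comb (a *: c) = a *: comb c.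
  by rewrite /comb scaler_sumr; apply: eq_bigr => i _; rewrite mxE scalerA.
have comb0 c : comb c = 0 -> c = 0.
  by move=> /free0 h; apply/rowP => i; rewrite h mxE.
have combI : injective comb.
  move=> c1 c2 e; apply/eqP; rewrite -subr_eq0; apply/eqP; apply: comb0.
  by rewrite combD -scaleN1r combZ scaleN1r e subrr.
have [K K0 hK] : exists2 K : R, 0 < K & forall c, `|c| <= K * nu (comb c).
  apply: norm_equivalence => [x y|a x|x /nu_def/comb0 //].
    by rewrite combD nuD.
  by rewrite combZ nuZ.
have /functional_choice[c0 hc0] : forall x, exists c, x \in E -> x = comb c.
  move=> x; have [xE|xE] := boolP (x \in E); last by exists 0.
  have [c ->] := (span0 x).1 xE; exists (\row_i c i) => _.
  by apply: eq_bigr => i _; rewrite mxE.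
have nu0 : nu 0 = 0 by rewrite -(scale0r (0 : V)) nuZ normr0 mul0r.
have [] := @fekete R 'rV[R]_n.+1 n.+1 [set c | nu (comb c) <= 1] 0 id K.
- by rewrite /= -(scale0r 0) combZ scale0r nu0.
- move=> c /= c1 i; apply: le_trans (rV_entry_le_norm _ _) _.
  by apply: le_trans (hK c) _; rewrite ler_piMr// ltW.
move=> z [zY hz].
pose Z : 'M[R]_n.+1 := \matrix_s z s.
have mulZ (c : 'rV[R]_n.+1) : c *m Z = \sum_s c 0 s *: z s.
  by rewrite mulmx_sum_row; apply: eq_bigr => s _; rewrite rowK.
have decomp c : exists2 g : 'rV[R]_n.+1, c = g *m Z & forall s, `|g 0 s| <= 2 * nu (comb c).
  have [c00|cn0] := eqVneq c 0.
    exists 0 => [|s]; first by rewrite c00 mul0mx.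
    by rewrite mxE normr0 mulr_ge0// norm_nonneg.
  have nc : 0 < nu (comb c).
    rewrite lt_neqAle eq_sym norm_nonneg// andbT.
    by apply: contra_neq cn0 => /nu_def/comb0.
  have [|g [g2 eg]] := hz ((nu (comb c))^-1 *: c).
    by rewrite /= combZ nuZ ger0_norm ?invr_ge0 ?(ltW nc)// mulVf// gt_eqF.
  exists (nu (comb c) *: \row_s g s) => [|s].
    rewrite -scalemxAl mulZ; under eq_bigr do rewrite mxE.
    by rewrite -eg scalerA mulfV ?scale1r// gt_eqF.
  by rewrite !mxE normrM gtr0_norm// mulrC ler_wpM2r// ltW.
have Zunit : Z \in unitmx.
  rewrite -row_full_unit -sub1mx; apply/row_subP => i.
  by have [g -> _] := decomp (row i 1%:M); exact: submxMl.
pose b s := comb (z s).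
exists b, (fun x => c0 x *m invmx Z); split=> [s|a x y xE yE|x xE].
- exact: zY.
- rewrite scalemxAl -mulmxDl; congr (_ *m _); apply: combI.
  rewrite combD combZ -!hc0//.
  by rewrite rpredD// rpredZ.
split=> [|s].
  rewrite {1}(hc0 x xE) -[c0 x in LHS](mulmxKV Zunit) mulZ /b.
  elim/big_rec2: _ => [|s u v _ <-].
    by rewrite -(scale0r 0) combZ scale0r.
  by rewrite combD combZ.
have [g e g2] := decomp (c0 x); rewrite [X in nu X]hc0//.
by rewrite {1}e mulmxK.
Qed.

Section Lp01.
Variables (R : realType) (p : R) (p1 : 1 <= p).
Local Notation mu := (lebesgue01 R).
Local Notation Lp := (Lp01 p1).
Local Notation nrm := (@Lp01_norm R p p1).
Let pE1 := lee1_EFin p1.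
Let p0 : 0 < p := lt_le_trans ltr01 p1.

Definition Lfun_of (x : Lp) : LfunType mu pE1 := Lfun_Sub pE1 (Lspace_fun_Lfun x).

Lemma Lp01_norm_ae (x : Lp) (f : measurableTypeR R -> R) :
  f \in Lfun mu p%:E -> Lspace_fun x = f %[ae mu] ->
  nrm x = fine ('N[mu]_(p%:E)[EFin \o f])%E.
Proof.
move=> mf xf; congr fine; apply: Lnorm_ae_eq => //.
  exact: measurable_Lspace_fun.
by apply: Lfun_measurable mf.
Qed.

Lemma Lp01_normD (x y : Lp) : nrm (x + y) <= nrm x + nrm y.
Proof.
rewrite (Lp01_norm_ae (f := Lfun_of x + Lfun_of y)); last exact: Lspace_funD.
  exact: ler_LnormD.
exact: (@LfunP _ _ _ mu p%:E pE1 (Lfun_of x + Lfun_of y)).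
Qed.

Lemma Lp01_normZ a (x : Lp) : nrm (a *: x) = `|a| * nrm x.
Proof.
rewrite (Lp01_norm_ae (f := a *: Lfun_of x)); last exact: Lspace_funZ.
  apply: EFin_inj; rewrite EFinM.
  rewrite (finite_norm_fine (a *: Lfun_of x)) (finite_norm_fine (Lfun_of x)).
  exact: LnormZ.
exact: (@LfunP _ _ _ mu p%:E pE1 (a *: Lfun_of x)).
Qed.

Lemma Lp01_norm_eq0 (x : Lp) : nrm x = 0 -> x = 0.
Proof.
move=> x0; apply/Lspace_eqP.
have := fine_Lnormr_eq0 (f := Lfun_of x) x0.
by apply: filterS2 (Lspace_fun0 mu pE1) => t h1 h2 _; rewrite h1//; exact: h2.
Qed.

End Lp01.

(** * Reduction to functions with finitely many values *)

Section SimpleApproximation.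
Import HBNNSimple.
Context d (T : measurableType d) (R : realType).
Variables (mu : {measure set T -> \bar R}) (p : R).
Hypothesis p1 : 1 <= p.
Let p0 : 0 < p := lt_le_trans ltr01 p1.

Lemma Lfun_le (f g : T -> R) : measurable_fun setT f -> g \in Lfun mu p%:E ->
  (forall x, `|f x| <= `|g x|) -> f \in Lfun mu p%:E.
Proof.
move=> mf gL fg; rewrite inE; apply/andP; split; first by rewrite inE.
rewrite inE /= /finite_norm; apply: (@le_lt_trans _ _ ('N[mu]_(p%:E)[EFin \o g])%E); last first.
  by move: gL; rewrite inE => /andP[_]; rewrite inE.
have mg : measurable_fun setT g by exact: Lfun_measurable gL.
have mp (h : T -> R) : measurable_fun setT h ->
    measurable_fun setT (fun x => (`|h x| `^ p)%:E).
  move=> mh; apply/measurable_EFinP.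
  by apply: (measurableT_comp (measurable_powR _)) => //; exact: measurableT_comp.
rewrite unlock /Lnorm; apply: gt0_ler_poweR.
- by rewrite invr_ge0 ltW.
- by rewrite in_itv /= leey andbT integral_ge0 // => x _; rewrite lee_fin powR_ge0.
- by rewrite in_itv /= leey andbT integral_ge0 // => x _; rewrite lee_fin powR_ge0.
apply: ge0_le_integral => //.
- by move=> x _; rewrite lee_fin powR_ge0.
- exact: mp.
- exact: mp.
- by move=> x _ /=; rewrite lee_fin ge0_ler_powR ?nnegrE ?(ltW p0).
Qed.

(** Approximating |f| from below and restoring the sign of f keeps the error at |f| - a_n <= |f|, so
    that dominated convergence applies. *)
Lemma simple_approximation (f : T -> R) (eta : R) :
  f \in Lfun mu p%:E -> 0 < eta ->
  exists h : T -> R, [/\ measurable_fun setT h,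
    (exists vals : seq R, forall x, h x \in vals), h \in Lfun mu p%:E &
    fine ('N[mu]_(p%:E)[EFin \o (f \- h)%R])%E <= eta].
Proof.
move=> fL eta0.
have mf : measurable_fun setT f by exact: Lfun_measurable fL.
pose af x := `|f x|%:E.
have maf : measurable_fun setT af by apply/measurable_EFinP; exact: measurableT_comp.
have af0 x : setT x -> (0 <= af x)%E by rewrite /af lee_fin.
pose a n : T -> R := nnsfun_approx measurableT maf n.
have a0 n x : 0 <= a n x by exact: fun_ge0.
have af_ n x : a n x <= `|f x|.
  by rewrite -lee_fin /a nnsfun_approxE; exact: le_approx.
pose h n x := if 0 <= f x then a n x else - a n x.
have ma n : measurable_fun setT (a n) by [].
have mh n : measurable_fun setT (h n).
  apply: measurable_fun_ifT => //.
    by apply: measurable_fun_ler.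
  exact: measurableT_comp.
have fh n x : `|f x - h n x| = `|f x| - a n x.
  rewrite /h; case: ifPn => [f0|]; rewrite ?(ger0_norm f0).
    by rewrite ger0_norm // subr_ge0 -[leRHS](ger0_norm f0).
  rewrite -ltNge => f0; rewrite opprK (ltr0_norm f0) ler0_norm ?opprD//.
  by rewrite -lerBrDr sub0r lerNr -(ltr0_norm f0).
have hL n : h n \in Lfun mu p%:E.
  apply: (@Lfun_le _ f) => // x; rewrite /h.
  by case: ifP => _; rewrite ?normrN ger0_norm.
have if_ := Lfun_integrable p1 fL.
have cvg0 : (\int[mu]_x (`|f x - h n x| `^ p)%:E)%E @[n --> \oo] --> 0%E.
  rewrite -(integral0 mu setT).
  apply: (@dominated_cvg _ _ _ mu setT measurableT _ _ (fun x => (`|f x| `^ p)%:E)) => //.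
  - move=> n; apply/measurable_EFinP.
    apply: (measurableT_comp (measurable_powR _)) => //.
    by apply: measurableT_comp => //; exact: measurable_funB.
  - move=> x _; apply/fine_cvgP; split; first exact: nearW.
    apply/cvgrPdist_lt => e e0.
    have /fine_cvgP[_ /cvgrPdist_lt] := @cvg_nnsfun_approx _ _ _ _ measurableT _ maf af0 x I.
    have e1 : 0 < Num.min 1 e by rewrite lt_min ltr01.
    move=> /(_ _ e1); apply: filterS => n /=; rewrite -/(a n x) lt_min => /andP[l1 le].
    rewrite sub0r normrN fh ger0_norm ?powR_ge0//.
    have d0 : 0 <= `|f x| - a n x by rewrite subr_ge0.
    move: l1 le; rewrite (ger0_norm d0) => l1 le.
    have [->|dn0] := eqVneq (`|f x| - a n x) 0; first by rewrite powR0 ?gt_eqF.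
    by apply: le_lt_trans le; apply: ge1r_powR => //; rewrite lt_neqAle eq_sym dn0 d0 ltW.
  - move=> n x _; rewrite lee_fin ger0_norm ?powR_ge0// fh.
    by rewrite ge0_ler_powR ?nnegrE ?subr_ge0 ?(ltW p0)// gerBl.
have ep : 0 < eta `^ p by rewrite powR_gt0.
have /fine_cvgP[fin /cvgrPdist_lt/(_ _ ep) small] := cvg0.
have [n [nfin nsmall]] := filter_ex (filterI fin small).
exists (h n); split => //.
  have /finite_seqP[s es] : finite_set (range (a n)) by [].
  exists (s ++ map -%R s) => x; rewrite mem_cat /h.
  have xs : a n x \in s.
    have : range (a n) (a n x) by exists x.
    by rewrite es.
  by case: ifP => _; rewrite ?xs// map_f ?orbT.
have -> : eta = (eta `^ p) `^ p^-1 by rewrite -powRrM mulfV ?gt_eqF// powRr1// ltW.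
rewrite unlock /Lnorm fine_poweR ge0_ler_powR ?invr_ge0 ?(ltW p0) ?nnegrE ?powR_ge0//.
  by rewrite fine_ge0// integral_ge0// => x _; rewrite lee_fin powR_ge0.
apply: le_trans (ltW nsmall); rewrite sub0r normrN; exact: ler_norm.
Qed.
End SimpleApproximation.

Lemma integral_finite_valued d (T : measurableType d) (R : realType)
    (mu : {measure set T -> \bar R}) (I : finType) (q : T -> I) (F : I -> R) :
  (forall i, measurable (q @^-1` [set i])) -> (forall i, 0 <= F i) ->
  (\int[mu]_x (F (q x))%:E = \sum_i (F i)%:E * mu (q @^-1` [set i]))%E.
Proof.
move=> mq F0.
have mi i : measurable_fun setT (fun x => (\1_(q @^-1` [set i]) x)%:E : \bar R).
  by apply/measurable_EFinP; exact: measurable_indic.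
transitivity (\int[mu]_x \sum_i ((F i)%:E * (\1_(q @^-1` [set i]) x)%:E))%E.
  apply: eq_integral => x _; rewrite (bigD1 (q x)) //= big1 ?adde0.
    by rewrite indicE mem_set// mule1.
  by move=> i iq; rewrite indicE memNset ?mule0//= => e; rewrite e eqxx in iq.
rewrite ge0_integral_sum //.
- apply: eq_bigr => i _; rewrite ge0_integralZl_EFin //.
  by rewrite integral_indic // setIT.
- by move=> i; apply: measurable_funeM.
- by move=> i x _; rewrite -EFinM lee_fin mulr_ge0.
Qed.

(** One atom for each joint value of the functions: the vector of values times the 1/p-th power of
    the measure of its fibre, which is finite as [mu] is. *)
Lemma finite_valued_atoms d (T : measurableType d) (R : realType)
    (mu : {measure set T -> \bar R}) (p : R) n (h : 'I_n -> T -> R) :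
  1 <= p -> (mu setT < +oo)%E ->
  (forall s, measurable_fun setT (h s)) ->
  (forall s, exists vals : seq R, forall x, h s x \in vals) ->
  exists us : seq 'rV[R]_n, forall c : 'rV[R]_n,
    (\int[mu]_x (`|\sum_s c 0 s * h s x| `^ p)%:E = (psum p us c)%:E)%E.
Proof.
move=> p1 mufin mh /functional_choice[vals hvals].
pose vs := flatten [seq vals s | s : 'I_n].
have hvs s x : h s x \in vs by apply/flatten_mapP; exists s; rewrite ?mem_enum.
pose q x : {ffun 'I_n -> seq_sub vs} := [ffun s => SeqSub (hvs s x)].
pose pt (i : {ffun 'I_n -> seq_sub vs}) : 'rV[R]_n := \row_s ssval (i s).
have qE i : q @^-1` [set i] = \big[setI/setT]_s (h s @^-1` [set ssval (i s)]).
  rewrite -bigcap_seq; apply/seteqP; split => [x /= <- s _|x hx].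
    by rewrite /= ffunE.
  apply/ffunP => s; apply/val_inj; rewrite ffunE /=.
  by apply: hx; rewrite /= mem_index_enum.

have mq i : measurable (q @^-1` [set i]).
  rewrite qE; apply: bigsetI_measurable => s _.
  by rewrite -[X in measurable X]setTI; exact: mh.
have muq i : (mu (q @^-1` [set i]) \is a fin_num)%E.
  rewrite ge0_fin_numE//; apply: le_lt_trans mufin.
  by apply: le_measure; rewrite ?inE.
pose w i := fine (mu (q @^-1` [set i])).
have w0 i : 0 <= w i by rewrite fine_ge0.
exists [seq w i `^ p^-1 *: pt i | i : {ffun 'I_n -> seq_sub vs}] => c.
transitivity (\int[mu]_x (`|dot (pt (q x)) c| `^ p)%:E)%E.
  apply: eq_integral => x _; congr (`|_| `^ p)%:E; apply: eq_bigr => s _.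
  by rewrite mxE ffunE mulrC.
rewrite (integral_finite_valued mu (F := fun i => `|dot (pt i) c| `^ p)) //.
rewrite /psum big_map -sumEFin big_enum /=; apply: eq_bigr => i _.
rewrite -[X in (_ * X)%E]fineK // -EFinM; congr (_%:E).
rewrite dotZl normrM (ger0_norm (powR_ge0 _ _)) powRM ?powR_ge0// -powRrM.
by rewrite mulVf ?powRr1 // 1?mulrC// gt_eqF// (lt_le_trans ltr01).
Qed.

Lemma Lspace_fun_sum d (T : measurableType d) (R : realType)
    (mu : {measure set T -> \bar R}) (p : \bar R) (p1 : (1 <= p)%E)
    (I : Type) (r : seq I) (c : I -> R) (x : I -> LspaceType mu p1)
    (h : I -> T -> R) :
  (forall i, Lspace_fun (x i) = h i %[ae mu]) ->
  Lspace_fun (\sum_(i <- r) c i *: x i) =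
    (fun t => \sum_(i <- r) c i * h i t) %[ae mu].
Proof.
move=> xh; elim: r => [|i r ih].
  rewrite big_nil; apply: filterS (Lspace_fun0 mu p1) => t e /e ->.
  by rewrite big_nil.
rewrite big_cons.
apply: (filterS2 _ _ (filterI (Lspace_funD (c i *: x i) (\sum_(j <- r) c j *: x j))
  (Lspace_funZ (c i) (x i))) (filterI ih (xh i))) => t [h1 h2] [h3 h4] It.
by rewrite big_cons h1// fctE h2// h3// fctE h4.
Qed.

Lemma lebesgue01_finite (R : realType) : (lebesgue01 R setT < +oo)%E.
Proof.
have -> : lebesgue01 R setT = lebesgue_measure (`[0%R, 1%R]%classic : set R).
  by rewrite -[X in _ = _ X](setTI `[0%R, 1%R]%classic).
by rewrite lebesgue_measure_itv /= lte_fin ltr01 oppr0 adde0 ltry.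
Qed.

(** Only the n given functions are approximated, so the error of a combination grows with its
    coefficients; hence the need for a basis with bounded coordinates. *)
Lemma Lp01_discretization (R : realType) (p : R) (p1 : 1 <= p) n
    (g : 'I_n -> Lp01 p1) (eta : R) : 0 < eta ->
  exists us : seq 'rV[R]_n, forall c : 'rV[R]_n,
    `|psum p us c `^ p^-1 - Lp01_norm (\sum_s c 0 s *: g s)|
      <= (\sum_s `|c 0 s|) * eta.
Proof.
move=> eta0.
have p0 : 0 < p := lt_le_trans ltr01 p1.
have /functional_choice[h hh] : forall s, exists h,
    [/\ measurable_fun setT h,
    (exists vals : seq R, forall x, h x \in vals), h \in Lfun (lebesgue01 R) p%:E &
    fine ('N[lebesgue01 R]_(p%:E)[EFin \o (Lspace_fun (g s) \- h)%R])%E <= eta].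
  by move=> s; apply: simple_approximation => //; exact: Lspace_fun_Lfun.
have hL s : h s \in Lfun (lebesgue01 R) p%:E by have [] := hh s.
have mh s : measurable_fun setT (h s) by have [] := hh s.
pose H s : Lp01 p1 := to_Lspace (lee1_EFin p1) (hL s).
have HE s : Lspace_fun (H s) = h s %[ae lebesgue01 R] by exact: to_LspaceE.
have [us hus] := finite_valued_atoms p1 (lebesgue01_finite R) mh
  (fun s => let: And4 _ v _ _ := hh s in v).
exists us => c.
have -> : psum p us c `^ p^-1 = Lp01_norm (\sum_s c 0 s *: H s).
  have e : Lspace_fun (\sum_s c 0 s *: H s) = (fun t => \sum_s c 0 s * h s t) %[ae lebesgue01 R].
    exact: Lspace_fun_sum.
  have mf : measurable_fun setT (fun t => \sum_s c 0 s * h s t).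
    by apply: measurable_sum => s; apply: measurable_funM.
  rewrite /Lp01_norm (Lnorm_ae_eq (lee1_EFin p1) _ mf e); last exact: measurable_Lspace_fun.
  rewrite unlock /Lnorm fine_poweR; congr (_ `^ _).
  by rewrite -[LHS]/(fine (psum p us c)%:E) -hus.
apply: le_trans (norm_dist (@Lp01_normD _ _ p1) (@Lp01_normZ _ _ p1) _ _) _.
rewrite -sumrB; under eq_bigr do rewrite -scalerBr.
apply: norm_combination_le => [| |s].
- exact: Lp01_normD.
- exact: Lp01_normZ.
have [_ _ _] := hh s; apply: le_trans.
rewrite -(norm_opp (@Lp01_normZ _ _ p1)) opprB -[H s]scale1r -scaleNr.
rewrite (Lp01_norm_ae (f := Lspace_fun (g s) \- h s))//.
  exact: (LfunP (Lfun_of (g s) - Lfun_Sub (lee1_EFin p1) (hL s))).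
apply: (filterS2 _ _ (Lspace_funD (g s) (-1 *: H s))
  (filterI (Lspace_funZ (-1) (H s)) (HE s))) => t h1 [h2 h3] It.
by rewrite h1// fctE h2// fctE scaleN1r h3.
Qed.

Lemma psum_ge0 (R : realType) (p : R) n (us : seq 'rV[R]_n) x : 0 <= psum p us x.
Proof. by apply: sumr_ge0 => v _; exact: powR_ge0. Qed.

Lemma psumZ (R : realType) (p : R) n (us : seq 'rV[R]_n) a x :
  psum p us (a *: x) = `|a| `^ p * psum p us x.
Proof.
by rewrite mulr_sumr; apply: eq_bigr => v _; rewrite dotZr normrM powRM.
Qed.

Lemma psum_homogeneous_error (R : realType) (p e : R) n (us vs : seq 'rV[R]_n) :
  (forall x : 'rV[R]_n, (forall t, `|x 0 t| <= 1) -> `|psum p us x - psum p vs x| <= e) ->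
  forall (x : 'rV[R]_n) r, 0 < r -> (forall t, `|x 0 t| <= r) ->
    `|psum p us x - psum p vs x| <= r `^ p * e.
Proof.
move=> h x r r0 xr; have rp : 0 < r `^ p by rewrite powR_gt0.
have -> : x = r *: (r^-1 *: x) by rewrite scalerA mulfV ?scale1r// gt_eqF.
rewrite (psumZ p us r) (psumZ p vs r) (gtr0_norm r0) -mulrBr normrM (gtr0_norm rp) ler_pM2l//.
apply: h => t; rewrite mxE normrM ger0_norm ?invr_ge0 ?(ltW r0)//.
by rewrite ler_pdivrMl// mulr1.
Qed.

(** For p >= 1, taking a p-th root does not enlarge a relative error. *)
Lemma powR_root_between (R : realType) (p d Y Z : R) :
  1 <= p -> 0 <= d < 1 -> 0 <= Y -> `|Z - Y| <= d * Y ->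
  (1 - d) * Y `^ p^-1 <= Z `^ p^-1 <= (1 + d) * Y `^ p^-1.
Proof.
move=> p1 /andP[d0 d1] Y0; rewrite ler_distl => /andP[lo hi].
have p0 : 0 < p := lt_le_trans ltr01 p1.
have ip1 : p^-1 <= 1 by rewrite invf_le1.
have ip0 : 0 <= p^-1 by rewrite invr_ge0 ltW.
have l0 : 0 <= (1 - d) * Y by rewrite mulr_ge0 // subr_ge0 ltW.
have Z0 : 0 <= Z by apply: le_trans lo; lra.
apply/andP; split.
  apply: (@le_trans _ _ (((1 - d) * Y) `^ p^-1)); last first.
    by rewrite ge0_ler_powR ?nnegrE//; lra.
  rewrite powRM ?subr_ge0 ?(ltW d1)// ler_wpM2r ?powR_ge0// ger1_powR//.
  by rewrite subr_gt0 d1 gerBl.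
apply: (@le_trans _ _ (((1 + d) * Y) `^ p^-1)).
  by rewrite ge0_ler_powR ?nnegrE// ?mulr_ge0//; lra.
by rewrite powRM ?addr_ge0// ler_wpM2r ?powR_ge0// ler1_powR// lerDl.
Qed.

Lemma lp_norm_scaled_dots (R : realType) (p l : R) n (us : seq 'rV[R]_n) x :
  1 <= p -> 0 <= l ->
  lp_norm p (\row_(j < size us) (l * dot us`_j x)) = l * psum p us x `^ p^-1.
Proof.
move=> p1 l0; have p0 : 0 < p := lt_le_trans ltr01 p1.
rewrite /lp_norm.
have -> : \sum_i `|(\row_(j < size us) (l * dot us`_j x)) ord0 i| `^ p =
    l `^ p * psum p us x.
  rewrite /psum (big_nth 0) big_mkord mulr_sumr; apply: eq_bigr => i _.
  by rewrite mxE normrM (ger0_norm l0) powRM.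
by rewrite powRM ?powR_ge0 ?psum_ge0// -powRrM mulfV ?gt_eqF// powRr1.
Qed.

(** The factor (1 - dl)^-2 makes the map noncontracting; the distortion is then at most ((1 + dl)/(1
    - dl))^2 <= 1 + 8 dl. *)
Lemma distortion_bound (R : realFieldType) (dl n y z : R) :
  0 < dl <= 1 / 16 -> 0 < n -> n - dl * n <= y <= n + dl * n ->
  (1 - dl) * y <= z <= (1 + dl) * y ->
  n <= ((1 - dl) ^+ 2)^-1 * z <= (1 + 8 * dl) * n.
Proof.
move=> /andP[d0 d1] n0 /andP[y1 y2] /andP[z1 z2].
have dd : 0 < 1 - dl by lra.
have d2 : 0 < (1 - dl) ^+ 2 by rewrite exprn_gt0.
apply/andP; split.
  rewrite ler_pdivlMl//; apply: le_trans z1.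
  by rewrite expr2 -mulrA ler_pM2l//; lra.
rewrite ler_pdivrMl// mulrA; apply: le_trans z2 _.
apply: (@le_trans _ _ ((1 + dl) * ((1 + dl) * n))).
  by rewrite ler_pM2l; lra.
rewrite mulrA ler_pM2r//.
have : dl * dl <= dl * (1 / 16) by rewrite ler_pM2l.
have : 0 <= dl * dl * dl by rewrite !mulr_ge0// ltW.
lra.
Qed.

Lemma subspace_embeds (R : realType) (p : R) (p1 : 1 <= p) m :
  (0 < m)%N ->
  let b := 1 / 2 + (2 * p + 1) / (2 * m%:R) in
  exists (K : R) (N1 : nat), 0 < K /\ 
  forall (E : submodClosed (Lp01 p1)) (eps : R) (N : nat),
    has_dim E m.+1 -> 0 < eps < 1 / 2 -> (N1 <= N)%N -> K * N%:R `^ (- b) <= eps ->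
    exists2 M, (M <= N)%N & embeds E eps M.
Proof.
move=> m0 b; have [C [N1 [C0 N10 sparse]]] := sparsification p1 m0.
have p0 : 0 < p := lt_le_trans ltr01 p1.
(* At each basis vector the p-th root of [psum] is at most 1 + eta <= 2. *)
pose A : R := m.+1%:R * 2 `^ p.
have A0 : 0 < A by rewrite mulr_gt0// ?ltr0n// powR_gt0.
exists (8 * 4 `^ p * (A * C)), N1; split.
  by apply: mulr_gt0; apply: mulr_gt0 => //; exact: powR_gt0.
move=> E eps N dimE /andP[e0 e2] N1N hK.
have [bs [coord [bs1 coordL coordE]]] := auerbach_basis (@Lp01_normD _ _ p1)
  (@Lp01_normZ _ _ p1) (@Lp01_norm_eq0 _ _ p1) dimE.
pose dl := eps / 8; pose eta := dl / (2 * m.+1%:R).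
have dl0 : 0 < dl by rewrite divr_gt0.
have dl1 : dl <= 1 / 16 by rewrite /dl; lra.
have m1 : 1 <= m.+1%:R :> R by rewrite ler1n.
have eta0 : 0 < eta by rewrite divr_gt0// mulr_gt0// (lt_le_trans ltr01).
have etaE : 2 * m.+1%:R * eta = dl.
  by rewrite mulrC divfK// mulf_neq0 ?pnatr_eq0.
have eta1 : eta <= 1.
  apply: le_trans (_ : dl <= 1); last lra.
  by rewrite -etaE ler_peMl ?(ltW eta0)//; lra.
have [us hus] := Lp01_discretization bs eta0.
have massA : mass p us <= A.
  rewrite mass_psum -[leRHS]/(m.+1%:R * 2 `^ p) mulr_natl -[m.+1 in leRHS]card_ord -sumr_const.
  apply: ler_sum => s _.
  have := hus (delta_mx 0 s).
  have -> : \sum_t (delta_mx 0 s : 'rV[R]_m.+1) 0 t *: bs t = bs s.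
    rewrite (bigD1 s) //= mxE !eqxx scale1r big1 ?addr0// => t /negPf ts.
    by rewrite mxE ts andbF scale0r.
  have -> : \sum_t `|(delta_mx 0 s : 'rV[R]_m.+1) 0 t| = 1.
    rewrite (bigD1 s) //= mxE !eqxx normr1 big1 ?addr0// => t /negPf ts.
    by rewrite mxE ts andbF normr0.
  rewrite mul1r ler_distl => /andP[_ h].
  have h2 : psum p us (delta_mx 0 s) `^ p^-1 <= 2.
    by apply: le_trans h _; have := bs1 s; lra.
  have -> : psum p us (delta_mx 0 s) = (psum p us (delta_mx 0 s) `^ p^-1) `^ p.
    by rewrite -powRrM mulVf ?gt_eqF// powRr1// psum_ge0.
  by rewrite ge0_ler_powR ?nnegrE ?powR_ge0// ltW.
have [us' [size' hus']] := sparse us A N A0 massA N1N.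
exists (size us') => //.
pose l := ((1 - dl) ^+ 2)^-1.
have l0 : 0 < l by rewrite invr_gt0 exprn_gt0//; lra.
exists (fun x => \row_(j < size us') (l * dot us'`_j (coord x))); split.
  move=> a x y xE yE; apply/rowP => j; rewrite !mxE coordL// dotDr dotZr.
  by rewrite mulrDr mulrCA.
move=> x xE; rewrite lp_norm_scaled_dots// ?(ltW l0)//.
have [xE2 cle] := coordE x xE.
have := norm_nonneg (@Lp01_normD _ _ p1) (@Lp01_normZ _ _ p1) x.
set c := coord x in xE2 cle *; set n := Lp01_norm x in cle *.
rewrite le_eqVlt => /predU1P[n0|n0].
  have c0 : c = 0.
    apply/rowP => t; apply/eqP; rewrite mxE -normr_eq0.
    by rewrite eq_le normr_ge0 (le_trans (cle t))// -n0 mulr0.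
  rewrite -n0 mulr0 c0 -[X in psum _ _ X](scale0r (0 : 'rV[R]_m.+1)) psumZ normr0.
  rewrite powR0 ?gt_eqF// mul0r.
  by rewrite powR0 ?invr_eq0 ?gt_eqF// mulr0 lexx.
set Y := psum p us c; set Z := psum p us' c.
have sc : \sum_s `|c 0 s| <= 2 * m.+1%:R * n.
  apply: le_trans (_ : \sum_(s < m.+1) 2 * n <= _); first exact: ler_sum.
  by rewrite sumr_const card_ord -[leLHS]mulr_natl mulrCA mulrA.
have Yn : `|Y `^ p^-1 - n| <= dl * n.
  have := hus c; rewrite -xE2 => h; apply: le_trans h _.
  by rewrite -etaE mulrAC ler_wpM2r// ltW.
have Y0 : 0 <= Y by exact: psum_ge0.
move: Yn; rewrite ler_distl => /andP[Ylo Yhi].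
have nY : 2 * n <= 4 * Y `^ p^-1.
  have : dl * n <= 1 / 16 * n by rewrite ler_wpM2r// ltW.
  lra.
have ZY : `|Z - Y| <= dl * Y.
  (* The coordinates are at most 2n and 2n <= 4 Y^(1/p), so the error is at most 4^p A C N^(-b) Y;
     the constant [K] makes this at most dl Y. *)
  have h := psum_homogeneous_error hus' (_ : 0 < 2 * n) cle.
  apply: le_trans (h _) _; first by rewrite mulr_gt0.
  have h4 : (2 * n) `^ p <= 4 `^ p * Y.
    have -> : 4 `^ p * Y = (4 * Y `^ p^-1) `^ p.
      by rewrite powRM ?powR_ge0// -powRrM mulVf ?gt_eqF// powRr1.
    by rewrite ge0_ler_powR ?nnegrE ?mulr_ge0 ?powR_ge0 ?(ltW n0) ?(ltW p0).
  apply: le_trans (ler_wpM2r _ h4) _.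
    by rewrite mulr_ge0 ?powR_ge0// mulr_ge0// ltW.
  have h8 : 4 `^ p * (A * C * N%:R `^ (- b)) <= dl.
    rewrite /dl; move: hK; rewrite -!mulrA; lra.
  by rewrite mulrAC ler_wpM2r.
have /andP[Zlo Zhi] : (1 - dl) * Y `^ p^-1 <= Z `^ p^-1 <= (1 + dl) * Y `^ p^-1.
  by apply: powR_root_between => //; rewrite (ltW dl0); lra.
have -> : eps = 8 * dl by rewrite /dl; lra.
by apply: (distortion_bound (y := Y `^ p^-1)); rewrite ?dl0 ?Ylo ?Zlo.
Qed.

Theorem theorem1p1 (R : realType) (d : nat) (hd : (2 <= d)%N)
    (p : R) (hp : 1 <= p) :
  exists2 C : R, 0 < C &
    forall eps : R, 0 < eps < 1 / 2 ->
      (Np hp d eps <=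
        (C * eps `^ (- (2 * (d%:R - 1) / (d%:R + 2 * p))))%:E)%E.
Proof.
case: d hd => [//|m] m0; rewrite ltnS in m0.
have [K [N1 [K0 emb]]] := subspace_embeds hp m0.
set b := 1 / 2 + _ in emb.
have mR : 0 < m%:R :> R by rewrite ltr0n.
have b0 : 0 < b by rewrite addr_gt0// ?divr_gt0// ?mulr_gt0//; lra.
have eb : 2 * (m.+1%:R - 1) / (m.+1%:R + 2 * p) = b^-1.
  have -> : b = (m.+1%:R + 2 * p) / (2 * m%:R).
    have mi : m%:R * m%:R^-1 = 1 :> R by rewrite mulfV ?gt_eqF.
    rewrite /b -[m.+1%:R]natr1 !invfM; move: (m%:R^-1) mi => y mi; lra.
  by rewrite invf_div -[m.+1%:R]natr1 addrK.
rewrite {}eb.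
exists (N1.+1%:R + K `^ b^-1); first by rewrite ltr_pwDl// powR_ge0.
move=> eps he; have /andP[e0 e2] := he.
apply: ge_ereal_sup => _ [E /= dimE <-].
pose X := (K / eps) `^ b^-1.
have X0 : 0 <= X by exact: powR_ge0.
(* The order of eps^(-1/b), just large enough for K N^(-b) <= eps. *)
pose N := (N1 + (Num.truncn X).+1)%N.
have XN : X <= N%:R.
  rewrite ltW// (lt_le_trans (truncnS_gt X))// ler_nat leq_addl//.
have [||M MN eM] := emb E eps N dimE he.
- exact: leq_addr.
- have : K / eps <= N%:R `^ b.
    have -> : K / eps = X `^ b.
      by rewrite /X -powRrM mulVf ?gt_eqF// powRr1// divr_ge0// ltW.
    by rewrite ge0_ler_powR ?nnegrE// ltW.
  rewrite powRN ler_pdivrMr// => h.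
  rewrite ler_pdivrMr; first by rewrite mulrC.
  by rewrite powR_gt0// ltr0n /N addnS.
apply: (@le_trans _ _ M%:R%:E); first by apply: ereal_inf_lbound; exists M.
rewrite lee_fin; apply: (@le_trans _ _ N%:R); first by rewrite ler_nat.
(* As eps < 1, the additive constant N1 + 1 is absorbed by the power of eps. *)
have ie1 : 1 <= eps `^ (- b^-1).
  rewrite powRN invf_ge1 ?powR_gt0//.
  have <- : 1 `^ b^-1 = 1 by rewrite powR1.
  by rewrite ge0_ler_powR ?nnegrE ?invr_ge0 ?(ltW b0) ?(ltW e0)//; lra.
have -> : N%:R = N1.+1%:R + (Num.truncn X)%:R :> R by rewrite -natrD addSnnS.
rewrite mulrDl lerD// ?ler_peMr//.
have tX : (Num.truncn X)%:R <= X by rewrite truncn_le.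
apply: le_trans tX _; rewrite /X powRM ?invr_ge0 ?(ltW K0) ?(ltW e0)//.
by rewrite -(powR_inv1 (ltW e0)) -powRrM mulN1r.
Qed.
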